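(* Let $\mathfrak{g}$ be a finite-dimensional complex Lie algebra, $\bar\rho:\mathrm{SL}(2,\mathbb{C})\to\mathrm{Aut}(\mathfrak{g})$ a representation, and $P$ a relatively invariant form (of degree $|\Gamma|$, vanishing on a $\Gamma$-orbit $S$) of the group $B\Gamma\subset\mathrm{SU}(2)$. The automorphic Lie algebra $\mathfrak{g}[X,Y,P^{-1}]^{B\Gamma}_0$ defined by $\bar\rho$ and $P$ is generated by $$\bigoplus_{k}P_k\,\Phi_{P,\bar\rho}(\mathfrak{g}_k)$$ as a module over the invariant functions $\mathbb{C}[X,Y,P^{-1}]^{B\Gamma}_0$, where $\mathfrak{g}_k$ is the eigenspace with eigenvalue $k$ of $H=\mathrm{d}\bar\rho(\mathrm{diag}(1,-1))$.
   Context: $\Gamma\subset \mathrm{SO}(3)$ is a polyhedral group, i.e. a finite subgroup, and $B\Gamma\subset\mathrm{SU}(2)$ is its full preimage under the double cover $\mathrm{SU}(2)\to\mathrm{SO}(3)$, so $\Gamma\cong B\Gamma/\{\pm\mathrm{Id}\}$ acts on the Riemann sphere (the complex projective line of lines in $\mathbb{C}^2$). $\Omega$ indexes the $\Gamma$-orbits $S_i$ whose elements have nontrivial stabiliser; $d_i=|S_i|$, $\nu_i$ is the stabiliser order, $d_i\nu_i=|\Gamma|$; $P_i\in\mathbb{C}[X,Y]$ is a homogeneous polynomial of degree $d_i$ vanishing on $S_i$ (a ground form, unique up to scalar). $B\Gamma$ acts on $\mathbb{C}[X,Y]$ by $(\gamma f)(v)=f(\gamma^{-1}v)$, $v=(X,Y)^T$.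 $S$ is any $\Gamma$-orbit and $P$ is a homogeneous polynomial of degree $|\Gamma|$ with zero set $S$ which each $\gamma\in B\Gamma$ multiplies by a scalar (unique up to a nonzero scalar). $\mathfrak{g}[X,Y,P^{-1}]=\mathfrak{g}\otimes_{\mathbb{C}}\mathbb{C}[X,Y,P^{-1}]$ carries the $\mathbb{C}[X,Y,P^{-1}]$-bilinear bracket and the action $(\gamma\cdot f)(v)=\bar\rho(\gamma)f(\gamma^{-1}v)$ of $B\Gamma$; subscript $k$ denotes homogeneous degree $k$ in $X,Y$ and superscript $B\Gamma$ denotes invariants. $\bar\rho$ is a homomorphism of complex Lie groups with derivative $\mathrm{d}\bar\rho$; $H,E,F$ are the images under $\mathrm{d}\bar\rho$ of $\begin{pmatrix}1&0\\0&-1\end{pmatrix},\begin{pmatrix}0&1\\0&0\end{pmatrix},\begin{pmatrix}0&0\\1&0\end{pmatrix}$. $\Phi_{P,\bar\rho}=\bar\rho(\Phi_{P,1})$ with $\Phi_{P,1}=\begin{pmatrix}\frac{\partial_YP}{\deg(P)P}&X\\-\frac{\partial_XP}{\deg(P)P}&Y\end{pmatrix}$ (determinant $1$), i.e. $\Phi_{P,\bar\rho}=\exp[\frac{X}{Y}E]\exp[-\frac{Y\partial_XP}{\deg(P)P}F]\exp[-\ln(Y)H]$, where $\exp[-\ln(Y)H]$ multiplies $\mathfrak{g}_k$ by $Y^{-k}$. For $k$ odd $P_k=0$; for $k$ even $$P_k=P^{\ell}\prod_{i\in\Omega}P_i^{\mathsf{n}(k)_i},\qquad \ell=\frac{k-\sum_i\mathsf{n}(k)_id_i}{|\Gamma|},$$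 where $\mathsf{n}(k)_i\in\{0,\ldots,\nu_i-1\}$ is the residue of $k/2$ modulo $\nu_i$. *)

(* Defs.v *)
From HB Require Import structures.
From mathcomp Require Import all_boot all_order all_algebra.
From mathcomp Require Import finmap complex.
From mathcomp Require Import all_classical all_reals all_analysis.
From mathcomp Require mpoly.
(* The notations of [mpoly] clash with those of MathComp-Analysis. *)
Import -(notations) mpoly.

Set Implicit Arguments.
Unset Strict Implicit.
Unset Printing Implicit Defensive.

Import Order.TTheory GRing.Theory Num.Theory.
Import numFieldNormedType.Exports.

Local Open Scope classical_set_scope.
Local Open Scope ring_scope.
Local Open Scope complex_scope.
Local Open Scope sesquilinear_scope.

Definition mx2 (K : Type) (a b c d : K) : 'M[K]_2 :=
  \matrix_(i, j) if i == 0 then (if j == 0 then a else b)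
                 else (if j == 0 then c else d).

(** Holomorphic functions on the complex submanifold SL(2) of the space of
    2x2 matrices: near each point they extend to a complex differentiable
    function of all four matrix entries. *)
Section HolomorphicSL2.
Variable K : numFieldType.
Implicit Types (f h : 'M[K]_2 -> K) (M A : 'M[K]_2).

Definition local_extension_SL2 f h (M0 : 'M[K]_2) : Prop :=
  \forall M \near M0, differentiable h M /\ (\det M = 1 -> h M = f M).

Definition holomorphic_SL2 f : Prop :=
  forall M, \det M = 1 -> exists h, local_extension_SL2 f h M.

(* [d] is the value at [A] of the differential at the identity of [f]; for a
   tangent vector, i.e. [\tr A = 0], it does not depend on the extension. *)
Definition differential_SL2 f A (d : K) : Prop :=
  exists2 h, local_extension_SL2 f h 1%:M & 'd h (1%:M : 'M[K]_2) A = d.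

End HolomorphicSL2.

Section LieAlgebra.
Variables (R : realType) (g : vectType R[i]).

Definition is_lie_bracket (br : {bilinear g -> g -> g | *:%R & *:%R}) : Prop :=
  (forall x, br x x = 0) /\
  (forall x y z, br x (br y z) + br y (br z x) + br z (br x y) = 0).

(* Only the values of [rho] on matrices of determinant 1 are meaningful.
   Holomorphy of a map into the finite-dimensional space 'End(g) is holomorphy
   of its matrix coefficients. *)
Record lie_group_rep (br : g -> g -> g) (rho : 'M[R[i]]_2 -> 'End(g)) : Prop := {
  rep_one : rho 1%:M = \1%VF;
  rep_mul : forall A B, \det A = 1 -> \det B = 1 ->
    rho (A *m B) = (rho A \o rho B)%VF;
  rep_bracket : forall A, \det A = 1 ->
    forall x y, rho A (br x y) = br (rho A x) (rho A y);
  rep_holomorphic : forall (phi : 'Hom(g, R[i]^o)) (x : g),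
    holomorphic_SL2 (fun M => phi (rho M x)) }.

(* The derivative of [rho] at the identity, for traceless [A]. *)
Definition drho (rho : 'M[R[i]]_2 -> 'End(g)) (A : 'M[R[i]]_2) : 'End(g) :=
  xget 0 [set D : 'End(g) | forall (phi : 'Hom(g, R[i]^o)) (x : g),
            differential_SL2 (fun M => phi (rho M x)) A (phi (D x))].

Definition weight_space (rho : 'M[R[i]]_2 -> 'End(g)) (k : int) : {vspace g} :=
  passmx.leigenspace (drho rho (mx2 1 0 0 (-1))) k%:~R.

End LieAlgebra.

Section PolyhedralGroups.
Variable R : realType.
Local Notation C := R[i].
Local Notation line := {vspace 'cV[C]_2}.

Definition SU2 : set 'M[C]_2 := [set U | U \is unitarymx /\ \det U = 1].

Definition pauli (i : 'I_3) : 'M[C]_2 :=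
  nth 0 [:: mx2 0 1 1 0; mx2 0 (- 'i%C) 'i%C 0; mx2 1 0 0 (-1)] i.

(* The action of SU(2) by conjugation on traceless Hermitian matrices, in the
   basis of Pauli matrices, which is orthonormal for (1/2) tr(A B). *)
Definition double_cover (U : 'M[C]_2) : 'M[R]_3 :=
  \matrix_(i, j) complex.Re (2^-1 * \tr (pauli i *m U *m pauli j *m U ^t*)).

Record finite_subgroup_SO3 (G : {fset 'M[R]_3}) : Prop := {
  SO3_orthogonal : forall A, A \in G -> A *m A^T = 1%:M /\ \det A = 1;
  SO3_one : 1%:M \in G;
  SO3_mul : forall A B, A \in G -> B \in G -> A *m B \in G;
  SO3_inv : forall A, A \in G -> invmx A \in G }.

Definition binary_group (G : {fset 'M[R]_3}) : set 'M[C]_2 :=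
  SU2 `&` [set U | double_cover U \in G].

(* Points of the Riemann sphere are the [L : line] with [\dim L = 1]. *)
Definition act_line (U : 'M[C]_2) (L : line) : line :=
  (linfun (mulmx U) @: L)%VS.

Definition orbit_line (G : {fset 'M[R]_3}) (L : line) : set line :=
  [set act_line U L | U in binary_group G].

Definition is_orbit (G : {fset 'M[R]_3}) (S : set line) : Prop :=
  exists2 L : line, \dim L = 1%N & S = orbit_line G L.

(* [A] in [G] acts on lines through any of its two lifts to SU(2). *)
Definition stab_order (G : {fset 'M[R]_3}) (L : line) : nat :=
  #|` [fset A in G | `[< exists U, [/\ SU2 U, double_cover U = A
                                     & act_line U L = L] >]]%fset |.

Definition exceptional_orbits (G : {fset 'M[R]_3}) : set (set line) :=
  [set S | is_orbit G S /\ forall L, S L -> (1 < stab_order G L)%N].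

End PolyhedralGroups.

Section Forms.
Variable R : realType.
Local Notation C := R[i].
Local Notation form := (mpoly 2 C).
Implicit Types (P q : form) (v : 'cV[C]_2).

Definition ev q v : C := meval (fun i => v i 0) q.

Definition homogeneous (d : nat) q : bool := q \is ishomog1 d mdeg.

Definition vanishes_on q (L : {vspace 'cV[C]_2}) : Prop :=
  forall v, v \in L -> ev q v = 0.

Definition relatively_invariant (B : set 'M[C]_2) q : Prop :=
  forall U, B U -> exists c : C, forall v, ev q (invmx U *m v) = c * ev q v.

Definition degree P : nat := (msize P).-1.

(* Elements of V[X,Y,1/P] are identified with V-valued functions on the
   complement of the zero set of P. *)
Definition domain P : Type := {v : 'cV[C]_2 | ev P v != 0}.

(* V[X,Y,1/P]_k : combinations of vectors of V with coefficients q / P^n, where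
   q is a form of degree k + n deg P. *)
Definition localized P (V : lmodType C) (k : int) : set (domain P -> V) :=
  [set f | exists (n m r : nat) (q : 'I_r -> form) (x : 'I_r -> V),
     [/\ m%:Z = k + (n * degree P)%:Z,
         forall j, homogeneous m (q j)
       & f = fun v : domain P =>
           \sum_(j < r) (ev (q j) (val v) / ev P (val v) ^+ n) *: x j]].

(* (U . f)(v) = rho(U) f(U^-1 v). The default value [v] of [insubd] is never
   used when [U] multiplies [P] by a scalar: [domain P] is then stable. *)
Definition act P (V : lmodType C) (rho : 'M[C]_2 -> V -> V) (U : 'M[C]_2)
    (f : domain P -> V) : domain P -> V :=
  fun v : domain P => rho U (f (insubd v (invmx U *m val v))).

Definition invariants P (V : lmodType C) (rho : 'M[C]_2 -> V -> V)
    (B : set 'M[C]_2) (k : int) : set (domain P -> V) :=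
  [set f | localized k f /\ forall U, B U -> act rho U f = f].

Definition invariant_functions P (B : set 'M[C]_2) : set (domain P -> C) :=
  @invariants P C^o (fun _ => id) B 0.

(* The Lie bracket is the pointwise one. *)
Definition automorphic_lie_algebra P (g : vectType C)
    (rho : 'M[C]_2 -> 'End(g)) (B : set 'M[C]_2) : set (domain P -> g) :=
  invariants (fun U => rho U) B 0.

Definition Phi1 P (v : domain P) : 'M[C]_2 :=
  let D := (degree P)%:R * ev P (val v) in
  mx2 (ev (mderiv 1 P) (val v) / D)     (val v 0 0)
      (- (ev (mderiv 0 P) (val v) / D)) (val v 1 0).

Definition Phi P (g : vectType C) (rho : 'M[C]_2 -> 'End(g)) (v : domain P)
  : 'End(g) := rho (Phi1 v).

Definition residue (nu : nat) (k : int) : nat := `|((k %/ 2)%Z %% nu)%Z|%N.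

(* [N] is the order of the group; for even [k] the division in the exponent of
   [P] is exact. *)
Definition Pk (I : finType) (N : nat) (d nu : I -> nat) (p : I -> form) P
    (k : int) (v : domain P) : C :=
  if (2 %| k)%Z then
    ev P (val v) ^ ((k - (\sum_i residue (nu i) k * d i)%N%:Z) %/ N)%Z
    * \prod_i ev (p i) (val v) ^+ residue (nu i) k
  else 0.

End Forms.

Arguments invariant_functions {R} P B.
Arguments automorphic_lie_algebra {R} P {g} rho B.

Section Modules.
Variables (K : fieldType) (T : Type) (V : lmodType K).

Definition sum_of (W : int -> set (T -> V)) : set (T -> V) :=
  [set f | exists (s : {fset int}) (w : int -> T -> V),
     (forall k, W k (w k)) /\ f = fun t => \sum_(k <- s) w k t].

Definition sum_direct (W : int -> set (T -> V)) : Prop :=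
  forall (s : {fset int}) (w : int -> T -> V), (forall k, W k (w k)) ->
  (forall t, \sum_(k <- s) w k t = 0) -> forall k, k \in s -> w k = fun=> 0.

Definition generated_module (A : set (T -> K)) (X : set (T -> V))
  : set (T -> V) :=
  [set f | exists (n : nat) (a : 'I_n -> T -> K) (x : 'I_n -> T -> V),
     [/\ forall j, A (a j), forall j, X (x j)
       & f = fun t => \sum_(j < n) a j t *: x j t]].

End Modules.

(* Main.v *)
Require Import Defs.
From HB Require Import structures.
From mathcomp Require Import all_boot all_order all_algebra.
From mathcomp Require Import finmap complex.
From mathcomp Require Import all_classical all_reals all_analysis.
From mathcomp Require mpoly.
From mathcomp Require Import ring lra zify.
Import -(notations) mpoly.

Set Implicit Arguments.
Unset Strict Implicit.
Unset Printing Implicit Defensive.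

Import Order.TTheory GRing.Theory Num.Theory.
Import numFieldNormedType.Exports.

Local Open Scope classical_set_scope.
Local Open Scope ring_scope.
Local Open Scope complex_scope.

(** The matrix [Phi] has determinant 1 by Euler's identity, it satisfies
    [Phi (U v) = U Phi v] for [U] in the binary group because [P] is
    semi-invariant, and [Phi (t v) = Phi v diag(t^-1, t)] because its columns
    have degrees -1 and 1. Hence, for an invariant function [f] of degree 0, the
    scalar components of [Phi^-1 f] in a basis of weight vectors are invariant
    under the substitution of [U v] for [v], and the component of weight [k] is
    homogeneous of degree [k]. The theorem thus reduces to scalar invariants:
    those of degree [k] are the multiples of [P_k] by invariants of degree 0.

    For odd [k] there are none, since [- 1] belongs to the group. For even [k] an
    element [U] of the binary group has a fixed point [w] on the sphere, with
    eigenvalue [z], and the factor by which [U] multiplies a form is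
    [z ^ (degree - 2 * order at w)] ([order_character]). The form [P] vanishes on
    its orbit to the order of the stabiliser ([P_order]), the ground forms have
    simple zeros, and Riemann-Hurwitz, obtained by counting fixed points in two
    ways, makes [P_k] a function of degree [k] ([Pk_degree]); these facts show
    that [P_k] is invariant ([Pk_invariant]). Conversely an invariant of degree
    [k] vanishes at an exceptional point to an order congruent to [k / 2] modulo
    the order of the stabiliser, so it is divisible by the residue powers of the
    ground forms ([invariant_factor]). The action on lines of an element of the
    group is read off from a lift to SU(2), which exists because the double cover
    is onto ([double_cover_surj]).

    For [Phi^-1 f] to have coefficients in the localisation at [P], the matrix
    coefficients of the holomorphic representation must be polynomials in the
    entries ([coefficient_regular]), and the argument needs a basis of integral
    weight vectors. Along the torus the representation solves a linear
    differential equation; as the torus closes up at [2 pi i], the operator [H] is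
    diagonalisable with integral eigenvalues ([weight_basis]). Conjugation by the
    torus rescales the unipotent matrices [shear z], so that in the weight basis
    their coefficients are monomials in [z] ([shear_monomial]). The Bruhat
    decomposition then makes each coefficient polynomial on the two open cells
    where an entry of the first column is invertible, and the two expressions are
    glued. That the sum is direct follows from the invertibility of [Phi] and the
    independence of the weight spaces ([weight_sum_direct]). *)

(** * Binary forms as functions on the plane *)

Section Dimension2.

Lemma I2P (i : 'I_2) : {i = 0} + {i = 1}.
Proof.
by case: i => -[|[|//]] Hi; [left|right]; apply: val_inj.
Qed.

Lemma lift00 : lift 0 0 = 1 :> 'I_2. Proof. exact: val_inj. Qed.
Lemma lift10 : lift 1 0 = 0 :> 'I_2. Proof. exact: val_inj. Qed.

Lemma sum2E (V : nmodType) (F : 'I_2 -> V) : \sum_i F i = F 0 + F 1.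
Proof. by rewrite !big_ord_recl big_ord0 addr0 lift00. Qed.

Lemma det2E (K : comNzRingType) (U : 'M[K]_2) :
  \det U = U 0 0 * U 1 1 - U 0 1 * U 1 0.
Proof.
rewrite (expand_det_row _ 0) sum2E /cofactor !det_mx11 !mxE.
by rewrite lift00 lift10 addn0 add0n expr0 expr1 mul1r mulN1r mulrN.
Qed.

End Dimension2.

Section BinaryForms.
Variable C : numClosedFieldType.
Local Notation vec := 'cV[C]_2.
Implicit Types (u v w : vec) (f h : vec -> C).

(** Evaluation over an arbitrary field; over [R[i]] it is convertible to [ev]. *)
Definition evalv (q : mpoly 2 C) v : C := meval (fun i => v i 0) q.

(** The determinant of the columns [w] and [v]. As a function of [v] it is the
    linear form that vanishes on the line spanned by [w]. *)
Definition area (w v : vec) : C := w 0 0 * v 1 0 - w 1 0 * v 0 0.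

Definition vec2 (a b : C) : vec := \col_i (if i == 0 then a else b).

Lemma vec2E0 a b : vec2 a b 0 0 = a. Proof. by rewrite mxE. Qed.
Lemma vec2E1 a b : vec2 a b 1 0 = b. Proof. by rewrite mxE. Qed.

Lemma vec_eqP u v : u 0 0 = v 0 0 -> u 1 0 = v 1 0 -> u = v.
Proof.
move=> e0 e1; apply/matrixP => i j; rewrite !ord1.
by case: (I2P i) => ->.
Qed.

Lemma prod2E (F : 'I_2 -> C) : \prod_i F i = F 0 * F 1.
Proof.
by rewrite !big_ord_recl big_ord0 mulr1 lift00.
Qed.

Lemma mpoly_ring_ind n (T : mpoly n C -> Prop) :
  (forall c, T (mpolyC n c)) -> (forall i, T (mpolyX C (mnm1 i))) ->
  (forall p q, T p -> T q -> T (p + q)) ->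
  (forall p q, T p -> T q -> T (p * q)) -> forall q, T q.
Proof.
move=> TC TX TD TM; elim/mpolyind => [|c m p _ _ Tp].
  by rewrite -(mpolyC0 n C); apply: TC.
apply: (TD) => //; rewrite -mul_mpolyC; apply: (TM) => //.
have T1 : T 1 by rewrite -(mpolyC1 n C); apply: (TC).
rewrite mpolyXE_id; apply: (big_ind T T1 TM) => i _.
by elim: (m i) => [|k IH]; rewrite ?expr0 // exprS; apply: TM.
Qed.

Lemma mulmx2E (U : 'M[C]_2) v i : (U *m v) i 0 = U i 0 * v 0 0 + U i 1 * v 1 0.
Proof. by rewrite mxE sum2E. Qed.

(** Forms are used through the functions they define, so that they can be divided
    and composed without any computation with monomials. *)
Definition is_form (m : nat) f : Prop :=
  exists2 q, (q \is ishomog1 m mdeg) & forall v, f v = evalv q v.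

Lemma evD q r v : evalv (q + r) v = evalv q v + evalv r v.
Proof. exact: mevalD. Qed.

Lemma evM q r v : evalv (q * r) v = evalv q v * evalv r v.
Proof. exact: mevalM. Qed.

Lemma is_form_ev m q : (q \is ishomog1 m mdeg) -> is_form m (evalv q).
Proof. by exists q. Qed.

Lemma is_form0 m : is_form m (fun=> 0).
Proof.
by exists 0 => [|v]; [exact: dhomog0 | exact/esym/meval0].
Qed.

Lemma is_formD m f h : is_form m f -> is_form m h ->
  is_form m (fun v => f v + h v).
Proof.
move=> [q hq eq_] [r hr er]; exists (q + r); first exact: dhomogD.
by move=> v; rewrite eq_ er /evalv mevalD.
Qed.

Lemma is_formM m n f h : is_form m f -> is_form n h ->
  is_form (m + n) (fun v => f v * h v).
Proof.
move=> [q hq eq_] [r hr er]; exists (q * r); first exact: dhomogM.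
by move=> v; rewrite eq_ er /evalv mevalM.
Qed.

Lemma is_formZ m c f : is_form m f -> is_form m (fun v => c * f v).
Proof.
move=> [q hq eq_]; exists (c *: q); first exact: dhomogZ.
by move=> v; rewrite eq_ /evalv mevalZ.
Qed.

Lemma is_form_const c : is_form 0 (fun=> c).
Proof.
exists (mpolyC 2 c) => [|v]; last by rewrite /evalv mevalC.
by rewrite -[mpolyC 2 c]mulr1 mul_mpolyC; apply/dhomogZ/dhomog1.
Qed.

Lemma is_form_coord i : is_form 1 (fun v => v i 0).
Proof.
exists (mpolyX C (mnm1 i)) => [|v]; last by rewrite /evalv mevalXU.
by rewrite dhomogX; apply/eqP/mdeg1.
Qed.

Lemma eq_is_form m f h : f =1 h -> is_form m f -> is_form m h.
Proof. by move=> /funext ->. Qed.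

Lemma eq_degree m n f : m = n -> is_form m f -> is_form n f.
Proof. by move->. Qed.

Lemma is_form_area w : is_form 1 (area w).
Proof.
apply: (@eq_is_form _ (fun v => w 0 0 * v 1 0 + (- w 1 0) * v 0 0)).
  by move=> v; rewrite mulNr.
by apply: is_formD; apply: is_formZ; apply: is_form_coord.
Qed.

Lemma is_formX m n f : is_form m f -> is_form (m * n) (fun v => f v ^+ n).
Proof.
move=> [q hq eq_]; exists (q ^+ n); first exact: dhomogMn.
by move=> v; rewrite eq_ /evalv rmorphXn.
Qed.

Lemma is_form_prod (I : Type) (s : seq I) (m : I -> nat) (F : I -> vec -> C) :
  (forall i, is_form (m i) (F i)) ->
  is_form (\sum_(i <- s) m i) (fun v => \prod_(i <- s) F i v).
Proof.
move=> hF; elim: s => [|i s IH].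
  by rewrite big_nil; apply: eq_is_form (is_form_const 1) => v; rewrite big_nil.
rewrite big_cons; apply: eq_is_form (is_formM (hF i) IH) => v.
by rewrite big_cons.
Qed.

Lemma is_form_sum (I : Type) (s : seq I) m (F : I -> vec -> C) :
  (forall i, is_form m (F i)) -> is_form m (fun v => \sum_(i <- s) F i v).
Proof.
move=> hF; elim: s => [|i s IH].
  by apply: eq_is_form (is_form0 m) => v; rewrite big_nil.
by apply: eq_is_form (is_formD (hF i) IH) => v; rewrite big_cons.
Qed.

Lemma is_form_expand m f : is_form m f -> exists c : nat -> C, forall v,
  f v = \sum_(j < m.+1) c j * v 0 0 ^+ (m - j) * v 1 0 ^+ j.
Proof.
move=> [q hq eq_].
suff [c hc] : exists c : nat -> C, forall v,
    \sum_(a <- msupp q) mcoeff a q * \prod_i v i 0 ^+ a i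
    = \sum_(j < m.+1) c j * v 0 0 ^+ (m - j) * v 1 0 ^+ j.
  by exists c => v; rewrite eq_ /evalv mevalE hc.
move/dhomogP: hq; elim: (msupp q) => [|a s IH] hs.
  exists (fun=> 0) => v; rewrite big_nil big1 // => j _; by rewrite !mul0r.
have [|c hc] := IH; first by move=> b bs; apply: hs; rewrite inE bs orbT.
have ha : mdeg a = m by apply: hs; rewrite inE eqxx.
exists (fun j => c j + (j == a 1%R)%:R * mcoeff a q) => v.
rewrite big_cons hc prod2E.
under [RHS]eq_bigr do rewrite !mulrDl.
rewrite big_split /= addrC; congr (_ + _).
have ha1 : (a 1%R < m.+1)%N by rewrite -ha ltnS mdegE sum2E leq_addl.
rewrite (bigD1 (Ordinal ha1)) //= eqxx mul1r big1 ?addr0 => [|j nj].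
  by rewrite -ha mdegE sum2E addnK mulrA.
by rewrite (_ : (_ == _) = false) ?mul0r //; apply: contra_neqF nj => /eqP e; apply: val_inj.
Qed.

(** A form stays a form of the same degree under a linear change of variables,
    because the substituted expressions are themselves forms of degree one. *)
Lemma is_form_subst m f (l0 l1 : vec -> C) :
  is_form m f -> is_form 1 l0 -> is_form 1 l1 ->
  is_form m (fun v => f (vec2 (l0 v) (l1 v))).
Proof.
move=> /is_form_expand [c hc] h0 h1.
apply: (@eq_is_form _ (fun v =>
  \sum_(j < m.+1) c j * (l0 v ^+ (m - j) * l1 v ^+ j))).
  by move=> v; rewrite hc vec2E0 vec2E1; under eq_bigr do rewrite mulrA.
apply: is_form_sum => j; apply: is_formZ.
apply: (@eq_degree (1 * (m - j) + 1 * j)).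
  by rewrite !mul1n subnK // -ltnS.
by apply: is_formM; apply: is_formX.
Qed.

Lemma is_form_mulmx m f (U : 'M[C]_2) :
  is_form m f -> is_form m (fun v => f (U *m v)).
Proof.
move=> hf.
apply: (@eq_is_form _ (fun v => f (vec2 (U 0 0 * v 0 0 + U 0 1 * v 1 0)
                                        (U 1 0 * v 0 0 + U 1 1 * v 1 0)))).
  by move=> v; congr f; apply: vec_eqP; rewrite mulmx2E ?vec2E0 ?vec2E1.
by apply: is_form_subst => //; apply: is_formD; apply: is_formZ;
  apply: is_form_coord.
Qed.

Lemma is_form_scale m f t v : is_form m f -> f (t *: v) = t ^+ m * f v.
Proof.
move=> /is_form_expand [c hc]; rewrite !hc big_distrr /=.
apply: eq_bigr => j _; rewrite !mxE !exprMn -[in t ^+ m](@subnK j m) ?exprD.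
  by ring.
by rewrite -ltnS.
Qed.

(** What the density arguments below use of a polynomial function. *)
Definition poly_on_lines f : Prop := forall u v, exists p : {poly C},
  forall z, f (u + z *: v) = p.[z].

Lemma poly_on_lines_form m f : is_form m f -> poly_on_lines f.
Proof.
move=> /is_form_expand [c hc] u v.
exists (\sum_(j < m.+1) (c j)%:P * ((u 0 0)%:P + (v 0 0)%:P * 'X) ^+ (m - j)
        * ((u 1 0)%:P + (v 1 0)%:P * 'X) ^+ j) => z.
rewrite hc horner_sum; apply: eq_bigr => j _.
rewrite !(hornerM, horner_exp, hornerD, hornerC, hornerX) !mxE.
by rewrite ![_ * z]mulrC.
Qed.

Lemma poly_eq0 (p : {poly C}) : (forall z, z != 0 -> p.[z] = 0) -> p = 0.
Proof.
move=> hp; apply/eqP/negPn/negP => np.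
pose s : seq C := [seq n.+1%:R | n <- iota 0 (size p)].
suff : (size s < size p)%N by rewrite size_map size_iota ltnn.
apply: max_poly_roots => //.
  by apply/allP => _ /mapP[n _ ->]; apply/rootP; apply: hp; rewrite pnatr_eq0.
by rewrite map_inj_uniq ?iota_uniq // => a b /eqP; rewrite eqr_nat => /eqP [].
Qed.

(** On the line through a point where [f] does not vanish and a point where
    [h] does not vanish, both restrict to nonzero polynomials, and so does
    their product. *)
Lemma common_nonzero f h u v : poly_on_lines f -> poly_on_lines h ->
  f u != 0 -> h v != 0 -> exists2 w, f w != 0 & h w != 0.
Proof.
move=> pf ph fu hv.
have [p hp] := pf u (v - u); have [q hq] := ph u (v - u).
have p0 : p != 0.
  apply: contra_neq fu => p0.
  by have := hp 0; rewrite p0 horner0 scale0r addr0.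
have q0 : q != 0.
  apply: contra_neq hv => q0.
  by have := hq 1; rewrite q0 horner0 scale1r addrC subrK.
have : p * q != 0 by rewrite mulf_neq0.
case: (pselect (forall z, z != 0 -> (p * q).[z] = 0)) => [/poly_eq0 -> /eqP//|].
move=> /existsNP[z /not_implyP[_ /eqP]]; rewrite hornerM mulf_eq0 negb_or.
by rewrite -hp -hq => /andP[? ?] _; exists (u + z *: (v - u)).
Qed.

Lemma poly_on_linesM f h : poly_on_lines f -> poly_on_lines h ->
  poly_on_lines (fun v => f v * h v).
Proof.
move=> pf ph u v; have [p hp] := pf u v; have [q hq] := ph u v.
by exists (p * q) => z; rewrite hornerM hp hq.
Qed.

Lemma poly_on_linesB f h : poly_on_lines f -> poly_on_lines h ->
  poly_on_lines (fun v => f v - h v).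
Proof.
move=> pf ph u v; have [p hp] := pf u v; have [q hq] := ph u v.
by exists (p - q) => z; rewrite hornerD hornerN hp hq.
Qed.

Lemma poly_on_linesX f n : poly_on_lines f -> poly_on_lines (fun v => f v ^+ n).
Proof.
move=> pf u v; have [p hp] := pf u v.
by exists (p ^+ n) => z; rewrite horner_exp hp.
Qed.

(** Otherwise the difference of [h1] and [h2] is nonzero somewhere, hence also at a
    point where [f] is nonzero. *)
Lemma poly_dense f h1 h2 u : poly_on_lines f -> poly_on_lines h1 ->
  poly_on_lines h2 -> f u != 0 ->
  (forall v, f v != 0 -> h1 v = h2 v) -> h1 =1 h2.
Proof.
move=> pf p1 p2 fu e v; apply/eqP; rewrite -subr_eq0; apply/negPn/negP => nv.
have [w fw] := common_nonzero pf (poly_on_linesB p1 p2) fu nv.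
by rewrite (e w fw) subrr eqxx.
Qed.

Lemma vec_neq0 w : w != 0 -> w 0 0 != 0 \/ w 1 0 != 0.
Proof.
move=> nw; case: (eqVneq (w 0 0) 0) => [e0|]; last by left.
right; apply: contra_neq nw => e1.
by apply: vec_eqP; rewrite mxE.
Qed.

Lemma area_compl w : w != 0 -> exists w', area w w' = 1.
Proof.
move=> /vec_neq0 [n|n]; [exists (vec2 0 (w 0 0)^-1)|exists (vec2 (- (w 1 0)^-1) 0)];
 rewrite /area vec2E0 vec2E1 ?mulr0 ?mul0r ?subr0 ?sub0r ?mulrN ?opprK divff //.
Qed.

Lemma area_decomp w w' v : area w w' = 1 ->
  v = area v w' *: w + area w v *: w'.
Proof.
rewrite /area => e; apply: vec_eqP; rewrite !mxE.
  by rewrite -[LHS]mul1r -e; ring.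
by rewrite -[LHS]mul1r -e; ring.
Qed.

Lemma areaC w v : area w v = - area v w.
Proof. by rewrite /area; ring. Qed.

Lemma area_mul (U : 'M[C]_2) w v : area (U *m w) (U *m v) = \det U * area w v.
Proof. by rewrite /area !mulmx2E det2E; ring. Qed.

Lemma area_scaler w v t : area w (t *: v) = t * area w v.
Proof. by rewrite /area !mxE; ring. Qed.

Lemma area_scalel w v t : area (t *: w) v = t * area w v.
Proof. by rewrite /area !mxE; ring. Qed.

Lemma area_ww w : area w w = 0.
Proof. by rewrite /area; ring. Qed.

Lemma area_lin2 (a b c d : C) u v :
  area (a *: u + b *: v) (c *: u + d *: v) = (a * d - b * c) * area u v.
Proof. by rewrite /area !mxE; ring. Qed.

Lemma eigen_cross (a b k l : C) : a * k * b - b * l * a = (k - l) * (a * b).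
Proof. by ring. Qed.

Lemma cancel_fraction (k r t x y : C) : x != 0 -> y != 0 ->
  k * t * r / y = x * t * (k * r / (x * y)).
Proof. by move=> x0 y0; field; rewrite x0 y0. Qed.

Lemma area_eq0 w v : w != 0 -> area w v = 0 -> exists t, v = t *: w.
Proof.
move=> nw e; have [w' ew'] := area_compl nw.
by exists (area v w'); rewrite {1}(area_decomp v ew') e scale0r addr0.
Qed.

(** In coordinates adapted to [w], vanishing at [w] means that the coefficient
    of the pure power of the first coordinate is zero. *)
Lemma form_div m f w : is_form m.+1 f -> w != 0 -> f w = 0 ->
  exists2 h, is_form m h & forall v, f v = area w v * h v.
Proof.
move=> hf nw fw; have [w' ew'] := area_compl nw.
have hg : is_form m.+1 (fun v => f (v 0 0 *: w + v 1 0 *: w')).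
  pose U : 'M[C]_2 := \matrix_(i, j) if j == 0 then w i 0 else w' i 0.
  apply: eq_is_form (is_form_mulmx U hf) => v; congr f.
  apply: vec_eqP; rewrite mulmx2E !mxE /=;
    by rewrite [_ * w _ _]mulrC [_ * w' _ _]mulrC.
have [c hc] := is_form_expand hg.
have c0 : c 0%N = 0.
  have := hc (vec2 1 0); rewrite vec2E0 vec2E1 scale1r scale0r addr0 fw.
  rewrite big_ord_recl big1 ?addr0 /= ?expr1n ?mulr1 // => j _.
  by rewrite exprS mul0r mulr0.
exists (fun v => \sum_(j < m.+1) c j.+1 * (- area w' v) ^+ (m - j) * area w v ^+ j).
  apply: is_form_sum => j; apply: (@eq_degree (1 * (m - j) + 1 * j)).
    by rewrite !mul1n subnK // -ltnS.
  apply: is_formM; [apply: is_formZ|]; apply: is_formX; last exact: is_form_area.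
  apply: (@eq_is_form _ (fun v => (-1) * area w' v)) => [v|].
    by rewrite mulN1r.
  exact/is_formZ/is_form_area.
move=> v; have := hc (vec2 (area v w') (area w v)).
rewrite vec2E0 vec2E1 -area_decomp // => ->.
rewrite big_ord_recl /= c0 !mul0r add0r big_distrr /=.
apply: eq_bigr => j _; rewrite /bump /= add1n subSS exprS -areaC; ring.
Qed.

(** Dehomogenise and take a root in the algebraically closed field, or the point
    at infinity if the degree drops. *)
Lemma form_root m f : is_form m.+1 f -> exists2 w, w != 0 & f w = 0.
Proof.
move=> /is_form_expand [c hc].
pose p : {poly C} := \poly_(k < m.+2) c (m.+1 - k)%N.
have hp x : f (vec2 x 1) = p.[x].
  rewrite hc vec2E0 vec2E1 horner_poly (reindex_inj rev_ord_inj) /=.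
  apply: eq_bigr => j _; rewrite subSS expr1n mulr1.
  by rewrite subKn // -ltnS.
have [c0|nc0] := eqVneq (c 0%N) 0.
  exists (vec2 1 0).
    apply/eqP => /(congr1 (fun w : vec => w 0 0)).
    by rewrite vec2E0 mxE => /eqP; rewrite oner_eq0.
  rewrite hc big_ord_recl vec2E1 c0 !mul0r add0r big1 // => j _.
  by rewrite exprS mul0r mulr0.
have [x /rootP px] : exists x, root p x.
  apply/closed_rootP; rewrite gtn_eqF //.
  by rewrite size_poly_eq ?subnn.
exists (vec2 x 1); last by rewrite hp.
apply/eqP => /(congr1 (fun w : vec => w 1 0)).
by rewrite vec2E1 mxE => /eqP; rewrite oner_eq0.
Qed.

Lemma form_neq0_deg m f : is_form m f -> (exists u, f u != 0) ->
  forall w, f w = 0 -> (0 < m)%N.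
Proof.
move=> hf [u fu] w; case: m hf => // /is_form_expand [c hc].
by move: fu; rewrite !hc !big_ord1 !expr0 => /negP h e; case: h; rewrite e.
Qed.

(** * Order of vanishing at a point of the projective line *)

(** [f] vanishes to order exactly [j] at the point of the projective line
    spanned by [w]. *)
Definition has_order (m : nat) f w (j : nat) : Prop := exists n h,
  [/\ m = (n + j)%N, is_form n h, forall v, f v = area w v ^+ j * h v & h w != 0].

(** Split off the linear form [area w] as long as the quotient vanishes at [w]; the
    degree bounds the number of divisions. *)
Lemma order_exists m f w : is_form m f -> (exists u, f u != 0) -> w != 0 ->
  exists j, has_order m f w j.
Proof.
move=> + + nw; elim: m f => [|m IH] f hf nf.
  have [/(form_neq0_deg hf nf)//|fw] := eqVneq (f w) 0.
  by exists 0%N, 0%N, f; split=> // v; rewrite expr0 mul1r.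
have [fw|fw] := eqVneq (f w) 0; last first.
  by exists 0%N, m.+1, f; split=> // [|v]; rewrite ?addn0 ?expr0 ?mul1r.
have [h hh eh] := form_div hf nw fw.
have [|j [n [h' [em hh' eh' h'w]]]] := IH h hh.
  case: nf => u fu; exists u; apply: contra_neq fu.
  by rewrite eh => ->; rewrite mulr0.
exists j.+1, n, h'; split=> // [|v]; first by rewrite addnS em.
by rewrite eh eh' exprS mulrA.
Qed.

(** At a fixed point [w] of [U], the factor by which [U] multiplies a form is
    determined by the order of vanishing and the eigenvalue. *)
Lemma order_character m f w j (U : 'M[C]_2) (c z : C) : has_order m f w j ->
  \det U = 1 -> U *m w = z *: w -> w != 0 -> z != 0 ->
  (forall v, f (U *m v) = c * f v) -> c = z ^ (m%:Z - 2 * j%:Z).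
Proof.
move=> [n [h [em hh eh hw]]] dU ew nw nz fU.
have aU v : area w (U *m v) = z^-1 * area w v.
  by apply: (mulfI nz); rewrite mulVKf // -area_scalel -ew area_mul dU mul1r.
have [w' ew'] := area_compl nw.
have hU : forall v, area w v ^+ j != 0 -> h (U *m v) = c * z ^+ j * h v.
  move=> v nv; apply: (mulfI nv); apply: (mulfI (expf_neq0 j (invr_neq0 nz))).
  have -> : z^-1 ^+ j * (area w v ^+ j * h (U *m v)) = c * (area w v ^+ j * h v).
    by rewrite [LHS]mulrA -exprMn -aU -(eh (U *m v)) fU eh.
  by rewrite exprVn; field; apply: expf_neq0.
have := @poly_dense _ (fun v => h (U *m v)) (fun v => c * z ^+ j * h v) w'
  (poly_on_linesX j (poly_on_lines_form (is_form_area w)))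
  (poly_on_lines_form (is_form_mulmx U hh))
  (poly_on_lines_form (is_formZ (c * z ^+ j) hh)).
rewrite ew' expr1n oner_neq0 => /(_ isT hU w).
rewrite ew (is_form_scale _ _ hh) => /(mulIf hw) e.
have -> : c = z ^+ n * z ^- j by rewrite e mulfK ?expf_neq0.
rewrite exprnN [z ^+ n]exprnP -expfzDr //; congr (z ^ _).
by rewrite em PoszD; lia.
Qed.

(** The linear form [area w] is prime: a power of it that divides a product and is
    prime to one factor divides the other. *)
Lemma div_power a g h w da dg dh e : is_form da a -> is_form dg g ->
  is_form dh h -> w != 0 -> a w != 0 -> (exists u, g u != 0) ->
  (forall v, a v * g v = area w v ^+ e * h v) ->
  exists n g', [/\ dg = (n + e)%N, is_form n g' &
    forall v, g v = area w v ^+ e * g' v].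
Proof.
move=> ha + hh nw aw; elim: e dg g => [|e IH] dg g hg ng eg.
  by exists dg, g; split=> // [|v]; rewrite ?addn0 ?expr0 ?mul1r.
have gw : g w = 0.
  apply: (mulfI aw); rewrite eg area_ww exprS !mul0r mulr0 //.
have dg0 := form_neq0_deg hg ng gw.
rewrite -(prednK dg0) in hg.
have [g1 hg1 eg1] := form_div hg nw gw.
have [||n [g' [e1 hg' eg']]] := IH _ g1 hg1.
- case: ng => u gu; exists u; apply: contra_neq gu.
  by rewrite eg1 => ->; rewrite mulr0.
- have [w' ew'] := area_compl nw.
  apply: (@poly_dense (area w) _ _ w').
  + exact: poly_on_lines_form (is_form_area w).
  + by apply: poly_on_linesM; [exact: poly_on_lines_form ha | exact: poly_on_lines_form hg1].
  + apply: poly_on_linesM; last exact: poly_on_lines_form hh.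
    exact: poly_on_linesX (poly_on_lines_form (is_form_area w)).
  + by rewrite ew' oner_neq0.
  move=> v nv; apply: (mulfI nv).
  by rewrite mulrCA -eg1 eg exprS mulrA.
exists n, g'; split=> // [|v]; first by rewrite addnS -e1 prednK.
by rewrite eg1 eg' exprS mulrA.
Qed.

(** Divisibility by powers of pairwise independent linear forms adds up. *)
Lemma div_product (I : eqType) (s : seq I) (w : I -> vec) (e : I -> nat) m f :
  is_form m f -> (exists u, f u != 0) -> uniq s ->
  {in s, forall i, w i != 0} ->
  {in s &, forall i j, i != j -> area (w i) (w j) != 0} ->
  {in s, forall i, exists n h, is_form n h /\
     forall v, f v = area (w i) v ^+ e i * h v} ->
  exists n g, [/\ m = (n + \sum_(i <- s) e i)%N, is_form n g &
    forall v, f v = (\prod_(i <- s) area (w i) v ^+ e i) * g v].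
Proof.
move=> hf nf; elim: s => [|i s IH] /=.
  by exists m, f; rewrite big_nil addn0; split=> // v; rewrite big_nil mul1r.
move=> /andP[nis us] nw aw de.
have [|||n [g [em hg eg]]] := IH us.
- by move=> j js; apply: nw; rewrite inE js orbT.
- by move=> j k js ks; apply: aw; rewrite inE ?js ?ks orbT.
- by move=> j js; apply: de; rewrite inE js orbT.
have [dh [h [hh eh]]] := de i (mem_head i s).
have ha : is_form (\sum_(j <- s) 1 * e j)
    (fun v => \prod_(j <- s) area (w j) v ^+ e j).
  by apply: is_form_prod => j; apply/is_formX/is_form_area.
have [||||n' [g' [en hg' eg']]] := @div_power _ g h (w i) _ _ _ (e i) ha hg hh.
- by apply: nw; rewrite mem_head.
- rewrite prodf_seq_neq0; apply/allP => j js /=; apply/expf_neq0/aw.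
  + by rewrite inE js orbT.
  + exact: mem_head.
  + by apply: contraNneq nis => <-.
- case: nf => u fu; exists u; apply: contra_neq fu.
  by rewrite eg => ->; rewrite mulr0.
- by move=> v; rewrite -eg eh.
exists n', g'; split=> // [|v]; first by rewrite big_cons em en addnA.
by rewrite eg eg' big_cons mulrA [_ * (area _ _ ^+ _)]mulrC.
Qed.

(** * Gradients of forms *)

(** First-order Taylor formula along a line; comparing the coefficients of [z]
    turns functional equations of a form into identities between its partial
    derivatives. *)
Lemma ev_line (q : mpoly 2 C) u v : exists r : {poly C}, forall z,
  evalv q (u + z *: v) = evalv q u
    + z * (v 0 0 * evalv (mderiv 0 q) u + v 1 0 * evalv (mderiv 1 q) u) + z ^+ 2 * r.[z].
Proof.
elim/mpoly_ring_ind: q => [c|i|p1 p2 [r1 h1] [r2 h2]|p1 p2 [r1 h1] [r2 h2]].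
- exists 0 => z; rewrite !mderivC /evalv !mevalC horner0; ring.
- exists 0 => z; rewrite !mderivX /evalv !mevalZ !mevalXU horner0 !mevalX !prod2E.
  rewrite !mxE !mnmBE !mnm1E.
  by case: (I2P i) => -> /=; rewrite ?expr0; ring.
- exists (r1 + r2) => z; rewrite !mderivD !evD h1 h2 hornerD; ring.
- pose d p := v 0 0 * evalv (mderiv 0 p) u + v 1 0 * evalv (mderiv 1 p) u.
  exists ((d p1 * d p2)%:P
     + r1 * ((evalv p2 u)%:P + 'X * (d p2)%:P + 'X^2 * r2)
     + r2 * ((evalv p1 u)%:P + 'X * (d p1)%:P)) => z.
  rewrite !mderivM !evD !evM h1 h2 /d.
  rewrite !(hornerD, hornerM, hornerC, hornerX, hornerXn); ring.
Qed.

Lemma line_coef_uniq (a b a' b' : C) (r r' : {poly C}) :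
  (forall z, a + z * b + z ^+ 2 * r.[z] = a' + z * b' + z ^+ 2 * r'.[z]) ->
  b = b'.
Proof.
move=> h.
have ea : a = a' by have := h 0; rewrite expr0n /= !mul0r !addr0.
have : (b - b')%:P + 'X * (r - r') = 0.
  apply: poly_eq0 => z nz; apply: (mulfI nz).
  rewrite !(hornerD, hornerN, hornerM, hornerC, hornerX) mulr0.
  have e := h z; rewrite ea in e.
  transitivity ((a' + z * b + z ^+ 2 * r.[z]) - (a' + z * b' + z ^+ 2 * r'.[z])).
    ring.
  by rewrite e subrr.
move=> /(congr1 (fun p => p.[0])).
rewrite hornerD hornerM hornerX mul0r addr0 hornerC horner0.
by move/eqP; rewrite subr_eq0 => /eqP.
Qed.

(** Euler's identity, from the Taylor formula at [v] in the direction [v]: there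
    [q ((1 + z) v) = (1 + z)^m q v]. *)
Lemma euler m (q : mpoly 2 C) v : (q \is ishomog1 m mdeg) ->
  v 0 0 * evalv (mderiv 0 q) v + v 1 0 * evalv (mderiv 1 q) v = m%:R * evalv q v.
Proof.
move=> /is_form_ev hq; have [r hr] := ev_line q v v.
have [p hp] : exists p : {poly C}, forall z, (1 + z) ^+ m = 1 + z * m%:R + z ^+ 2 * p.[z].
  elim: m {hq} => [|m [p hp]]; first by exists 0 => z; rewrite horner0; ring.
  exists (m%:R%:P + p * (1 + 'X)) => z; rewrite exprS hp -natr1.
  by rewrite !(hornerD, hornerM, hornerC, hornerX); ring.
apply: (@line_coef_uniq (evalv q v) _ (evalv q v) _ r (p * (evalv q v)%:P)) => z.
rewrite -hr -{1}[v]scale1r -scalerDl (is_form_scale _ _ hq) hp hornerM hornerC.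
ring.
Qed.

(** The chain rule: compare the linear terms in [z] of [q (U (v + z u))] and of
    [c * q (v + z u)]. *)
Lemma gradient_equivariant (q : mpoly 2 C) (U : 'M[C]_2) c :
  (forall v, evalv q (U *m v) = c * evalv q v) ->
  forall v, c * evalv (mderiv 0 q) v =
      U 0 0 * evalv (mderiv 0 q) (U *m v) + U 1 0 * evalv (mderiv 1 q) (U *m v) /\
    c * evalv (mderiv 1 q) v =
      U 0 1 * evalv (mderiv 0 q) (U *m v) + U 1 1 * evalv (mderiv 1 q) (U *m v).
Proof.
move=> h v.
have key u : c * (u 0 0 * evalv (mderiv 0 q) v + u 1 0 * evalv (mderiv 1 q) v) =
  (U *m u) 0 0 * evalv (mderiv 0 q) (U *m v) + (U *m u) 1 0 * evalv (mderiv 1 q) (U *m v).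
  have [r hr] := ev_line q v u; have [s hs] := ev_line q (U *m v) (U *m u).
  apply: (@line_coef_uniq (c * evalv q v) _ (evalv q (U *m v)) _ (r * c%:P) s) => z.
  rewrite -hs scalemxAr -mulmxDr h hr hornerM hornerC; ring.
split; [have := key (vec2 1 0)|have := key (vec2 0 1)];
  by rewrite !mulmx2E !vec2E0 !vec2E1 !mulr0 !mulr1 !mul0r !mul1r ?addr0 ?add0r.
Qed.

End BinaryForms.
(** * The double cover of SO(3) by SU(2) in quaternion coordinates *)

Section Quaternions.
Local Open Scope sesquilinear_scope.
Variable R : realType.
Local Notation C := R[i].

Lemma mx2E (K : Type) (a b c d : K) :
  (mx2 a b c d 0 0 = a) * (mx2 a b c d 0 1 = b) *
  (mx2 a b c d 1 0 = c) * (mx2 a b c d 1 1 = d).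
Proof. by rewrite !mxE. Qed.

Lemma mx2P (K : Type) (A B : 'M[K]_2) :
  A 0 0 = B 0 0 -> A 0 1 = B 0 1 -> A 1 0 = B 1 0 -> A 1 1 = B 1 1 -> A = B.
Proof.
move=> *; apply/matrixP => i j.
by case: (I2P i) => ->; case: (I2P j) => ->.
Qed.

Lemma mulmx2 (K : pzRingType) (A B : 'M[K]_2) i j :
  (A *m B) i j = A i 0 * B 0 j + A i 1 * B 1 j.
Proof. by rewrite mxE sum2E. Qed.

(** The quaternion [x + a i + b j + c k], where [i], [j], [k] are the Pauli matrices
    times the imaginary unit; SU(2) is the unit sphere. *)
Definition quat (x a b c : R) : 'M[C]_2 :=
  mx2 (x +i* c) (b +i* a) (- b +i* a) (x +i* - c).

(** The Euler-Rodrigues matrix, which describes conjugation by a quaternion. *)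
Definition rot (x a b c : R) : 'M[R]_3 := \matrix_(i, j)
  nth 0 (nth [::] [::
   [:: x^+2 + a^+2 - b^+2 - c^+2; 2 * (a * b + x * c); 2 * (a * c - x * b)];
   [:: 2 * (a * b - x * c); x^+2 - a^+2 + b^+2 - c^+2; 2 * (b * c + x * a)];
   [:: 2 * (a * c + x * b); 2 * (b * c - x * a); x^+2 - a^+2 - b^+2 + c^+2]]
  i) j.

Lemma complexP (z w : C) : complex.Re z = complex.Re w ->
  complex.Im z = complex.Im w -> z = w.
Proof. by case: z w => [a b] [c d] /= -> ->. Qed.

Lemma mulcE (a b c d : R) :
  ((a +i* b) * (c +i* d) = (a * c - b * d) +i* (a * d + b * c) :> C).
Proof. by []. Qed.

Lemma addcE (a b c d : R) : ((a +i* b) + (c +i* d) = (a + c) +i* (b + d) :> C).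
Proof. by []. Qed.

Lemma oppcE (a b : R) : (- (a +i* b) = (- a) +i* (- b) :> C).
Proof. by []. Qed.

Lemma onecE : 1 = 1 +i* 0 :> C. Proof. by []. Qed.
Lemma zerocE : 0 = 0 +i* 0 :> C. Proof. by []. Qed.

Lemma quatM x a b c x' a' b' c' : quat x a b c *m quat x' a' b' c' =
  quat (x * x' - a * a' - b * b' - c * c')
       (x * a' + a * x' - b * c' + c * b')
       (x * b' + b * x' - c * a' + a * c')
       (x * c' + c * x' - a * b' + b * a').
Proof.
by apply: mx2P; rewrite mulmx2 !mx2E !mulcE !addcE; congr (_ +i* _); ring.
Qed.

Lemma det_quat x a b c :
  \det (quat x a b c) = (x ^+ 2 + a ^+ 2 + b ^+ 2 + c ^+ 2)%:C.
Proof.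
by rewrite det2E !mx2E !mulcE oppcE addcE; congr (_ +i* _); ring.
Qed.

Lemma quat_tc x a b c : quat x a b c ^t* = quat x (- a) (- b) (- c).
Proof.
by apply: mx2P; rewrite !mxE //= ; congr (_ +i* _); ring.
Qed.

Lemma SU2_quat x a b c : x ^+ 2 + a ^+ 2 + b ^+ 2 + c ^+ 2 = 1 ->
  SU2 (quat x a b c).
Proof.
move=> e; split; last by rewrite det_quat e.
apply/unitarymxP; rewrite quat_tc quatM.
apply: mx2P; rewrite !mx2E !mxE /= ?onecE ?zerocE; congr (_ +i* _); rewrite -?e; ring.
Qed.

Lemma quatP (U : 'M[C]_2) : SU2 U ->
  exists x a b c, U = quat x a b c /\ x ^+ 2 + a ^+ 2 + b ^+ 2 + c ^+ 2 = 1.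
Proof.
move=> [/unitarymxP uU dU].
have hE i j : U i 0 * (U j 0)^*%C + U i 1 * (U j 1)^*%C = (i == j)%:R.
  by have /matrixP/(_ i j) := uU; rewrite mulmx2 !mxE.
have h00 : U 0 0 * (U 0 0)^*%C + U 0 1 * (U 0 1)^*%C = 1 by rewrite hE.
have h10 : U 1 0 * (U 0 0)^*%C + U 1 1 * (U 0 1)^*%C = 0 by rewrite hE.
rewrite det2E in dU.
have e11 : U 1 1 = (U 0 0)^*%C.
  rewrite -[LHS]mulr1 -[X in _ * X = _]h00 mulrDr.
  transitivity ((U 0 0)^*%C * (U 0 0 * U 1 1 - U 0 1 * U 1 0) +
    U 0 1 * (U 1 0 * (U 0 0)^*%C + U 1 1 * (U 0 1)^*%C)); first by ring.
  by rewrite dU h10 mulr0 mulr1 addr0.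
have e10 : U 1 0 = - (U 0 1)^*%C.
  rewrite -[LHS]mulr1 -[X in _ * X = _]h00 mulrDr.
  transitivity (- (U 0 1)^*%C * (U 0 0 * U 1 1 - U 0 1 * U 1 0) +
    U 0 0 * (U 1 0 * (U 0 0)^*%C + U 1 1 * (U 0 1)^*%C)); first by ring.
  by rewrite dU h10 mulr0 mulr1 addr0.
have eU : exists x a b c, U = quat x a b c.
  case e0: (U 0 0) e11 => [x c] e11; case e1 : (U 0 1) e10 => [b a] e10.
  exists x, a, b, c; apply: mx2P; rewrite !mx2E ?e11 ?e10 //=.
  by rewrite oppcE opprK.
case: eU dU => x [a [b [c ->]]]; rewrite -det2E det_quat => -[e].
by exists x, a, b, c.
Qed.

Lemma double_cover_quat x a b c : double_cover (quat x a b c) = rot x a b c.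
Proof.
have half (z : C) : complex.Re (2^-1 * z) = 2^-1 * complex.Re z.
  have -> : 2^-1 = (2^-1)%:C :> C by rewrite fmorphV rmorph_nat.
  by case: z => u v; rewrite /= mul0r subr0.
apply/matrixP => i j; rewrite !mxE half quat_tc /mxtrace sum2E !mulmx2.
by case: i => -[|[|[|//]]] Hi; case: j => -[|[|[|//]]] Hj;
  rewrite /pauli /= !mx2E; rewrite !(onecE,zerocE,oppcE,mulcE,addcE) /=; field.
Qed.

Lemma rotM x a b c x' a' b' c' : rot x a b c *m rot x' a' b' c' =
  rot (x * x' - a * a' - b * b' - c * c')
       (x * a' + a * x' - b * c' + c * b')
       (x * b' + b * x' - c * a' + a * c')
       (x * c' + c * x' - a * b' + b * a').
Proof.
apply/matrixP => i j; rewrite mxE !big_ord_recl big_ord0 !mxE /=.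
by case: i => -[|[|[|//]]] Hi; case: j => -[|[|[|//]]] Hj /=; ring.
Qed.

Lemma rot1 : rot 1 0 0 0 = 1%:M.
Proof.
apply/matrixP => i j; rewrite !mxE.
by case: i => -[|[|[|//]]] Hi; case: j => -[|[|[|//]]] Hj /=; ring.
Qed.

Lemma SU2M (U V : 'M[C]_2) : SU2 U -> SU2 V -> SU2 (U *m V).
Proof.
move=> [uU dU] [uV dV]; split; first exact: mul_unitarymx.
by rewrite det_mulmx dU dV mulr1.
Qed.

Lemma SU2_1 : SU2 (1%:M : 'M[C]_2).
Proof.
have := @SU2_quat 1 0 0 0; rewrite expr0n expr1n !addr0 => /(_ erefl).
rewrite (_ : quat 1 0 0 0 = 1%:M) //.
by apply: mx2P; rewrite !mx2E !mxE //= oppr0.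
Qed.

Lemma SU2_unit (U : 'M[C]_2) : SU2 U -> U \in unitmx.
Proof. by move=> [_ dU]; rewrite unitmxE dU unitr1. Qed.

Lemma SU2V (U : 'M[C]_2) : SU2 U -> SU2 (invmx U).
Proof.
move=> sU; have [uU dU] := sU; split; last by rewrite det_inv dU invr1.
have [x [a [b [c [e1 e2]]]]] := quatP sU.
rewrite (invmx_unitary uU) e1 quat_tc.
by case: (@SU2_quat x (- a) (- b) (- c)) => //; rewrite !sqrrN.
Qed.

Lemma SU2N (U : 'M[C]_2) : SU2 U -> SU2 (- U).
Proof.
move=> /quatP [x [a [b [c [-> e]]]]].
rewrite (_ : - quat x a b c = quat (- x) (- a) (- b) (- c)).
  by apply: SU2_quat; rewrite !sqrrN.
by apply: mx2P; rewrite !mxE.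
Qed.

Lemma double_coverM (U V : 'M[C]_2) : SU2 U -> SU2 V ->
  double_cover (U *m V) = double_cover U *m double_cover V.
Proof.
move=> /quatP [x [a [b [c [-> _]]]]] /quatP [x' [a' [b' [c' [-> _]]]]].
by rewrite quatM !double_cover_quat rotM.
Qed.

Lemma double_coverN (U : 'M[C]_2) : double_cover (- U) = double_cover U.
Proof.
apply/matrixP => i j; rewrite !mxE; congr (complex.Re (_ * \tr _)).
rewrite mulmxN mulNmx.
rewrite (_ : (- U) ^t* = - U ^t*); first by rewrite mulmxN mulNmx opprK.
by apply/matrixP => k l; rewrite !mxE rmorphN.
Qed.

Lemma double_cover1 : double_cover (1%:M : 'M[C]_2) = 1%:M.
Proof.
rewrite -rot1 -double_cover_quat; congr double_cover.
by apply: mx2P; rewrite !mx2E !mxE //= oppr0.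
Qed.

Lemma double_cover_ker (U : 'M[C]_2) : SU2 U -> double_cover U = 1%:M ->
  U = 1%:M \/ U = - 1%:M.
Proof.
move=> /quatP [x [a [b [c [-> e]]]]]; rewrite double_cover_quat => /matrixP h.
have := h 0 0; have := h 1 1; have := h 2%:R 2%:R; rewrite !mxE /= => h2 h1 h0.
have a0 : a = 0 by apply/eqP; rewrite -sqrf_eq0; apply/eqP; lra.
have b0 : b = 0 by apply/eqP; rewrite -sqrf_eq0; apply/eqP; lra.
have c0 : c = 0 by apply/eqP; rewrite -sqrf_eq0; apply/eqP; lra.
have /eqP : x ^+ 2 = 1 by rewrite a0 b0 c0 in e; rewrite -[RHS]e; ring.
rewrite sqrf_eq1 a0 b0 c0 => /orP[] /eqP ->; [left|right];
  by apply: mx2P; rewrite !mxE /= ?onecE ?zerocE ?oppcE ?oppr0.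
Qed.

Lemma double_cover_inj (U V : 'M[C]_2) : SU2 U -> SU2 V ->
  double_cover U = double_cover V -> U = V \/ U = - V.
Proof.
move=> sU sV e; have sV' := SU2V sV.
have : double_cover (U *m invmx V) = 1%:M.
  rewrite (double_coverM sU sV') e -(double_coverM sV sV').
  by rewrite (mulmxV (SU2_unit sV)) double_cover1.
case/double_cover_ker=> [|/(congr1 (mulmx^~ V))|/(congr1 (mulmx^~ V))]; first exact: SU2M.
  by rewrite mulmxKV ?SU2_unit // mul1mx; left.
by rewrite mulmxKV ?SU2_unit // mulNmx mul1mx; right.
Qed.

Lemma sum3E (V : nmodType) (F : 'I_3 -> V) : \sum_i F i = F 0 + F 1 + F 2%:R.
Proof.
rewrite !big_ord_recl big_ord0 addr0 addrA.
by congr (F _ + F _ + F _); apply: val_inj.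
Qed.

Lemma det3E (K : comNzRingType) (U : 'M[K]_3) :
  \det U = U 0 0 * (U 1 1 * U 2%:R 2%:R - U 1 2%:R * U 2%:R 1)
   - U 0 1 * (U 1 0 * U 2%:R 2%:R - U 1 2%:R * U 2%:R 0)
   + U 0 2%:R * (U 1 0 * U 2%:R 1 - U 1 1 * U 2%:R 0).
Proof.
have e00 : lift 0 0 = 1 :> 'I_3 by apply: val_inj.
have e01 : lift 0 1 = 2%:R :> 'I_3 by apply: val_inj.
have e10 : lift 1 0 = 0 :> 'I_3 by apply: val_inj.
have e11 : lift 1 1 = 2%:R :> 'I_3 by apply: val_inj.
have e20 : lift 2%:R 0 = 0 :> 'I_3 by apply: val_inj.
have e21 : lift 2%:R 1 = 1 :> 'I_3 by apply: val_inj.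
rewrite (expand_det_row _ 0) sum3E /cofactor !det2E !mxE.
rewrite e00 e01 e10 e11 e20 e21.
have s2 : (-1) ^+ (2%:R : 'I_3) = 1 :> K.
  by rewrite -[LHS]/((-1) ^+ 2) sqrrN expr1n.
rewrite addn0 !add0n expr0 s2 -[(-1) ^+ (1%R : 'I_3)]/((-1) ^+ 1) expr1.
ring.
Qed.

(** Half-angle formulas: [x] is the cosine of half the angle with the third axis.
    They degenerate at the pole [w = -1], where a half turn does it. *)
Lemma rot_third_column (u v w : R) : u ^+ 2 + v ^+ 2 + w ^+ 2 = 1 ->
  exists x a b, [/\ x ^+ 2 + a ^+ 2 + b ^+ 2 = 1,
    - 2 * (x * b) = u, 2 * (x * a) = v & x ^+ 2 - a ^+ 2 - b ^+ 2 = w].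
Proof.
move=> e; have [w1|w1] := eqVneq w (-1).
  exists 0, 1, 0; rewrite w1 in e.
  have u0 : u = 0 by apply/eqP; rewrite -sqrf_eq0; apply/eqP; nra.
  have v0 : v = 0 by apply/eqP; rewrite -sqrf_eq0; apply/eqP; nra.
  by split; rewrite ?u0 ?v0 ?w1; ring.
have wp : 0 < 1 + w by rewrite lt_neqAle; apply/andP; split; [lra | nra].
pose x := Num.sqrt ((1 + w) / 2).
have x2 : x ^+ 2 = (1 + w) / 2 by rewrite sqr_sqrtr //; lra.
have x0 : x != 0 by rewrite -sqrf_eq0 x2; lra.
have ab : (v / (2 * x)) ^+ 2 + (- u / (2 * x)) ^+ 2 = (1 - w) / 2.
  have -> : (v / (2 * x)) ^+ 2 + (- u / (2 * x)) ^+ 2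
     = (u ^+ 2 + v ^+ 2) / (4 * x ^+ 2) by field.
  rewrite x2 (_ : u ^+ 2 + v ^+ 2 = 1 - w ^+ 2); last by rewrite -e; ring.
  by field; lra.
exists x, (v / (2 * x)), (- u / (2 * x)); split.
- by rewrite -addrA ab x2; field.
- by field.
- by field.
- by rewrite -addrA -opprD ab x2; field.
Qed.

(** The half-angle formulas in the plane orthogonal to the axis of rotation. *)
Lemma rot_axis (u v : R) : u ^+ 2 + v ^+ 2 = 1 -> exists x c,
  [/\ x ^+ 2 + c ^+ 2 = 1, x ^+ 2 - c ^+ 2 = u & 2 * (x * c) = v].
Proof.
move=> e; have [|x [a [b [h1 h2 h3 h4]]]] := @rot_third_column 0 v u.
  by rewrite -e; ring.
have [x0|x0] := eqVneq x 0.
  exists 0, 1; rewrite x0 in h1 h3 h4; split; [ring|lra|by rewrite -h3; ring].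
have b0 : b = 0.
  apply/eqP; have /eqP : x * b = 0 by lra.
  by rewrite mulf_eq0 (negPf x0).
exists x, a; rewrite b0 in h1 h4; split; [rewrite -[RHS]h1; ring|lra|by []].
Qed.

Lemma sqr_sum_eq0 (u v : R) : u ^+ 2 + v ^+ 2 = 0 -> u = 0 /\ v = 0.
Proof.
by move/eqP; rewrite paddr_eq0 ?sqr_ge0 // !sqrf_eq0 => /andP[/eqP-> /eqP->].
Qed.

(** First rotate the third basis vector to its image under [A]; what remains
    is a rotation about the third axis, whose half angle comes from a square
    root. *)
Lemma double_cover_surj (A : 'M[R]_3) : A *m A^T = 1%:M -> \det A = 1 ->
  exists2 U, SU2 U & double_cover U = A.
Proof.
move=> oA dA.
have oA' : A^T *m A = 1%:M by apply: mulmx1C.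
have e : A 0 2%:R ^+ 2 + A 1 2%:R ^+ 2 + A 2%:R 2%:R ^+ 2 = 1.
  by have /matrixP/(_ 2%:R 2%:R) := oA'; rewrite mxE sum3E !mxE -!expr2 => ->.
have [x [a [b [h1 h2 h3 h4]]]] := rot_third_column e.
have n1 : x ^+ 2 + a ^+ 2 + b ^+ 2 + 0 ^+ 2 = 1 by rewrite expr0n addr0.
have rr : rot x (- a) (- b) 0 *m rot x a b 0 = 1%:M.
  by rewrite -rot1 rotM -n1; congr rot; ring.
have rr' : rot x a b 0 *m rot x (- a) (- b) 0 = 1%:M by apply: mulmx1C.
pose A' := rot x (- a) (- b) 0 *m A.
have tr : (rot x (- a) (- b) 0)^T = rot x a b 0.
  apply/matrixP => i j; rewrite !mxE.
  by case: i => -[|[|[|//]]] Hi; case: j => -[|[|[|//]]] Hj /=; ring.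
have oA1 : A' *m A'^T = 1%:M.
  by rewrite /A' trmx_mul tr -mulmxA (mulmxA A) oA mul1mx rr.
have dA1 : \det A' = 1.
  rewrite /A' det_mulmx dA mulr1 det3E !mxE /=.
  by rewrite -[RHS](expr1n _ 3) -[in RHS]n1; ring.
have c2 i : A' i 2%:R = (i == 2%:R)%:R.
  have /matrixP/(_ i 2%:R) := rr; rewrite !mxE => <-.
  apply: eq_bigr => k _; congr (_ * _).
  case: k => -[|[|[|//]]] Hk; rewrite !mxE /=.
  - by rewrite (_ : Ordinal Hk = 0) -?h2; [ring|apply: val_inj].
  - by rewrite (_ : Ordinal Hk = 1) -?h3; [ring|apply: val_inj].
  - by rewrite (_ : Ordinal Hk = 2%:R) -?h4; [ring|apply: val_inj].
have o i j : A' i 0 * A' j 0 + A' i 1 * A' j 1 + A' i 2%:R * A' j 2%:R = (i == j)%:R.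
  by have /matrixP/(_ i j) := oA1; rewrite mxE sum3E !mxE.
have c20 : A' 0 2%:R = 0 by rewrite c2.
have c21 : A' 1 2%:R = 0 by rewrite c2.
have c22 : A' 2%:R 2%:R = 1 by rewrite c2.
have o22 := o 2%:R 2%:R; have o00 := o 0 0; have o11 := o 1 1; have o01 := o 0 1.
rewrite c20 c21 ?c22 /= in o22 o00 o11 o01.
have a20 : A' 2%:R 0 = 0 by apply/eqP; rewrite -sqrf_eq0; apply/eqP; nra.
have a21 : A' 2%:R 1 = 0 by apply/eqP; rewrite -sqrf_eq0; apply/eqP; nra.
rewrite det3E c20 c21 c22 a20 a21 in dA1.
have [|y [c [k1 k2 k3]]] := @rot_axis (A' 0 0) (A' 0 1).
  by rewrite !expr2; lra.
have s0 : (A' 0 0 - A' 1 1) ^+ 2 + (A' 0 1 + A' 1 0) ^+ 2 = 0 by nra.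
have [d0 d1] := sqr_sum_eq0 s0.
have a11 : A' 1 1 = A' 0 0 by lra.
have a10 : A' 1 0 = - A' 0 1 by lra.
have eA' : A' = rot y 0 0 c.
  apply/matrixP => i j.
  have ord3 (k : 'I_3) : [\/ k = 0, k = 1 | k = 2%:R].
    by case: k => -[|[|[|//]]] Hk; [apply: Or31|apply: Or32|apply: Or33];
      apply: val_inj.
  case: (ord3 i) => ->; case: (ord3 j) => ->; rewrite [RHS]mxE /=;
    rewrite ?c20 ?c21 ?c22 ?a20 ?a21 ?a10 ?a11 -?k2 -?k3;
    first [ring | by rewrite -[LHS]k1; ring].
exists (quat x a b 0 *m quat y 0 0 c).
  apply: SU2M; apply: SU2_quat => //; rewrite -k1; ring.
rewrite double_coverM; try (apply: SU2_quat => //; rewrite -k1; ring).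
by rewrite !double_cover_quat -eA' /A' mulmxA rr' mul1mx.
Qed.

End Quaternions.
(** * Fixed points on the Riemann sphere *)

Section Lines.
Variable R : realType.
Local Notation C := R[i].
Local Notation vec := 'cV[C]_2.
Local Notation line := {vspace 'cV[C]_2}.
Implicit Types (u v w : vec) (U V : 'M[C]_2) (L : line).

Lemma dim1_line L : \dim L = 1%N -> exists2 w, w != 0 & L = <[w]>%VS.
Proof.
move=> dL; have nL : L != 0%VS by rewrite -dimv_eq0 dL.
exists (vpick L); first by rewrite vpick0.
by apply/esym/eqP; rewrite eqEdim -memvE memv_pick dL dim_vline vpick0 nL.
Qed.

Lemma area_sym u v : area u v = 0 -> area v u = 0.
Proof. by rewrite areaC => /eqP; rewrite oppr_eq0 => /eqP. Qed.

Lemma line_eqP u v : u != 0 -> v != 0 ->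
  reflect (area u v = 0) (<[u]>%VS == <[v]>%VS :> line).
Proof.
move=> nu nv; apply: (iffP eqP) => [e|/(area_eq0 nu) [t ev]].
  have /vlineP [t ->] : v \in <[u]>%VS by rewrite e memv_line.
  by rewrite area_scaler area_ww mulr0.
have nt : t != 0 by apply: contra_neq nv => t0; rewrite ev t0 scale0r.
apply/eqP; rewrite eqEdim !dim_vline nu nv leqnn andbT -memvE.
by apply/vlineP; exists t^-1; rewrite ev scalerA mulVf // scale1r.
Qed.

Lemma act_lineE U w : act_line U <[w]>%VS = <[U *m w]>%VS.
Proof. by rewrite /act_line limg_line lfunE. Qed.

Lemma act_line1 L : act_line 1%:M L = L.
Proof.
rewrite /act_line (_ : linfun (mulmx 1%:M) = \1%VF) ?limg_lfun1 ?lim1g //.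
by apply/lfunP => v; rewrite lfunE /= id_lfunE mul1mx.
Qed.

Lemma act_lineM U V L : act_line (U *m V) L = act_line U (act_line V L).
Proof.
rewrite /act_line -limg_comp; congr (_ @: _)%VS.
by apply/lfunP => v; rewrite comp_lfunE !lfunE /= mulmxA.
Qed.

Lemma act_lineN U L : act_line (- U) L = act_line U L.
Proof.
apply/vspaceP => v; apply/memv_imgP/memv_imgP => -[u uL ->].
  by exists (- u); rewrite ?memvN // !lfunE /= mulNmx mulmxN.
by exists (- u); rewrite ?memvN // !lfunE /= mulNmx mulmxN opprK.
Qed.

Lemma mulmx_neq0 U w : \det U != 0 -> w != 0 -> U *m w != 0.
Proof.
move=> dU; apply: contra_neq => e.
have uU : U \in unitmx by rewrite unitmxE unitfE.
by rewrite -(mulKmx uU w) e mulmx0.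
Qed.

Lemma dim_act_line U L : \det U != 0 -> \dim L = 1%N -> \dim (act_line U L) = 1%N.
Proof.
move=> dU /dim1_line [w nw ->].
by rewrite act_lineE dim_vline mulmx_neq0.
Qed.

Lemma eigen_exists U : exists z w, w != 0 /\ U *m w = z *: w.
Proof.
have [z /rootP pz] : exists z, root (char_poly U^T) z.
  by apply/closed_rootP; rewrite size_char_poly.
have /eigenvalueP [r] : eigenvalue U^T z.
  by rewrite eigenvalue_root_char; apply/rootP.
move=> /(congr1 trmx); rewrite trmx_mul trmxK linearZ /= => e nr.
by exists z, r^T; rewrite trmx_eq0.
Qed.

(** The quaternionic structure of the plane, which commutes with SU(2): it
    turns an eigenvector into the other one. *)
Definition qconj v : vec := vec2 (- (v 1 0)^*%C) ((v 0 0)^*%C).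

Lemma qconjZ t v : qconj (t *: v) = t^*%C *: qconj v.
Proof. by apply: vec_eqP; rewrite !mxE /= rmorphM ?mulrN. Qed.

Lemma SU2_qconj U v : SU2 U -> U *m qconj v = qconj (U *m v).
Proof.
move=> /quatP [x [a [b [c [-> _]]]]].
apply: vec_eqP; rewrite !mulmx2E ?vec2E0 ?vec2E1 !mulmx2E !mx2E;
  case: (v 0 0) => p q; case: (v 1 0) => r s;
  by rewrite !(oppcE, mulcE, addcE) /= ?oppcE ?mulcE; congr (_ +i* _); ring.
Qed.

Lemma area_qconj_neq0 w : w != 0 -> area w (qconj w) != 0.
Proof.
move=> nw; rewrite /area /qconj !mxE /= mulrN opprK.
rewrite -[(w 0 0)^*%C]/((w 0 0)^*)%R -[(w 1 0)^*%C]/((w 1 0)^*)%R -!normCK.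
rewrite paddr_eq0 ?exprn_ge0 // !expf_eq0 /= !normr_eq0 negb_and.
by case: (vec_neq0 nw) => ->; rewrite ?orbT.
Qed.

Lemma qconj_neq0 w : w != 0 -> qconj w != 0.
Proof.
move=> /area_qconj_neq0; apply: contra_neq => ->.
by rewrite /area !mxE !mulr0 subrr.
Qed.

Lemma eigen_qconj U w z : SU2 U -> w != 0 -> U *m w = z *: w ->
  z != 0 /\ U *m qconj w = z^-1 *: qconj w.
Proof.
move=> sU nw e; have e' : U *m qconj w = z^*%C *: qconj w.
  by rewrite SU2_qconj // e qconjZ.
have zz : z * z^*%C = 1.
  have := area_mul U w (qconj w).
  rewrite sU.2 mul1r e e' area_scalel area_scaler mulrA => h.
  by apply: (mulIf (area_qconj_neq0 nw)); rewrite h mul1r.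
have nz : z != 0 by apply: contra_eq_neq zz => ->; rewrite mul0r eq_sym oner_eq0.
by split=> //; rewrite e' -(mulKf nz z^*%C) zz mulr1.
Qed.

Lemma eigen_basisP U V w (z : C) : w != 0 -> U *m w = V *m w ->
  U *m qconj w = V *m qconj w -> U = V.
Proof.
move=> nw e1 e2; have nq := area_qconj_neq0 nw.
suff h v : U *m v = V *m v.
  apply/matrixP => i j; have := h (\col_k (k == j)%:R).
  move=> /matrixP/(_ i 0); rewrite !mulmx2E !mxE.
  by case: (I2P j) => -> /=; rewrite !(mulr0, mulr1, addr0, add0r).
have ea : area w ((area w (qconj w))^-1 *: qconj w) = 1.
  by rewrite area_scaler mulVf.
by rewrite (area_decomp v ea) !mulmxDr -!scalemxAr e1 e2.
Qed.

(** The two eigenlines of [U]: its eigenvalues [z] and [z^-1] differ, for otherwise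
    [U] would be [1] or [- 1]. *)
Lemma two_fixed_lines U : SU2 U -> U <> 1%:M -> U <> - 1%:M ->
  exists L1 L2, [/\ \dim L1 = 1%N, \dim L2 = 1%N, L1 != L2 &
    forall L, \dim L = 1%N -> act_line U L = L <-> L = L1 \/ L = L2].
Proof.
move=> sU n1 n2; have [z [w [nw e]]] := eigen_exists U.
have [nz e'] := eigen_qconj sU nw e.
have nq := qconj_neq0 nw; have na := area_qconj_neq0 nw.
exists <[w]>%VS, <[qconj w]>%VS; rewrite !dim_vline nw nq; split => //.
  by apply/line_eqP => //; apply/eqP.
have zz : z != z^-1.
  apply/eqP => ez; have : z ^+ 2 = 1 by rewrite expr2 {2}ez mulfV.
  move=> /eqP; rewrite sqrf_eq1 => /orP[] /eqP z1.
    by apply: n1; apply: (@eigen_basisP _ _ w 1) => //;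
      rewrite ?e ?e' mul1mx z1 ?invr1 scale1r.
  by apply: n2; apply: (@eigen_basisP _ _ w 1) => //;
    rewrite ?e ?e' mulNmx mul1mx z1 ?invrN ?invr1 scaleN1r.
move=> _ /dim1_line [v nv ->]; rewrite act_lineE.
have nUv : U *m v != 0 by apply: mulmx_neq0; rewrite // sU.2 oner_eq0.
have ea : area w ((area w (qconj w))^-1 *: qconj w) = 1.
  by rewrite area_scaler mulVf.
split=> [/eqP/(line_eqP nUv nv)|].
  have := area_decomp v ea.
  set a := area v _; set b := area w v; set q := qconj w.
  rewrite scalerA; set b' := b * _ => ev.
  rewrite ev mulmxDr -!scalemxAr e e' => h.
  rewrite !scalerA area_lin2 in h.
  have /eqP : a * z * b' - b' * z^-1 * a = 0.
    by apply: (mulIf na); rewrite mul0r.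
  rewrite eigen_cross.
  rewrite mulf_eq0 subr_eq0 (negPf zz) mulf_eq0 /= => /orP[] /eqP h0.
    right; apply/eqP; rewrite -ev; apply/(line_eqP nv nq).
    by rewrite ev h0 scale0r add0r area_scalel area_ww mulr0.
  left; apply/eqP; rewrite -ev; apply/(line_eqP nv nw).
  by rewrite ev h0 scale0r addr0 area_scalel area_ww mulr0.
case=> /eqP/(line_eqP nv) h; apply/eqP/(line_eqP nUv nv).
  have [t ->] := area_eq0 nw (area_sym (h nw)).
  by rewrite -scalemxAr e !area_scalel area_scaler area_ww !mulr0.
have [t ->] := area_eq0 nq (area_sym (h nq)).
by rewrite -scalemxAr e' !area_scalel area_scaler area_ww !mulr0.
Qed.

End Lines.
(** * Orbits and stabilisers *)

Section OrbitCounting.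
Variables (R : realType) (G : {fset 'M[R]_3}).
Hypothesis hG : finite_subgroup_SO3 G.
Local Notation C := R[i].
Local Notation line := {vspace 'cV[C]_2}.
Local Notation B := (binary_group G).
Implicit Types (U V : 'M[C]_2) (L : line) (A : 'M[R]_3).

Lemma binaryP U : B U <-> SU2 U /\ double_cover U \in G.
Proof. by []. Qed.

Lemma binary1 : B 1%:M.
Proof.
by apply/binaryP; rewrite double_cover1 (SO3_one hG); split=> //; exact: SU2_1.
Qed.

Lemma binaryM U V : B U -> B V -> B (U *m V).
Proof.
move=> /binaryP[sU gU] /binaryP[sV gV]; apply/binaryP; split; first exact: SU2M.
by rewrite (double_coverM sU sV); exact: (SO3_mul hG gU gV).
Qed.

Lemma binaryV U : B U -> B (invmx U).
Proof.
move=> [sU gU]; have sV := SU2V sU; apply/binaryP; split; first exact: sV.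
have e : double_cover U *m double_cover (invmx U) = 1%:M.
  by rewrite -(double_coverM sU sV) (mulmxV (SU2_unit sU)) double_cover1.
have [uU _] := mulmx1_unit e.
rewrite (_ : double_cover (invmx U) = invmx (double_cover U)).
  exact: (SO3_inv hG).
by rewrite -[RHS]mulmx1 -e (mulKmx uU).
Qed.

Lemma binaryN U : B U -> B (- U).
Proof.
move=> [sU gU]; apply/binaryP; split; first exact: SU2N.
by rewrite double_coverN.
Qed.

(** One of the two preimages in SU(2); they act in the same way on lines. *)
Definition lift A : 'M[C]_2 := xget 0 [set U | SU2 U /\ double_cover U = A].

Lemma liftP A : A \in G -> SU2 (lift A) /\ double_cover (lift A) = A.
Proof.
move=> gA; have [oA dA] := SO3_orthogonal hG gA.
have [U sU dU] := double_cover_surj oA dA.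
by apply: (@xgetPex _ 0 [set U | SU2 U /\ double_cover U = A]); exists U.
Qed.

Lemma binary_lift A : A \in G -> B (lift A).
Proof. move=> gA; have [sU dU] := liftP gA; apply/binaryP; split; first exact: sU.
by rewrite dU. Qed.

Definition gact A L := act_line (lift A) L.

Lemma gactE U L : B U -> gact (double_cover U) L = act_line U L.
Proof.
move=> [sU gU]; have [sV dV] := liftP gU.
by rewrite /gact; case: (double_cover_inj sV sU dV) => ->; rewrite ?act_lineN.
Qed.

Lemma gactM A A' L : A \in G -> A' \in G -> gact (A *m A') L = gact A (gact A' L).
Proof.
move=> gA gA'; have [sU dU] := liftP gA; have [sV dV] := liftP gA'.
rewrite -{1}dU -{1}dV -(double_coverM sU sV) gactE ?act_lineM //.
by apply: binaryM; apply: binary_lift.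
Qed.

Lemma gact1 L : gact 1%:M L = L.
Proof. by rewrite -double_cover1 gactE ?act_line1 //; exact: binary1. Qed.

Lemma gact_inj A : A \in G -> injective (gact A).
Proof.
move=> gA L L' e; have gV := SO3_inv hG gA.
have uA : A \in unitmx.
  by case: (mulmx1_unit (SO3_orthogonal hG gA).1).
by rewrite -[L]gact1 -(mulVmx uA) gactM // e -gactM // mulVmx // gact1.
Qed.

Lemma reindex_group A0 : A0 \in G -> perm_eq [seq A0 *m A | A <- G] G.
Proof.
move=> gA; have uA : A0 \in unitmx.
  by case: (mulmx1_unit (SO3_orthogonal hG gA).1).
apply: uniq_perm; first by rewrite map_inj_uniq ?fset_uniq //; exact: can_inj (mulKmx uA).
  exact: fset_uniq.
move=> A; apply/mapP/idP => [[A' gA' ->]|gA1]; first exact: (SO3_mul hG).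
exists (invmx A0 *m A); last by rewrite mulKVmx.
by apply: (SO3_mul hG) => //; apply: (SO3_inv hG).
Qed.

Lemma fixesP A L : A \in G ->
  (exists U, [/\ SU2 U, double_cover U = A & act_line U L = L]) <-> gact A L = L.
Proof.
move=> gA; split=> [[U [sU dU fU]]|fA].
  by rewrite -dU gactE //; apply/binaryP; rewrite dU.
by exists (lift A); have [? ?] := liftP gA.
Qed.

Lemma stab_orderE L : stab_order G L = (\sum_(A <- G) (gact A L == L))%N.
Proof.
rewrite /stab_order card_fset_sum1 -big_fset_condE big_mkcond /=.
apply: eq_big_seq => A gA; case: asboolP => [/(fixesP _ gA) ->|h].
  by rewrite eqxx.
by case: eqP => // /(fixesP _ gA).
Qed.

Lemma orbitE L : orbit_line G L = [set` [fset gact A L | A in G]%fset].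
Proof.
apply/seteqP; split=> [L' [U bU <-]|L' /= /imfsetP [A /= gA ->]].
  by rewrite /= -gactE //; apply/imfsetP; exists (double_cover U) => //; case: bU.
by exists (lift A); first exact: binary_lift.
Qed.

(** All fibres of the orbit map have the size of the stabiliser: translating the
    group carries one to the other. *)
Lemma orbit_stabiliser L : (#|` fset_set (orbit_line G L)| * stab_order G L)%N = #|` G|.
Proof.
rewrite orbitE set_fsetK -[RHS]sum1_size (partition_big_imfset _ (fun A => gact A L)) /=.
rewrite (eq_big_seq (fun=> stab_order G L)) => [|L' /imfsetP [A0 /= gA ->]].
  by rewrite big_const_seq count_predT iter_addn_0 mulnC.
rewrite stab_orderE -(perm_big _ (reindex_group gA)) big_map big_mkcond /=.
apply: eq_big_seq => A gA'; rewrite gactM // (inj_eq (gact_inj gA)).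
by case: eqP.
Qed.

End OrbitCounting.
(** * The Riemann-Hurwitz count *)

Section RiemannHurwitz.
Variables (R : realType) (G : {fset 'M[R]_3}).
Hypothesis hG : finite_subgroup_SO3 G.
Local Notation C := R[i].
Local Notation line := {vspace 'cV[C]_2}.
Local Notation B := (binary_group G).
Implicit Types (U V : 'M[C]_2) (L : line) (A : 'M[R]_3) (S : set line).

Lemma binary_det U : B U -> \det U = 1.
Proof. by case=> -[]. Qed.

Lemma orbit_line_id L : orbit_line G L L.
Proof. by exists 1%:M; [exact: binary1 | exact: act_line1]. Qed.

Lemma orbit_line_eq L L' : orbit_line G L L' -> orbit_line G L' = orbit_line G L.
Proof.
move=> [U bU <-]; apply/seteqP; split=> _ [V bV <-].
  by exists (V *m U); [exact: (binaryM hG bV bU) | rewrite act_lineM].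
exists (V *m invmx U); first exact: (binaryM hG bV (binaryV hG bU)).
by rewrite -act_lineM mulmxKV // (SU2_unit bU.1).
Qed.

Lemma orbitP S L : is_orbit G S -> S L -> \dim L = 1%N /\ S = orbit_line G L.
Proof.
move=> [L0 dL0 ->] hL; split; last by rewrite (orbit_line_eq hL).
case: hL => U bU <-; apply: dim_act_line => //.
by rewrite (binary_det bU) oner_eq0.
Qed.

Lemma orbit_finite S : is_orbit G S -> finite_set S.
Proof. by move=> [L _ ->]; rewrite (orbitE hG). Qed.

Lemma orbit_act S U L : is_orbit G S -> B U -> S L -> S (act_line U L).
Proof. by move=> oS bU /(orbitP oS) [_ ->]; exists U. Qed.

Lemma mem_orbit S L : is_orbit G S -> (L \in fset_set S) = (L \in S).
Proof. by move=> /orbit_finite fS; rewrite in_fset_set. Qed.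

Lemma orbit_card_gt0 S L : is_orbit G S -> S L -> (0 < #|` fset_set S|)%N.
Proof.
move=> oS SL; rewrite cardfs_gt0; apply/fset0Pn; exists L.
by rewrite mem_orbit // inE.
Qed.

Lemma orbit_card S L : is_orbit G S -> S L ->
  (#|` fset_set S| * stab_order G L)%N = #|` G|.
Proof. by move=> oS /(orbitP oS) [_ ->]; apply: orbit_stabiliser. Qed.

Lemma stab_order_orbit S L L' : is_orbit G S -> S L -> S L' ->
  stab_order G L = stab_order G L'.
Proof.
move=> oS SL SL'; apply/eqP.
rewrite -(eqn_pmul2l (orbit_card_gt0 oS SL)).
by rewrite (orbit_card oS SL) (orbit_card oS SL').
Qed.

Lemma group_card_gt0 : (0 < #|` G|)%N.
Proof. by rewrite cardfs_gt0; apply/fset0Pn; exists 1%:M; exact: (SO3_one hG). Qed.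

Lemma stab_order_gt0 L : (0 < stab_order G L)%N.
Proof.
have := group_card_gt0; rewrite -(orbit_stabiliser hG L) muln_gt0.
by case/andP.
Qed.

Variables (Omega : finType) (Sx : Omega -> set line).
Hypotheses (hSx_inj : injective Sx) (hSx : range Sx = exceptional_orbits G).
Variables (d nu : Omega -> nat).
Hypotheses (hd : forall i, d i = #|` fset_set (Sx i)|)
  (hnu : forall i L, Sx i L -> stab_order G L = nu i).
Local Notation N := #|` G|.

Lemma Sx_orbit i : is_orbit G (Sx i).
Proof. by have [] : exceptional_orbits G (Sx i) by rewrite -hSx; exists i. Qed.

Lemma Sx_nonempty i : exists L, Sx i L.
Proof. by have [L _ ->] := Sx_orbit i; exists L; exact: orbit_line_id. Qed.

Lemma d_nu i : (d i * nu i)%N = N.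
Proof.
have [L iL] := Sx_nonempty i.
by rewrite hd -(hnu iL) (orbit_card (Sx_orbit i) iL).
Qed.

Lemma nu_gt1 i : (1 < nu i)%N.
Proof.
have [L iL] := Sx_nonempty i; rewrite -(hnu iL).
have [_] : exceptional_orbits G (Sx i) by rewrite -hSx; exists i.
exact.
Qed.

Lemma Sx_disjoint i j L : Sx i L -> Sx j L -> i = j.
Proof.
move=> iL jL; apply: hSx_inj.
by rewrite (orbitP (Sx_orbit i) iL).2 (orbitP (Sx_orbit j) jL).2.
Qed.

Lemma exceptionalP L : \dim L = 1%N -> (1 < stab_order G L)%N -> exists i, Sx i L.
Proof.
move=> dL sL; have oL : is_orbit G (orbit_line G L) by exists L.
have : exceptional_orbits G (orbit_line G L).
  split=> // L' oL'; rewrite (stab_order_orbit oL oL' (orbit_line_id L)) //.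
by rewrite -hSx => -[i _ e]; exists i; rewrite e; exact: orbit_line_id.
Qed.

Lemma stab_order_nonid L : stab_order G L =
  (1 + \sum_(A <- G | A != 1%:M) (gact A L == L))%N.
Proof.
rewrite (stab_orderE hG) (bigID (fun A => A == 1%:M)) /=; congr (_ + _)%N.
rewrite big_mkcond (big_fsetD1 1%:M) ?(SO3_one hG) //= eqxx (gact1 hG) eqxx.
by rewrite big1_fset // => A; rewrite !inE => /andP[/negPf -> _].
Qed.

Lemma lift_neq1 A : A \in G -> A != 1%:M -> lift A <> 1%:M /\ lift A <> - 1%:M.
Proof.
move=> gA nA; have [sU dU] := liftP hG gA.
split=> e; move/eqP: nA; apply; rewrite -dU e ?double_coverN double_cover1 //.
Qed.

Lemma exceptional_count L : \dim L = 1%N -> (1 < stab_order G L)%N ->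
  (\sum_i (L \in fset_set (Sx i)))%N = 1%N.
Proof.
move=> dL sL; have [i iL] := exceptionalP dL sL.
rewrite (bigD1 i) //= mem_orbit; last exact: Sx_orbit.
rewrite mem_set // big1 // => j nj; rewrite mem_orbit; last exact: Sx_orbit.
by rewrite memNset // => jL; move/eqP: nj; apply; apply: Sx_disjoint jL iL.
Qed.

Lemma fixed_count A : A \in G -> A != 1%:M ->
  (\sum_i \sum_(L <- fset_set (Sx i)) (gact A L == L))%N = 2%N.
Proof.
move=> gA nA; have [sU dU] := liftP hG gA; have [n1 n2] := lift_neq1 gA nA.
have [L1 [L2 [d1 d2 n12 fix12]]] := two_fixed_lines sU n1 n2.
have stab L : \dim L = 1%N -> gact A L = L -> (1 < stab_order G L)%N.
  move=> dL fL; rewrite stab_order_nonid add1n ltnS.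
  by rewrite big_mkcond (big_fsetD1 A) //= nA fL eqxx.
have s1 : (1 < stab_order G L1)%N by apply: stab => //; apply/fix12 => //; left.
have s2 : (1 < stab_order G L2)%N by apply: stab => //; apply/fix12 => //; right.
transitivity (\sum_i (L1 \in fset_set (Sx i))
   + \sum_i (L2 \in fset_set (Sx i)))%N; last by rewrite !exceptional_count.
rewrite -big_split /=; apply: eq_bigr => i _.
transitivity (\sum_(L <- fset_set (Sx i)) ((L == L1) + (L == L2)))%N.
  apply: eq_big_seq => L; rewrite mem_orbit ?inE; last exact: Sx_orbit.
  move=> /(orbitP (Sx_orbit i)) [dL _].
  case: (eqVneq (gact A L) L) => [/(fix12 L dL) [] ->|nL].
  - by rewrite eqxx (negPf n12).
  - by rewrite eqxx eq_sym (negPf n12).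
  have /negPf -> : L != L1 by apply: contra_neq nL => ->; apply/fix12 => //; left.
  have /negPf -> // : L != L2 by apply: contra_neq nL => ->; apply/fix12 => //; right.
have count1 L' : (\sum_(L <- fset_set (Sx i)) (L == L'))%N = (L' \in fset_set (Sx i)).
  have [L'i|nL'] := boolP (L' \in fset_set (Sx i)).
    rewrite (big_fsetD1 L') //= eqxx big1_fset // => L.
    by rewrite !inE => /andP[/negPf -> _].
  rewrite big1_fset // => L iL _; case: eqP => // e; move: iL nL'.
  by rewrite e => ->.
by rewrite big_split /= !count1.
Qed.

(** Counting the pairs of a nontrivial rotation and a point it fixes in two
    ways gives the Riemann-Hurwitz formula for the quotient of the sphere. *)
Lemma riemann_hurwitz : (\sum_i (N - d i) = 2 * (N - 1))%N.
Proof.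
transitivity (\sum_i \sum_(L <- fset_set (Sx i))
                \sum_(A <- G | A != 1%:M) (gact A L == L))%N.
  apply: eq_bigr => i _.
  transitivity (\sum_(L <- fset_set (Sx i)) (nu i - 1))%N.
    by rewrite big_const_seq count_predT iter_addn_0 -hd mulnC mulnBr d_nu muln1.
  apply: eq_big_seq => L; rewrite mem_orbit ?inE; last exact: Sx_orbit.
  by move=> iL; rewrite -(hnu iL) stab_order_nonid addKn.
under eq_bigr do rewrite exchange_big.
rewrite exchange_big /=.
transitivity (\sum_(A <- G | A != 1%:M) 2)%N.
  rewrite big_seq_cond [RHS]big_seq_cond; apply: eq_bigr => A /andP[gA nA].
  exact: fixed_count.
rewrite big_const_seq iter_addn_0; congr (_ * _)%N.
have := card_fset_sum1 G; rewrite (bigID (fun A => A == 1%:M)) /=.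
rewrite [X in (_ + X)%N]sum1_count big_mkcond (big_fsetD1 1%:M) ?(SO3_one hG) //= eqxx big1_fset.
  by move=> ->; rewrite addn0 add1n subn1.
by move=> A; rewrite !inE => /andP[/negPf -> _].
Qed.

Lemma sum_d : (\sum_i (d i)%:Z = (#|Omega|%:Z - 2) * N%:Z + 2)%R.
Proof.
have h := riemann_hurwitz; have Ngt0 := group_card_gt0.
have dN i : (d i <= N)%N by rewrite -(d_nu i) leq_pmulr // ltnW // nu_gt1.
have : (\sum_i (N - d i)%N%:Z = #|Omega|%:Z * N%:Z - \sum_i (d i)%:Z)%R.
  under eq_bigr do rewrite -subzn //.
  by rewrite sumrB sumr_const -mulr_natl natz.
rewrite -(big_morph Posz PoszD (erefl 0%:Z)) h.
by rewrite PoszM -subzn //; lia.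
Qed.

(** As [k / 2] and its residue [n_i] agree modulo [nu_i] and [d_i nu_i = N], the sum
    of the [n_i d_i] is [k / 2] times the sum of the [d_i] modulo [N]. By the
    Riemann-Hurwitz count the latter sum is 2 modulo [N]. *)
Lemma Pk_degree (k : int) : (2 %| k)%Z ->
  ((k - (\sum_i residue (nu i) k * d i)%N%:Z) %/ N)%Z * N%:Z
   + (\sum_i residue (nu i) k * d i)%N%:Z = k.
Proof.
move=> /dvdzP [h ->].
suff : (N%:Z %| (h * 2)%R - (\sum_i residue (nu i) (h * 2)%R * d i)%N%:Z)%Z.
  by move=> /divzK ->; rewrite subrK.
have e i : (residue (nu i) (h * 2)%R * d i)%N%:Z
    = h * (d i)%:Z - (h %/ nu i)%Z * N%:Z.
  rewrite /residue mulzK // PoszM gez0_abs ?modz_ge0 //; last first.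
    by have := nu_gt1 i; lia.
  rewrite /modz mulrBl -mulrA; congr (_ - _ * _).
  by rewrite mulrC -PoszM d_nu.
rewrite (big_morph Posz PoszD (erefl 0%:Z)).
under eq_bigr do rewrite e.
rewrite sumrB -mulr_sumr -mulr_suml sum_d.
apply/dvdzP; exists (- h * (#|Omega|%:Z - 2) + \sum_i (h %/ nu i)%Z).
by move: (\sum_i _) (#|Omega|%:Z) (N%:Z) => s o n; ring.
Qed.

End RiemannHurwitz.
(** * Eigenvalues of a point stabiliser *)

Section Stabiliser.
Variables (R : realType) (G : {fset 'M[R]_3}).
Hypothesis hG : finite_subgroup_SO3 G.
Local Notation C := R[i].
Local Notation vec := 'cV[C]_2.
Local Notation line := {vspace 'cV[C]_2}.
Local Notation B := (binary_group G).
Implicit Types (U V : 'M[C]_2) (L : line) (A : 'M[R]_3) (w : vec) (z : C).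

(** The eigenvalue of [U] at an eigenvector [w], by a formula that makes sense for
    all [U]. *)
Definition eigen_ratio U w : C := area (U *m w) (qconj w) / area w (qconj w).

Lemma eigen_ratioE U w z : w != 0 -> U *m w = z *: w -> eigen_ratio U w = z.
Proof.
move=> nw e; rewrite /eigen_ratio e area_scalel mulfK //.
exact: area_qconj_neq0.
Qed.

Lemma fixes_eigen U w : \det U != 0 -> w != 0 -> act_line U <[w]>%VS = <[w]>%VS ->
  U *m w = eigen_ratio U w *: w.
Proof.
move=> dU nw; rewrite act_lineE => /eqP/(line_eqP (mulmx_neq0 dU nw) nw).
by move=> /area_sym/(area_eq0 nw) [t e]; rewrite (eigen_ratioE nw e).
Qed.

Lemma eigen_fixes U w z : w != 0 -> z != 0 -> U *m w = z *: w ->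
  act_line U <[w]>%VS = <[w]>%VS.
Proof.
move=> nw nz e; rewrite act_lineE e; apply/eqP/line_eqP => //.
  by rewrite scaler_eq0 negb_or nz.
by rewrite area_scalel area_ww mulr0.
Qed.

Variable w : vec.
Hypothesis nw : w != 0.
Local Notation L := (<[w]>%VS : line).

Definition stabiliser : {fset 'M[R]_3} := [fset A in G | gact A L == L]%fset.

Lemma in_stabiliser A : (A \in stabiliser) = (A \in G) && (gact A L == L).
Proof. by rewrite !inE. Qed.

Lemma card_stabiliser : #|` stabiliser| = stab_order G L.
Proof.
rewrite (stab_orderE hG) card_fset_sum1 -big_fset_condE big_mkcond /=.
by apply: eq_bigr => A _; case: eqP.
Qed.

(** The square removes the ambiguity of sign in the choice of a lift. *)
Definition stab_char A : C := eigen_ratio (lift A) w ^+ 2.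

Lemma lift_eigen A : A \in stabiliser ->
  lift A *m w = eigen_ratio (lift A) w *: w /\ eigen_ratio (lift A) w != 0.
Proof.
rewrite in_stabiliser => /andP[gA /eqP fA]; have [sU dU] := liftP hG gA.
have n1 : \det (lift A) != 0 by rewrite sU.2 oner_neq0.
have e := fixes_eigen n1 nw fA; split=> //.
by have [] := eigen_qconj sU nw e.
Qed.

Lemma stab_char_eigen U z : B U -> U *m w = z *: w ->
  double_cover U \in stabiliser /\ stab_char (double_cover U) = z ^+ 2.
Proof.
move=> bU e; have [sU gU] := bU; have [nz _] := eigen_qconj sU nw e.
have [sV dV] := liftP hG gU; split.
  by rewrite in_stabiliser gU (gactE hG _ bU) (eigen_fixes nw nz e) eqxx.
rewrite /stab_char; case: (double_cover_inj sV sU dV) => ->.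
  by rewrite (eigen_ratioE nw e).
by rewrite (@eigen_ratioE _ _ (- z)) ?sqrrN // mulNmx e scaleNr.
Qed.

Lemma stab_charM A A' : A \in stabiliser -> A' \in stabiliser ->
  A *m A' \in stabiliser /\ stab_char (A *m A') = stab_char A * stab_char A'.
Proof.
move=> sA sA'; have [e n] := lift_eigen sA; have [e' n'] := lift_eigen sA'.
have [gA _] := andP (etrans (esym (in_stabiliser A)) sA).
have [gA' _] := andP (etrans (esym (in_stabiliser A')) sA').
have [sU dU] := liftP hG gA; have [sV dV] := liftP hG gA'.
have bUV : B (lift A *m lift A').
  exact: (binaryM hG (binary_lift hG gA) (binary_lift hG gA')).
have eUV : (lift A *m lift A') *m w =
    (eigen_ratio (lift A) w * eigen_ratio (lift A') w) *: w.
  by rewrite -mulmxA e' -scalemxAr e scalerA mulrC.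
have := stab_char_eigen bUV eUV.
by rewrite (double_coverM sU sV) dU dV exprMn.
Qed.

Lemma stab_char_neq0 A : A \in stabiliser -> stab_char A != 0.
Proof. by move=> /lift_eigen [_ n]; apply: expf_neq0. Qed.

(** A finite group of roots of unity: multiplying its elements together, once
    directly and once after translating by one of them, shows that each has
    order dividing the order of the group. *)
Lemma stab_char_pow A : A \in stabiliser -> stab_char A ^+ stab_order G L = 1.
Proof.
move=> sA; have [gA _] := andP (etrans (esym (in_stabiliser A)) sA).
have uA : A \in unitmx by case: (mulmx1_unit (SO3_orthogonal hG gA).1).
have pe : perm_eq [seq A *m A' | A' <- stabiliser] stabiliser.
  have us : uniq [seq A *m A' | A' <- stabiliser].
    by rewrite map_inj_uniq ?fset_uniq //; exact: can_inj (mulKmx uA).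
  apply: uniq_perm => //; first exact: fset_uniq.
  apply: (uniq_min_size us _ _).2 => [x /mapP[A' sA' ->]|].
    by have [] := stab_charM sA sA'.
  by rewrite size_map.
have n0 : \prod_(A' <- stabiliser) stab_char A' != 0.
  by rewrite prodf_seq_neq0; apply/allP => A' sA'; apply: stab_char_neq0.
apply: (mulIf n0); rewrite mul1r -[in RHS](perm_big _ pe) big_map.
rewrite [RHS](eq_big_seq (fun A' => stab_char A * stab_char A')).
  rewrite [RHS]big_split /= -card_stabiliser; congr (_ * _).
  by rewrite big_const_seq count_predT -iter_mulr_1.
by move=> A' sA'; have [] := stab_charM sA sA'.
Qed.

(** A matrix in SU(2) is determined by one eigenvector and its eigenvalue; equal
    squares leave a sign, which the double cover forgets. *)
Lemma stab_char_inj A A' : A \in stabiliser -> A' \in stabiliser ->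
  stab_char A = stab_char A' -> A = A'.
Proof.
move=> sA sA'; have [e n] := lift_eigen sA; have [e' n'] := lift_eigen sA'.
have [gA _] := andP (etrans (esym (in_stabiliser A)) sA).
have [gA' _] := andP (etrans (esym (in_stabiliser A')) sA').
have [sU dU] := liftP hG gA; have [sV dV] := liftP hG gA'.
move=> /eqP; rewrite /stab_char eqf_sqr => /orP[] /eqP ez.
  rewrite -dU -dV; congr double_cover; apply: (@eigen_basisP _ _ _ w 1) => //.
    by rewrite e e' ez.
  by rewrite (eigen_qconj sU nw e).2 (eigen_qconj sV nw e').2 ez.
rewrite -dU -dV -(double_coverN (lift A')); congr double_cover.
apply: (@eigen_basisP _ _ _ w 1) => //.
  by rewrite mulNmx e e' ez scaleNr.
by rewrite mulNmx (eigen_qconj sU nw e).2 (eigen_qconj sV nw e').2 ez invrN scaleNr.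
Qed.

Lemma stab_eigen_pow U z (e : int) : B U -> U *m w = z *: w ->
  (stab_order G L %| e)%Z -> z ^ (2 * e) = 1.
Proof.
move=> bU eU /dvdzP [q ->]; have [sU ez] := stab_char_eigen bU eU.
have := stab_char_pow sU; rewrite ez => e1.
by rewrite mulrCA mulrC -!exprz_exp -[z ^ 2]/(z ^+ 2) -exprnP e1 exp1rz.
Qed.

(** The squared eigenvalues are as many distinct roots of unity as the order of
    the stabiliser, so they cannot all be roots of a smaller degree. *)
Lemma stab_eigen_dvd (e : int) :
  (forall U z, B U -> U *m w = z *: w -> z ^ (2 * e) = 1) ->
  (stab_order G L %| e)%Z.
Proof.
move=> h; set n := stab_order G L.
have n0 : (0 < n)%N := stab_order_gt0 hG L.
pose r := `|(e %% n)%Z|%N.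
have er : (r%:Z = e %% n)%Z by rewrite gez0_abs // modz_ge0 // eqz_nat -lt0n.
have rn : (r < n)%N by rewrite -ltz_nat er ltz_pmod.
suff r0 : r = 0%N by apply/dvdz_mod0P; rewrite -er r0.
apply/eqP; rewrite -leqn0 leqNgt; apply/negP => r0.
have hr A : A \in stabiliser -> stab_char A ^+ r = 1.
  move=> sA; have [eA nA] := lift_eigen sA.
  have [gA _] := andP (etrans (esym (in_stabiliser A)) sA).
  have := h _ _ (binary_lift hG gA) eA; rewrite -exprz_exp -[_ ^ 2]/(stab_char A).
  rewrite {1}(divz_eq e n) -er expfzDr ?stab_char_neq0 // [_ * n%:Z]mulrC -exprz_exp.
  by rewrite -!exprnP [_ ^+ n](stab_char_pow sA) exp1rz mul1r.
have : (size [seq stab_char A | A <- stabiliser] < size ('X^r - 1 : {poly C})%R)%N.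
  apply: max_poly_roots.
  - by rewrite -size_poly_gt0 size_XnsubC.
  - apply/allP => _ /mapP[A sA ->]; rewrite rootE !hornerE hr // subrr //.
  - rewrite map_inj_in_uniq ?fset_uniq //; exact: stab_char_inj.
by rewrite size_map card_stabiliser size_XnsubC // ltnS leqNgt rn.
Qed.

End Stabiliser.
(** * Ground forms *)

Section SemiInvariants.
Variables (R : realType) (G : {fset 'M[R]_3}).
Hypothesis hG : finite_subgroup_SO3 G.
Local Notation C := R[i].
Local Notation vec := 'cV[C]_2.
Local Notation line := {vspace 'cV[C]_2}.
Local Notation B := (binary_group G).
Local Notation N := #|` G|.
Implicit Types (U V : 'M[C]_2) (L : line) (u v w : vec) (z : C) (f : vec -> C).

Lemma form_of_homogeneous m (q : mpoly 2 C) : homogeneous m q -> is_form m (ev q).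
Proof. exact: is_form_ev. Qed.

(** On the affine line [vec2 z 1] distinct monomials of the same degree restrict to
    distinct powers of [z]. *)
Lemma homogeneous_neq0 m (q : mpoly 2 C) : homogeneous m q -> q != 0 ->
  exists u, ev q u != 0.
Proof.
move=> hq nq; apply/not_existsP => h; move/negP: nq; apply; apply/eqP.
pose f := \sum_(a <- msupp q) mcoeff a q *: 'X^(a 0%R) : {poly C}.
have f0 : f = 0.
  apply: poly_eq0 => z _; have /negP := h (vec2 z 1); rewrite negbK => /eqP <-.
  rewrite /ev mevalE horner_sum; apply: eq_bigr => a _.
  by rewrite prod2E vec2E0 vec2E1 expr1n mulr1 hornerZ hornerXn.
apply/mpolyP => b; rewrite mcoeff0.
have [bq|] := boolP (b \in msupp q); last by move/memN_msupp_eq0.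
have := congr1 (fun r : {poly C} => r`_(b 0%R)) f0; rewrite coef0 coef_sum => <-.
rewrite (bigD1_seq b) ?msupp_uniq //= coefZ coefXn eqxx mulr1.
rewrite big_seq_cond big1 ?addr0 // => a /andP[aq nab].
rewrite coefZ coefXn; case: eqP => [e|]; last by rewrite mulr0.
case/eqP: nab; apply/mnmP => j; move/dhomogP: hq => hq.
have := hq a aq; rewrite -(hq b bq) /= !mdegE !sum2E e => /addnI e1.
by case: (I2P j) => ->.
Qed.

Lemma vpick_line L : \dim L = 1%N -> vpick L != 0 /\ <[vpick L]>%VS = L.
Proof.
move=> dL; have nL : L != 0%VS by rewrite -dimv_eq0 dL.
rewrite vpick0 nL; split=> //.
by apply/eqP; rewrite eqEdim -memvE memv_pick dL dim_vline vpick0 nL.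
Qed.

Lemma area_vpick L L' : \dim L = 1%N -> \dim L' = 1%N -> L != L' ->
  area (vpick L) (vpick L') != 0.
Proof.
move=> /vpick_line [n e] /vpick_line [n' e']; apply: contraNneq => h.
by rewrite -{1}e -e'; apply/line_eqP.
Qed.

Definition line_form (X : {fset line}) (e : nat) v : C :=
  \prod_(L <- X) area (vpick L) v ^+ e.

Lemma is_form_line_form X e : is_form (#|` X| * e) (line_form X e).
Proof.
have := @is_form_prod _ line X (fun=> (1 * e)%N)
  (fun L v => area (vpick L) v ^+ e).
rewrite big_const_seq count_predT iter_addn_0 mul1n mulnC; apply=> L.
by rewrite -[e in is_form e]mul1n; apply/is_formX/is_form_area.
Qed.

Lemma line_form_neq0 X e w : (forall L, L \in X -> area (vpick L) w != 0) ->
  line_form X e w != 0.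
Proof.
move=> h; rewrite prodf_seq_neq0; apply/allP => L LX /=.
exact/expf_neq0/h.
Qed.

Lemma line_form_div (X : {fset line}) e m f :
  is_form m f -> (exists u, f u != 0) ->
  (forall L, L \in X -> \dim L = 1%N) ->
  (forall L, L \in X -> exists n h, is_form n h /\
     forall v, f v = area (vpick L) v ^+ e * h v) ->
  exists n g, [/\ m = (n + #|` X| * e)%N, is_form n g &
    forall v, f v = line_form X e v * g v].
Proof.
move=> hf nf dX hX.
have [|||n [g [em hg eg]]] :=
  @div_product _ _ X (fun L => vpick L) (fun=> e) m f hf nf (fset_uniq X).
- by move=> L LX; have [] := vpick_line (dX L LX).
- by move=> L L' LX LX'; apply: area_vpick; apply: dX.
- exact: hX.
exists n, g; split=> //.
by rewrite em big_const_seq count_predT iter_addn_0 mulnC.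
Qed.

Lemma vanish_div m f L : is_form m f -> (exists u, f u != 0) -> \dim L = 1%N ->
  f (vpick L) = 0 ->
  exists n h, is_form n h /\ forall v, f v = area (vpick L) v ^+ 1 * h v.
Proof.
move=> hf nf dL fL; have [nw _] := vpick_line dL.
have m0 := form_neq0_deg hf nf fL; rewrite -(prednK m0) in hf.
by have [h hh eh] := form_div hf nw fL; exists m.-1, h.
Qed.

Definition semi_invariant f := forall U, B U -> exists c, forall v, f (U *m v) = c * f v.

Lemma semi_invariant_ev (q : mpoly 2 C) :
  relatively_invariant B q -> semi_invariant (ev q).
Proof.
move=> h U bU; have [c hc] := h _ (binaryV hG bU).
by exists c => v; rewrite -hc invmxK.
Qed.

(** Each zero splits off its linear form, and no degree is left for the quotient. *)
Lemma ground_form_factor (X : {fset line}) f : (forall L, L \in X -> \dim L = 1%N) ->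
  is_form #|` X| f -> (exists u, f u != 0) ->
  (forall L, L \in X -> f (vpick L) = 0) ->
  exists2 c, c != 0 & forall v, f v = c * line_form X 1 v.
Proof.
move=> dX hf nf vf.
have [L LX|n [g [en hg eg]]] := line_form_div hf nf dX (e := 1%N).
  exact: vanish_div hf nf (dX L LX) (vf L LX).
have n0 : n = 0%N by lia.
rewrite n0 in hg; have [c hc] := is_form_expand hg.
have gc v : g v = c 0%N by rewrite hc big_ord1 !expr0 !mulr1.
exists (c 0%N) => [|v]; last by rewrite eg gc mulrC.
by case: nf => u; rewrite eg gc mulf_eq0 negb_or => /andP[].
Qed.

Section GroundForm.
Variables (S : set line) (q : mpoly 2 C).
Hypotheses (oS : is_orbit G S) (hq : homogeneous #|` fset_set S| q)
  (q0 : q != 0) (vq : forall L, S L -> vanishes_on q L).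

Let mem_dim L : L \in fset_set S -> \dim L = 1%N.
Proof. by rewrite (mem_orbit hG) // inE => /(orbitP hG oS) []. Qed.

Lemma ground_formE : exists2 c, c != 0 &
  forall v, ev q v = c * line_form (fset_set S) 1 v.
Proof.
apply: ground_form_factor mem_dim (form_of_homogeneous hq) _ _.
  exact: homogeneous_neq0 hq q0.
move=> L; rewrite (mem_orbit hG) // inE => SL; apply: (vq SL).
exact: memv_pick.
Qed.

(** Both [q] and its transform have the same zeros and the same degree. *)
Lemma ground_form_semi_invariant : semi_invariant (ev q).
Proof.
move=> U bU; have [c c0 ec] := ground_formE.
have dU : \det U = 1 := binary_det bU.
have uU : U \in unitmx by rewrite unitmxE dU unitr1.
have [|||c' _ ec'] := @ground_form_factor (fset_set S) (fun v => ev q (U *m v)) mem_dim.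
- exact: is_form_mulmx (form_of_homogeneous hq).
- have [u hu] := homogeneous_neq0 hq q0.
  by exists (invmx U *m u); rewrite mulKVmx.
- move=> L LS; have dL := mem_dim LS; have [n e] := vpick_line dL.
  have SL : S L by move: LS; rewrite (mem_orbit hG) // inE.
  apply: (vq (orbit_act hG oS bU SL)).
  by rewrite -{2}e act_lineE memv_line.
by exists (c' / c) => v; rewrite ec' ec mulrA divfK.
Qed.

Lemma ground_form_order w : w != 0 ->
  has_order #|` fset_set S| (ev q) w (<[w]>%VS \in fset_set S).
Proof.
move=> nw; have dw : \dim (<[w]>%VS : line) = 1%N by rewrite dim_vline nw.
have [c c0 ec] := ground_formE; have [wS|wS] := boolP (<[w]>%VS \in fset_set S).
  have [n e] := vpick_line dw.
  have [|t et] := area_eq0 nw (v := vpick <[w]>%VS).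
    by apply/line_eqP => //; rewrite e.
  have t0 : t != 0 by apply: contra_neq n => t0; rewrite et t0 scale0r.
  exists #|` (fset_set S `\ <[w]>%VS)%fset|%N,
    (fun v => (c * t) * line_form (fset_set S `\ <[w]>%VS)%fset 1 v); split.
  - by rewrite (cardfsD1 <[w]>%VS) wS addnC.
  - by apply: is_formZ; have := is_form_line_form (fset_set S `\ <[w]>%VS)%fset 1; rewrite muln1.
  - move=> v; rewrite ec /line_form (big_fsetD1 _ wS) /= !expr1 et area_scalel.
    by rewrite -!mulrA [RHS]mulrCA; congr (_ * _); rewrite mulrCA.
  rewrite mulf_neq0 ?mulf_neq0 // line_form_neq0 // => L.
  rewrite !inE => /andP[nL LS]; have [nL' eL] := vpick_line (mem_dim LS).
  by apply: contra_neq nL => h; rewrite -eL; apply/eqP/line_eqP.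
exists #|` fset_set S|, (ev q); split; rewrite ?addn0 //.
- exact: form_of_homogeneous.
- by move=> v; rewrite expr0 mul1r.
rewrite ec mulf_neq0 // line_form_neq0 // => L LS.
have [nL' eL] := vpick_line (mem_dim LS).
apply: contraNneq wS => h; rewrite (_ : <[w]>%VS = L) // -eL.
by apply/esym/eqP/line_eqP.
Qed.

End GroundForm.

End SemiInvariants.
(** * Invariants of a given degree *)

Section InvariantForms.
Variables (R : realType) (G : {fset 'M[R]_3}).
Hypothesis hG : finite_subgroup_SO3 G.
Local Notation C := R[i].
Local Notation vec := 'cV[C]_2.
Local Notation line := {vspace 'cV[C]_2}.
Local Notation B := (binary_group G).
Local Notation N := #|` G|.
Implicit Types (U V : 'M[C]_2) (L : line) (u v w : vec) (z : C) (f : vec -> C).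

Variables (S : set line) (hS : is_orbit G S) (P : mpoly 2 C).
Hypotheses (hP_hom : homogeneous N P)
  (hP_zero : forall L, \dim L = 1%N -> (vanishes_on P L <-> S L))
  (hP_inv : relatively_invariant B P).

Lemma line_form_exists (X : {fset line}) e : (forall L, L \in X -> \dim L = 1%N) ->
  exists w, line_form X e w != 0.
Proof.
have h (s : seq line) : {in s, forall L, \dim L = 1%N} ->
    exists w, \prod_(L <- s) area (vpick L) w ^+ e != 0.
  elim: s => [|L s IH] ds; first by exists 0; rewrite big_nil oner_neq0.
  have [|w hw] := IH; first by move=> L' L's; apply: ds; rewrite inE L's orbT.
  have [nL _] := vpick_line (ds L (mem_head L s)).
  have [w' ew'] := area_compl nL.
  have [|||u fu gu] := @common_nonzero _ (fun v => area (vpick L) v ^+ e)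
    (fun v => \prod_(L <- s) area (vpick L) v ^+ e) w' w _ _ _ hw.
  - exact: poly_on_linesX (poly_on_lines_form (is_form_area _)).
  - apply: (@poly_on_lines_form _ (\sum_(L <- s) 1 * e)%N).
    by apply: is_form_prod => L'; apply/is_formX/is_form_area.
  - by rewrite ew' expr1n oner_neq0.
  by exists u; rewrite big_cons mulf_neq0.
by move=> dX; apply: h.
Qed.

Lemma P_exists : exists v, ev P v != 0.
Proof.
have dX L : L \in fset_set S -> \dim L = 1%N.
  by rewrite (mem_orbit hG) // inE => /(orbitP hG hS) [].
have [w hw] := line_form_exists 1 dX.
have [L0 dL0 eS] := hS.
have SL0 : L0 \in fset_set S.
  by rewrite (mem_orbit hG) // inE eS; exact: (orbit_line_id hG).
have aw L : L \in fset_set S -> area (vpick L) w != 0.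
  move=> LS; move: hw; rewrite /line_form (big_fsetD1 _ LS) /= expr1.
  by rewrite mulf_eq0 negb_or => /andP[].
have nw : w != 0.
  apply: contraNneq (aw L0 SL0) => ->.
  by rewrite /area !mxE !mulr0 subrr.
have dw : \dim (<[w]>%VS : line) = 1%N by rewrite dim_vline nw.
have nS : ~ S <[w]>%VS.
  move=> Sw; have [n e] := vpick_line dw.
  have := aw <[w]>%VS; rewrite (mem_orbit hG) // inE => /(_ Sw) /negP; apply.
  by apply/eqP/line_eqP => //; rewrite e.
apply/not_existsP => h; apply: nS; apply/(hP_zero dw) => v _.
by apply/eqP; move/negP: (h v); rewrite negbK.
Qed.

Lemma P_neq0 : P != 0.
Proof.
have [v] := P_exists; apply: contra_neq => ->.
exact: meval0.
Qed.

Lemma order_scale m f w j (t : C) : t != 0 -> has_order m f w j ->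
  has_order m f (t *: w) j.
Proof.
move=> t0 [n [h [em hh eh hw]]]; exists n, (fun v => t ^- j * h v); split=> //.
- exact: is_formZ.
- move=> v; rewrite area_scalel exprMn eh [RHS]mulrACA -exprVn -exprMn.
  by rewrite mulfV // expr1n mul1r.
- by rewrite (is_form_scale _ _ hh) !mulf_neq0 ?invr_neq0 ?expf_neq0.
Qed.

Lemma order_transport m f w j U : has_order m f w j -> \det U = 1 ->
  (exists u, f u != 0) -> (exists c, forall v, f (U *m v) = c * f v) ->
  has_order m f (U *m w) j.
Proof.
move=> [n [h [em hh eh hw]]] dU [u fu] [c fU].
have uU : U \in unitmx by rewrite unitmxE dU unitr1.
have c0 : c != 0.
  apply: contra_neq fu => c0.
  by rewrite -(mulKVmx uU u) fU c0 mul0r.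
exists n, (fun v => c * h (invmx U *m v)); split=> //.
- by apply: is_formZ; apply: is_form_mulmx.
- move=> v; have -> : area (U *m w) v = area w (invmx U *m v).
    by rewrite -{1}(mulKVmx uU v) area_mul dU mul1r.
  by rewrite mulrCA -eh -fU mulKVmx.
- by rewrite mulKmx // mulf_neq0.
Qed.

Lemma P_at w : w != 0 -> ~ S <[w]>%VS -> ev P w != 0.
Proof.
move=> nw nS; apply/negP => /eqP h; apply: nS.
have dw : \dim (<[w]>%VS : line) = 1%N by rewrite dim_vline nw.
apply/(hP_zero dw) => v /vlineP [t ->].
by rewrite (is_form_scale _ _ (form_of_homogeneous hP_hom)) h mulr0.
Qed.

(** The zeros of [P] form one orbit, along which the multiplicity is constant;
    comparing degrees, it is the order of the stabiliser. *)
Lemma P_order w : w != 0 -> exists2 j, has_order N (ev P) w j &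
  (stab_order G <[w]>%VS %| j)%N.
Proof.
move=> nw; have hP := form_of_homogeneous hP_hom.
have dw : \dim (<[w]>%VS : line) = 1%N by rewrite dim_vline nw.
have [Sw|nSw] := pselect (S <[w]>%VS); last first.
  exists 0%N; last exact: dvdn0.
  exists N, (ev P); split; rewrite ?addn0 //; last exact: P_at.
  by move=> v; rewrite expr0 mul1r.
have [j oj] := order_exists hP P_exists nw; exists j => //.
have mX L : L \in fset_set S -> S L by rewrite (mem_orbit hG) // inE.
have dX L : L \in fset_set S -> \dim L = 1%N by move=> /mX /(orbitP hG hS) [].
have oX L : L \in fset_set S -> has_order N (ev P) (vpick L) j.
  move=> LX; have [_ eS] := orbitP hG hS Sw.
  have [n e] := vpick_line (dX L LX).
  have : orbit_line G <[w]>%VS L by rewrite -eS; exact: mX.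
  move=> [U bU eL]; have dU : \det U = 1 := binary_det bU.
  have oU := order_transport oj dU P_exists (semi_invariant_ev hG hP_inv bU).
  have nU : U *m w != 0 by apply: mulmx_neq0; rewrite // dU oner_neq0.
  have [|t et] := area_eq0 nU (v := vpick L).
    by apply/line_eqP => //; rewrite e -eL act_lineE.
  rewrite et; apply: order_scale => //.
  by apply: contra_neq n => t0; rewrite et t0 scale0r.
have [L LX|n [g [eN hg eg]]] := line_form_div hP P_exists dX (e := j).
  by have [n [h [_ hh eh _]]] := oX L LX; exists n, h.
have gX L : L \in fset_set S -> g (vpick L) != 0.
  move=> LX; have [n' [h [_ hh eh hL]]] := oX L LX.
  have [nL _] := vpick_line (dX L LX); have [w' ew'] := area_compl nL.
  have := @poly_dense _ (area (vpick L)) h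
    (fun v => line_form (fset_set S `\ L)%fset j v * g v) w'
    (poly_on_lines_form (is_form_area _)) (poly_on_lines_form hh)
    (poly_on_linesM (poly_on_lines_form (is_form_line_form _ _))
       (poly_on_lines_form hg)).
  rewrite ew' oner_neq0 => /(_ isT) eh'.
  apply: contra_neq hL => gL; rewrite eh' ?gL ?mulr0 // => v nv.
  apply: (mulfI (expf_neq0 j nv)); rewrite -eh eg /line_form (big_fsetD1 _ LX) /=.
  by rewrite mulrA.
(* The quotient [g] by all the linear forms is nonzero along the orbit, hence
   everywhere: it is constant, and the degrees give [j]. *)
case: n => [|n] in eN hg *.
  have [L0 L0X] : exists L, L \in fset_set S.
    by exists <[w]>%VS; rewrite (mem_orbit hG) // inE.
  move: eN; rewrite add0n -(orbit_card hG hS Sw) => /eqP.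
  rewrite eqn_pmul2l; last exact: (orbit_card_gt0 hG hS Sw).
  by move/eqP=> ->.
have [u nu gu] := form_root hg.
have Su : S <[u]>%VS.
  apply: contrapT => nS; have := P_at nu nS.
  by rewrite eg gu mulr0 eqxx.
have uX : <[u]>%VS \in fset_set S by rewrite (mem_orbit hG) // inE.
have [n' e] := vpick_line (dX _ uX).
have [|t et] := area_eq0 nu (v := vpick <[u]>%VS).
  by apply/line_eqP => //; rewrite e.
by have := gX _ uX; rewrite et (is_form_scale _ _ hg) gu mulr0 eqxx.
Qed.

Variables (Omega : finType) (Sx : Omega -> set line).
Hypotheses (hSx_inj : injective Sx) (hSx : range Sx = exceptional_orbits G).
Variables (d nu : Omega -> nat).
Hypotheses (hd : forall i, d i = #|` fset_set (Sx i)|)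
  (hnu : forall i L, Sx i L -> stab_order G L = nu i).
Variable p : Omega -> mpoly 2 C.
Hypotheses (hp_neq0 : forall i, p i != 0)
  (hp_hom : forall i, homogeneous (d i) (p i))
  (hp_van : forall i L, Sx i L -> vanishes_on (p i) L).

Local Notation res k i := (residue (nu i) k).

(** The value of [P_k] for even [k], as a function on the whole plane. *)
Definition Pk_fun (k : int) v : C :=
  ev P v ^ ((k - (\sum_i res k i * d i)%N%:Z) %/ N)%Z
  * \prod_i ev (p i) v ^+ res k i.

Let oSx i : is_orbit G (Sx i) := Sx_orbit hSx i.

Lemma hp_hom' i : homogeneous #|` fset_set (Sx i)| (p i).
Proof. by rewrite -hd. Qed.

Lemma residue_mod i (h : int) : ((res (2 * h) i)%:Z = h %% nu i)%Z.
Proof.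
rewrite /residue mulKz // gez0_abs // modz_ge0 //.
by have := nu_gt1 hG hSx hnu i; lia.
Qed.

(** [P_k] is semi-invariant; its character at [U], read off at a fixed point of
    [U], is trivial because the order of [P_k] there is [k / 2] modulo the order
    of the stabiliser and its degree is [k]. *)
Lemma Pk_invariant k U v : (2 %| k)%Z -> B U -> Pk_fun k (U *m v) = Pk_fun k v.
Proof.
move=> k2 bU; have [z [w [nw ew]]] := eigen_exists U.
have [nz _] := eigen_qconj bU.1 nw ew; have dU : \det U = 1 := binary_det bU.
have [c cP] := semi_invariant_ev hG hP_inv bU.
have [j oj sj] := P_order nw.
have ec := order_character oj dU ew nw nz cP.
have /choice [ci hci] i : exists c, forall v, ev (p i) (U *m v) = c * ev (p i) v.
  exact: (ground_form_semi_invariant hG (oSx i) (hp_hom' i) (hp_neq0 i) (@hp_van i) bU).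
pose b i : nat := <[w]>%VS \in fset_set (Sx i).
have eci i : ci i = z ^ ((d i)%:Z - 2 * (b i)%:Z).
  have := ground_form_order hG (oSx i) (hp_hom' i) (hp_neq0 i) (@hp_van i) nw.
  by move=> /order_character /(_ dU ew nw nz (hci i)); rewrite hd.
rewrite /Pk_fun cP expfzMl.
have -> : \prod_i ev (p i) (U *m v) ^+ res k i =
    (\prod_i ci i ^+ res k i) * \prod_i ev (p i) v ^+ res k i.
  by rewrite -big_split /=; apply: eq_bigr => i _; rewrite hci exprMn.
rewrite mulrACA -[RHS]mul1r; congr (_ * _).
set l := (_ %/ _)%Z.
have ePk : l * N%:Z + (\sum_i res k i * d i)%N%:Z = k.
  exact: (Pk_degree hG hSx_inj hSx hd hnu k2).
have /dvdzP [h ek] := k2; rewrite mulrC in ek.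
have -> : \prod_i ci i ^+ res k i =
    z ^ ((\sum_i res k i * d i)%N%:Z - 2 * (\sum_i res k i * b i)%N%:Z).
  rewrite !(big_morph Posz PoszD (erefl 0%:Z)) mulr_sumr -sumrB.
  rewrite (big_morph (fun e : int => z ^ e) (id1 := 1) (op1 := *%R)) //; last first.
    by move=> e1 e2; exact: expfzDr.
  apply: eq_bigr => i _; rewrite eci exprnP exprz_exp !PoszM; congr (z ^ _).
  by ring.
rewrite ec exprz_exp -expfzDr //.
rewrite (_ : _ + _ = 2 * (h - l * j%:Z - (\sum_i res k i * b i)%N%:Z)); last first.
  move: ePk; rewrite ek; move: (\sum_i _)%N (\sum_i _)%N => s t; lia.
apply: (stab_eigen_pow hG nw bU ew).
rewrite addrAC; apply: rpredB; last first.
  by apply: dvdz_mull; rewrite dvdzE.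
have dw : \dim (<[w]>%VS : line) = 1%N by rewrite dim_vline nw.
have [s1|s1] := leqP (stab_order G <[w]>%VS) 1.
  have -> : stab_order G <[w]>%VS = 1%N.
    by apply/eqP; rewrite eqn_leq s1 (stab_order_gt0 hG).
  exact: dvd1z.
have [i iw] := exceptionalP hG hSx dw s1.
rewrite (bigD1 i) //= big1 ?addn0 => [|i' ni']; last first.
  rewrite /b (mem_orbit hG) // memNset ?muln0 // => i'w.
  by move/eqP: ni'; apply; apply: (Sx_disjoint hG hSx_inj hSx) i'w iw.
rewrite /b (mem_orbit hG) // mem_set // muln1 ek residue_mod (hnu iw).
by rewrite {1}(divz_eq h (nu i)) addrK dvdz_mull.
Qed.

(** Invariance forces the order of an invariant at an exceptional point to be
    congruent to [k / 2] modulo the order of the stabiliser, hence at least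
    equal to its residue: the invariant is divisible by [P_k]. *)
Lemma invariant_factor k n m q : (2 %| k)%Z -> m%:Z = k + (n * N)%:Z ->
  is_form m q ->
  (forall U v, B U -> ev P v != 0 ->
     q (U *m v) / ev P (U *m v) ^+ n = q v / ev P v ^+ n) ->
  exists n' q', [/\ is_form (n' * N) q',
    forall v, ev P v != 0 ->
      q v / ev P v ^+ n = Pk_fun k v * (q' v / ev P v ^+ n') &
    forall U v, B U -> ev P v != 0 ->
     q' (U *m v) / ev P (U *m v) ^+ n' = q' v / ev P v ^+ n'].
Proof.
move=> k2 em hq qinv; have hP := form_of_homogeneous hP_hom.
have [u0 Pu0] := P_exists.
have [nq|q0] := pselect (exists u, q u != 0); last first.
  have qz v : q v = 0.
    by apply/eqP/negPn/negP => nv; apply: q0; exists v.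
  exists 0%N, (fun=> 0); split=> [|v _|U v _ _].
  - exact: is_form0.
  - by rewrite qz !mul0r mulr0.
  - by rewrite !mul0r.
have /dvdzP [h ek] := k2; rewrite mulrC in ek.
have ord i L : Sx i L -> exists n' h', is_form n' h' /\
    forall v, q v = area (vpick L) v ^+ res k i * h' v.
  move=> iL; have [dL _] := orbitP hG (oSx i) iL.
  have [nw eL] := vpick_line dL; set w := vpick L in nw eL *.
  have [j [n' [h' [em' hh' eh' h'w]]]] := order_exists hq nq nw.
  have oj : has_order m q w j by exists n', h'.
  have [jP ojP sjP] := P_order nw; rewrite eL (hnu iL) in sjP.
  (* The form [q] has the character of [P ^+ n]; at a fixed point both are powers
     of the eigenvalue, with exponents given by the degrees and the orders. *)
  have : (stab_order G <[w]>%VS %| h + n%:Z * jP%:Z - j%:Z)%Z.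
    apply: (stab_eigen_dvd hG nw) => U z bU ew.
    have dU : \det U = 1 := binary_det bU.
    have [nz _] := eigen_qconj bU.1 nw ew.
    have [c cP] := semi_invariant_ev hG hP_inv bU.
    have ec := order_character ojP dU ew nw nz cP.
    have c0 : c != 0 by rewrite ec expfz_neq0.
    have qU : forall v, q (U *m v) = c ^+ n * q v.
      apply: (@poly_dense _ (ev P) _ _ u0) => //.
      + exact: poly_on_lines_form hP.
      + exact: poly_on_lines_form (is_form_mulmx U hq).
      + exact: poly_on_lines_form (is_formZ _ hq).
      move=> v Pv; have := qinv U v bU Pv; rewrite cP exprMn invfM mulrA.
      move=> /(mulIf (invr_neq0 (expf_neq0 n Pv))) e.
      by rewrite -e mulrC divfK // expf_neq0.
    have := order_character oj dU ew nw nz qU.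
    rewrite ec exprnP exprz_exp => e.
    have -> : 2 * (h + n%:Z * jP%:Z - j%:Z) =
        m%:Z - 2 * j%:Z - (N%:Z - 2 * jP%:Z) * n%:Z by rewrite em ek PoszM; lia.
    by rewrite expfzDr // -e -expfzDr // subrr expr0z.
  rewrite eL (hnu iL) => dv.
  have dv' : (nu i %| h - j%:Z)%Z.
    rewrite (_ : h - j%:Z = h + n%:Z * jP%:Z - j%:Z - n%:Z * jP%:Z); last lia.
    by apply: rpredB => //; apply: dvdz_mull; rewrite dvdzE.
  have rj : (res k i <= j)%N.
    rewrite -lez_nat ek residue_mod.
    have -> : (h %% nu i = j %% nu i)%Z by apply/eqP; rewrite eqz_mod_dvd.
    by rewrite modz_nat lez_nat leq_mod.
  exists (1 * (j - res k i) + n')%N,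
    (fun v => area w v ^+ (j - res k i) * h' v); split.
    by apply: is_formM => //; apply/is_formX/is_form_area.
  by move=> v; rewrite mulrA -exprD subnKC.
pose s := [seq (i, L) | i <- enum Omega, L <- fset_set (Sx i)].
have sP x : x \in s -> Sx x.1 x.2.
  move=> /allpairsPdep [i [L [_ iL ->]]].
  by move: iL; rewrite (mem_orbit hG) // inE.
have [||||m' [g [em' hg eg]]] := @div_product _ _ s (fun x => vpick x.2)
   (fun x => res k x.1) m q hq nq.
- apply: allpairs_uniq_dep => [|i _|[i L] [i' L'] _ _ [-> ->]] //.
    exact: enum_uniq.
  exact: fset_uniq.
- by move=> x /sP /(orbitP hG (oSx _)) [/vpick_line []].
- move=> x y /sP xs /sP ys nxy.
  have [dx _] := orbitP hG (oSx _) xs; have [dy _] := orbitP hG (oSx _) ys.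
  apply: area_vpick => //; apply: contra_neq nxy => exy.
  case: x y exy xs ys {dx dy} => [i L] [i' L'] /= <- iL i'L.
  by rewrite (Sx_disjoint hG hSx_inj hSx iL i'L).
- by move=> x /sP; apply: ord.
have /choice [c hc] i : exists c, c != 0 /\
    forall v, ev (p i) v = c * line_form (fset_set (Sx i)) 1 v.
  have [c c0 hc] := ground_formE hG (oSx i) (hp_hom' i) (hp_neq0 i) (@hp_van i).
  by exists c.
(* The ground forms are products of linear forms only up to the constants [c i]. *)
pose kappa := \prod_i (c i)^-1 ^+ res k i.
have k0 : kappa != 0.
  apply/prodf_neq0 => i _; apply: expf_neq0; apply: invr_neq0.
  by have [] := hc i.
have eprod v : \prod_(x <- s) area (vpick x.2) v ^+ res k x.1 =
    kappa * \prod_i ev (p i) v ^+ res k i.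
  rewrite big_allpairs_dep -big_split /= big_enum /=; apply: eq_bigr => i _.
  have [c0 hci] := hc i; rewrite hci exprMn mulrA -exprMn mulVf // expr1n mul1r.
  by rewrite /line_form -prodrXl; apply: eq_bigr => L _; rewrite expr1.
set l := ((k - (\sum_i res k i * d i)%N%:Z) %/ N)%Z.
have ePk : l * N%:Z + (\sum_i res k i * d i)%N%:Z = k.
  exact: (Pk_degree hG hSx_inj hSx hd hnu k2).
have es : (\sum_(x <- s) res k x.1 = \sum_i res k i * d i)%N.
  rewrite big_allpairs_dep big_enum /=; apply: eq_bigr => i _.
  by rewrite big_const_seq count_predT iter_addn_0 hd mulnC.
have N0 := group_card_gt0 hG.
have em2 : m'%:Z = (l + n%:Z) * N%:Z.
  apply: (addIr (\sum_i res k i * d i)%N%:Z).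
  by rewrite mulrDl addrAC ePk -PoszD -es -em' em.
have ln0 : 0 <= l + n%:Z.
  rewrite -(@pmulr_lge0 _ N%:Z) ?ltz_nat // -em2 //.
pose n' := `|(l + n%:Z)%R|%N.
have en' : n'%:Z = l + n%:Z by rewrite gez0_abs.
exists n', (fun v => kappa * g v).
have fE v : ev P v != 0 ->
    q v / ev P v ^+ n = Pk_fun k v * (kappa * g v / ev P v ^+ n').
  move=> Pv; rewrite eg eprod /Pk_fun -/l.
  have -> : ev P v ^+ n' = ev P v ^ l * ev P v ^+ n.
    by rewrite !exprnP en' expfzDr.
  have := expf_neq0 n Pv; have : ev P v ^ l != 0 by rewrite expfz_neq0.
  move: (ev P v ^ l) (ev P v ^+ n) (\prod_i _) (g v) => x y t r x0 y0.
  exact: cancel_fraction.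
split; [|exact: fE|].
- apply: is_formZ; rewrite (_ : (n' * N)%N = m') //.
  by apply/eqP; rewrite -eqz_nat PoszM en' em2.
move=> U v bU Pv; have [cU cP] := semi_invariant_ev hG hP_inv bU.
have hPU := is_form_mulmx U hP.
have hkg := is_formZ kappa hg; have hkgU := is_form_mulmx U hkg.
pose a u := ev P u * \prod_i ev (p i) u ^+ res k i.
have Pk_poly : poly_on_lines (fun u => \prod_i ev (p i) u ^+ res k i).
  apply: (@poly_on_lines_form _ (\sum_(i <- index_enum Omega) d i * res k i)%N).
  by apply: is_form_prod => i; apply/is_formX/form_of_homogeneous.
have [u1 au1] : exists u, a u != 0.
  have [u2 pu2] : exists u, \prod_i ev (p i) u ^+ res k i != 0.
    case: nq => u qu; exists u; apply: contra_neq qu.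
    by rewrite eg eprod => ->; rewrite mulr0 mul0r.
  have [u1 Pu1 pu1] := common_nonzero (poly_on_lines_form hP) Pk_poly Pu0 pu2.
  by exists u1; rewrite mulf_neq0.
have cU0 : cU != 0.
  apply: contra_neq Pu0 => cU0.
  by rewrite -(mulKVmx (SU2_unit bU.1) u0) cP cU0 mul0r.
(* Where the ground forms do not vanish, [P_k] can be cancelled; the invariance
   extends to their zeros by density, as an identity between polynomials. *)
have key : forall u, kappa * g (U *m u) * ev P u ^+ n' =
    kappa * g u * ev P (U *m u) ^+ n'.
  apply: (@poly_dense _ a _ _ u1) au1 _.
  - exact: poly_on_linesM (poly_on_lines_form hP) Pk_poly.
  - apply: poly_on_linesM; first exact: poly_on_lines_form hkgU.
    exact: poly_on_linesX (poly_on_lines_form hP).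
  - apply: poly_on_linesM; first exact: poly_on_lines_form hkg.
    exact: poly_on_linesX (poly_on_lines_form hPU).
  move=> u; rewrite mulf_eq0 negb_or => /andP[Pu pu].
  have PUu : ev P (U *m u) != 0 by rewrite cP mulf_neq0.
  have := qinv U u bU Pu; rewrite (fE _ PUu) (fE _ Pu) (Pk_invariant u k2 bU) => /mulfI e.
  apply/eqP; rewrite -eqr_div ?expf_neq0 //; apply/eqP; apply: e.
  by rewrite mulf_neq0 // expfz_neq0.
have PUv : ev P (U *m v) != 0 by rewrite cP mulf_neq0.
by apply/eqP; rewrite eqr_div ?expf_neq0 // key.
Qed.

End InvariantForms.
(** * The complex exponential and complex curves *)

Section ComplexCurves.
Variable R : realType.
Local Notation C := R[i].
Local Notation nc := (@Normc.normc R).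
Implicit Types (f g : R -> C) (z : C).

Definition cexp z : C :=
  (expR (complex.Re z) * cos (complex.Im z)) +i* (expR (complex.Re z) * sin (complex.Im z)).

Lemma cexpD z w : cexp (z + w) = cexp z * cexp w.
Proof.
case: z w => [a b] [c d]; rewrite /cexp /= expRD cosD sinD mulcE.
by congr (_ +i* _); ring.
Qed.

Lemma cexp0 : cexp 0 = 1.
Proof. by rewrite /cexp /= expR0 cos0 sin0 mulr1 mulr0. Qed.

Lemma cexpN z : cexp (- z) * cexp z = 1.
Proof. by rewrite -cexpD addNr cexp0. Qed.

Lemma cexp_neq0 z : cexp z != 0.
Proof.
apply: contra_eq_neq (cexpN z) => ->; by rewrite mulr0 eq_sym oner_neq0.
Qed.

Lemma cexpNV z : cexp (- z) = (cexp z)^-1.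
Proof. by apply: (mulIf (cexp_neq0 z)); rewrite cexpN mulVf // cexp_neq0. Qed.

Lemma cexpXz z (n : int) : cexp (n%:~R * z) = cexp z ^ n.
Proof.
have h (m : nat) : cexp (m%:R * z) = cexp z ^+ m.
  elim: m => [|m IH]; first by rewrite mul0r cexp0.
  by rewrite -natr1 mulrDl mul1r cexpD IH exprSr.
case: n => n; first by rewrite -pmulrn h.
by rewrite NegzE mulrNz mulNr cexpNV -pmulrn h -invr_expz.
Qed.

Lemma cexp_surj t : t != 0 -> exists z, cexp z = t.
Proof.
move=> t0; have n0 : nc t != 0 by apply: contra_neq t0 => /Normc.eq0_normc.
have np : 0 < nc t.
  by rewrite lt_def n0 /=; case: (t) => a b /=; exact: sqrtr_ge0.
have [a [b [et eab]]] : exists a b, t = (nc t * a) +i* (nc t * b) /\ a ^+ 2 + b ^+ 2 = 1.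
  case et: t n0 np => [x y]; rewrite -et => n0 np.
  exists (x / nc t), (y / nc t); split.
    by rewrite ![nc t * _]mulrC !divfK.
  have e2 : nc t ^+ 2 = x ^+ 2 + y ^+ 2.
    by rewrite et /= sqr_sqrtr // addr_ge0 ?sqr_ge0.
  by rewrite !expr_div_n -mulrDl -e2 divff // sqrf_eq0.
have ha : -1 <= a <= 1 by rewrite -ler_norml -(@expr_le1 _ 2) // -normrX ger0_norm ?sqr_ge0 //; nra.
have [_ ec] := acos_def ha.
have es : sin (acos a) ^+ 2 = b ^+ 2.
  by have := cos2Dsin2 (acos a); rewrite ec -eab => /addrI.
have [th [e1 e2]] : exists th, cos th = a /\ sin th = b.
  move/eqP: es; rewrite eqf_sqr => /orP[] /eqP es; first by exists (acos a).
  by exists (- acos a); rewrite cosN sinN es opprK.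
exists (ln (nc t) +i* th); rewrite /cexp /= lnK ?posrE // e1 e2.
by rewrite -et.
Qed.

(** The modulus shows that [l] is real; removing its integral part leaves an angle
    in [[0, 2 pi)] with cosine 1. *)
Lemma cexp_2pi_int (l : C) : cexp (l * (0 +i* (pi *+ 2))) = 1 ->
  exists n : int, l = n%:~R.
Proof.
case: l => a b; rewrite mulcE mulr0 sub0r mulr0 addr0 => h.
have pi0 := pi_gt0 R.
have b0 : b = 0.
  have : expR (- (b * (pi *+ 2))) = 1.
    have := congr1 nc h; rewrite /cexp /= !exprMn -mulrDr cos2Dsin2 mulr1.
    by rewrite sqrtr_sqr ger0_norm ?expR_ge0 // expr1n expr0n addr0 sqrtr1.
  rewrite -[RHS]expR0 => /expR_inj /eqP; rewrite oppr_eq0 mulf_eq0 mulrn_eq0 /= (gt_eqF pi0) orbF.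
  by move/eqP.
pose n := Num.floor a; exists n; rewrite b0.
have nE : (n%:~R : C) = n%:~R%:C by rewrite rmorph_int.
suff -> : a = n%:~R by rewrite nE.
have fa := floor_itv a; rewrite -/n in fa.
have h1 : cexp (0 +i* ((a - n%:~R) * (pi *+ 2))) = 1.
  have := cexpXz (0 +i* (pi *+ 2)) n.
  have -> : cexp (0 +i* (pi *+ 2)) = 1.
    by rewrite /cexp /= expR0 !mul1r cos2pi sin2pi.
  rewrite exp1rz nE mulcE => hn.
  have -> : 0 +i* ((a - n%:~R) * (pi *+ 2)) = - (b * (pi *+ 2)) +i* (a * (pi *+ 2)) -
     ((n%:~R * 0 - 0 * (pi *+ 2)) +i* (n%:~R * (pi *+ 2) + 0 * 0)).
    by rewrite oppcE addcE b0; congr (_ +i* _); ring.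
  by rewrite cexpD h cexpNV hn invr1 mulr1.
set x := (a - n%:~R) * (pi *+ 2) in h1.
have x0 : 0 <= x.
  by apply: mulr_ge0; [rewrite subr_ge0; case/andP: fa | rewrite mulrn_wge0 ?ltW].
have x2 : x < pi *+ 2.
  have pp : 0 < pi *+ 2 :> R by rewrite mulrn_wgt0.
  have an : a - n%:~R < 1 by case/andP: fa => _; rewrite intrD; lra.
  by rewrite /x -[ltRHS]mul1r (ltr_pM2r pp).
have cx : cos x = 1 by move: h1; rewrite /cexp /= expR0 mul1r => -[].
have acos1 : acos 1 = 0 :> R.
  by rewrite -{1}(cos0 R) cosK // in_itv /= lexx ltW.
suff /eqP : x = 0.
  by rewrite mulf_eq0 mulrn_eq0 /= (gt_eqF pi0) orbF subr_eq0 => /eqP.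
have [xpi|xpi] := leP x pi.
  by have := cosK (x := x); rewrite in_itv /= x0 xpi cx acos1 => /(_ isT) ->.
have cy : cos (pi *+ 2 - x) = 1.
  by rewrite cosB cos2pi sin2pi mul0r addr0 mul1r.
have := @cosK R (pi *+ 2 - x); rewrite in_itv /= cy acos1 => h2.
have : 0 = pi *+ 2 - x by apply: h2; apply/andP; split; lra.
by move=> h3; move: x2; rewrite -subr_gt0 -h3 ltxx.
Qed.

(** Complex-valued functions of a real variable. The estimate is in the real-valued
    modulus, which fits both the real calculus of the two components and the
    first-order expansions on SL(2). *)
Definition has_cderiv f r d := forall e, 0 < e -> exists2 dl, 0 < dl &
  forall h, `|h| < dl -> nc (f (r + h) - f r - h%:C * d) <= e * `|h|.

Lemma derivP (f : R -> R) (r d : R) : is_derive r 1 f d <->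
  forall e, 0 < e -> exists2 dl, 0 < dl &
  forall h, `|h| < dl -> `|f (r + h) - f r - h * d| <= e * `|h|.
Proof.
have lim h : h != 0 -> h^-1 *: ((f \o shift r) (h *: 1) - f r) =
    h^-1 * (f (r + h) - f r).
  by rewrite /= [h *: 1]mulr1 [h + r]addrC.
split=> [[df ed] e e0|h].
  have : h^-1 *: ((f \o shift r) (h *: 1) - f r) @[h --> 0^'] --> d.
    by rewrite -ed.
  move=> /cvgrPdist_le /(_ e e0); rewrite near_withinE => /nbhs_norm0P[dl dl0 hdl].
  exists dl => // h hh; have [->|h0] := eqVneq h 0.
    by rewrite addr0 subrr mul0r subr0 normr0 mulr0.
  have := hdl h hh h0; rewrite lim // => he.
  rewrite (_ : _ - _ = - h * (d - h^-1 * (f (r + h) - f r))).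
    by rewrite normrM normrN mulrC ler_wpM2r.
  by field.
have cv : h^-1 *: ((f \o shift r) (h *: 1) - f r) @[h --> 0^'] --> d.
  apply/cvgrPdist_le => e e0; rewrite near_withinE.
  have [dl dl0 hdl] := h e e0; apply/(@nbhs_norm0P R R).
  exists dl => // x /= xd x0.
  rewrite lim //; have := hdl x xd.
  rewrite (_ : _ - _ = - x * (d - x^-1 * (f (r + x) - f r))).
    by rewrite normrM normrN mulrC ler_pM2r // normr_gt0.
  by field.
by apply: DeriveDef; [apply/cvg_ex; exists d | exact: cvg_lim cv].
Qed.

Lemma nc_Re z : `|complex.Re z| <= nc z.
Proof.
case: z => a b /=; rewrite -sqrtr_sqr ler_wsqrtr // lerDl sqr_ge0 //.
Qed.

Lemma nc_Im z : `|complex.Im z| <= nc z.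
Proof.
case: z => a b /=; rewrite -sqrtr_sqr ler_wsqrtr // lerDr sqr_ge0 //.
Qed.

Lemma nc_le z : nc z <= `|complex.Re z| + `|complex.Im z|.
Proof.
case: z => a b /=; rewrite -[leRHS]ger0_norm ?addr_ge0 // -sqrtr_sqr ler_wsqrtr //.
rewrite sqrrD !real_normK ?num_real // -addrA lerD2l lerDr.
by rewrite mulrn_wge0 // mulr_ge0.
Qed.

Lemma has_cderivP f r d : has_cderiv f r d <->
  is_derive r 1 (fun x => complex.Re (f x)) (complex.Re d) /\
  is_derive r 1 (fun x => complex.Im (f x)) (complex.Im d).
Proof.
have eRe h x y z : complex.Re (x - y - h%:C * z) =
    complex.Re x - complex.Re y - h * complex.Re z.
  by case: x y z => [a b] [a' b'] [a'' b''] /=; ring.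
have eIm h x y z : complex.Im (x - y - h%:C * z) =
    complex.Im x - complex.Im y - h * complex.Im z.
  by case: x y z => [a b] [a' b'] [a'' b''] /=; ring.
split=> [h|[/derivP h1 /derivP h2] e e0].
  split; apply/derivP => e e0; have [dl dl0 hdl] := h e e0;
    exists dl => // x xd; apply: le_trans (hdl x xd).
    by rewrite -eRe nc_Re.
  by rewrite -eIm nc_Im.
have e20 : 0 < e / 2 by rewrite divr_gt0.
have [d1 d10 hd1] := h1 _ e20; have [d2 d20 hd2] := h2 _ e20.
exists (Num.min d1 d2); first by rewrite lt_min d10.
move=> x; rewrite lt_min => /andP[x1 x2].
apply: le_trans (nc_le _) _; rewrite eRe eIm [e]splitr mulrDl.
by apply: lerD; [apply: hd1|apply: hd2].
Qed.

Lemma has_cderivM f g r df dg : has_cderiv f r df -> has_cderiv g r dg ->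
  has_cderiv (fun x => f x * g x) r (f r * dg + df * g r).
Proof.
move=> /has_cderivP [f1 f2] /has_cderivP [g1 g2]; apply/has_cderivP; split.
  have -> : (fun x => complex.Re (f x * g x)) =
     ((fun x => complex.Re (f x)) * (fun x => complex.Re (g x)) -
      (fun x => complex.Im (f x)) * (fun x => complex.Im (g x)))%R.
    by apply/funext => x /=; rewrite !fctE; case: (f x) (g x) => [a b] [a' b'].
  apply: (is_derive_eq (is_deriveB (is_deriveM f1 g1) (is_deriveM f2 g2))).
  rewrite /GRing.scale /=.
  by case: (f r) (g r) df dg {f1 f2 g1 g2} => [a b] [a' b'] [u v] [u' v'] /=; ring.
have -> : (fun x => complex.Im (f x * g x)) =
     ((fun x => complex.Re (f x)) * (fun x => complex.Im (g x)) +
      (fun x => complex.Im (f x)) * (fun x => complex.Re (g x)))%R.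
  by apply/funext => x /=; rewrite !fctE; case: (f x) (g x) => [a b] [a' b'].
apply: (is_derive_eq (is_deriveD (is_deriveM f1 g2) (is_deriveM f2 g1))).
rewrite /GRing.scale /=.
by case: (f r) (g r) df dg {f1 f2 g1 g2} => [a b] [a' b'] [u v] [u' v'] /=; ring.
Qed.

Lemma has_cderiv_cexp z r :
  has_cderiv (fun x => cexp (z * x%:C)) r (z * cexp (z * r%:C)).
Proof.
have lin (k : R) : is_derive r 1 ( *%R k) k.
  apply/derivP => e e0; exists 1 => // h _.
  rewrite (_ : k * (r + h) - k * r - h * k = 0); last by ring.
  by rewrite normr0 mulr_ge0 // ltW.
case: z => a b; have da := lin a; have db := lin b.
apply/has_cderivP; split.
  have -> : (fun x => complex.Re (cexp ((a +i* b) * x%:C))) =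
      ((expR \o ( *%R a)) * (cos \o ( *%R b)))%R.
    by apply/funext => x; rewrite /cexp /= fctE /= !mulr0 subr0 add0r.
  have d1 := is_derive1_comp (is_derive_expR (a * r)) da.
  have d2 := is_derive1_comp (is_derive_cos (b * r)) db.
  apply: (is_derive_eq (is_deriveM d1 d2)); rewrite /GRing.scale /= /cexp /= !mulr0 subr0 add0r.
  by ring.
have -> : (fun x => complex.Im (cexp ((a +i* b) * x%:C))) =
    ((expR \o ( *%R a)) * (sin \o ( *%R b)))%R.
  by apply/funext => x; rewrite /cexp /= fctE /= !mulr0 subr0 add0r.
have d1 := is_derive1_comp (is_derive_expR (a * r)) da.
have d2 := is_derive1_comp (is_derive_sin (b * r)) db.
apply: (is_derive_eq (is_deriveM d1 d2)); rewrite /GRing.scale /= /cexp /= !mulr0 subr0 add0r.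
by ring.
Qed.

Lemma has_cderiv_close f (h : R -> C) r d : has_cderiv h r d -> f r = h r ->
  (forall ep : R, 0 < ep -> exists2 dl : R, 0 < dl & forall s, `|s| < dl ->
     nc (f (r + s) - h (r + s)) <= ep * `|s|) -> has_cderiv f r d.
Proof.
move=> hh e0 hc ep ep0; have ep2 : 0 < ep / 2 by rewrite divr_gt0.
have [d1 d10 h1] := hh _ ep2; have [d2 d20 h2] := hc _ ep2.
exists (Num.min d1 d2); first by rewrite lt_min d10.
move=> s; rewrite lt_min => /andP[s1 s2].
have -> : f (r + s) - f r - s%:C * d =
    (h (r + s) - h r - s%:C * d) + (f (r + s) - h (r + s)).
  by rewrite e0; ring.
apply: le_trans (le_normcD _ _) _; rewrite [ep]splitr mulrDl.
by apply: lerD; [apply: h1 | apply: h2].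
Qed.

Lemma has_cderiv_lip f r d : has_cderiv f r d -> exists2 K : R, 0 < K &
  exists2 dl : R, 0 < dl & forall s, `|s| < dl -> nc (f (r + s) - f r) <= K * `|s|.
Proof.
move=> hf; have [dl dl0 hd] := hf 1 ltr01.
have n0 : 0 <= nc d := le_trans (normr_ge0 _) (nc_Re d).
exists (1 + nc d); first by rewrite ltr_pwDl.
exists dl => // s sd.
have -> : f (r + s) - f r = (f (r + s) - f r - s%:C * d) + s%:C * d by ring.
apply: le_trans (le_normcD _ _) _; rewrite mulrDl; apply: lerD; first exact: hd.
rewrite Normc.normcM mulrC; apply: ler_wpM2l => //.
by rewrite /= expr0n addr0 sqrtr_sqr.
Qed.

Lemma has_cderivD f (h : R -> C) r a b : has_cderiv f r a -> has_cderiv h r b ->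
  has_cderiv (fun s => f s + h s) r (a + b).
Proof.
move=> hf hh ep ep0; have ep2 : 0 < ep / 2 by rewrite divr_gt0.
have [d1 d10 h1] := hf _ ep2; have [d2 d20 h2] := hh _ ep2.
exists (Num.min d1 d2); first by rewrite lt_min d10.
move=> s; rewrite lt_min => /andP[s1 s2].
have -> : f (r + s) + h (r + s) - (f r + h r) - s%:C * (a + b) =
  (f (r + s) - f r - s%:C * a) + (h (r + s) - h r - s%:C * b) by ring.
apply: le_trans (le_normcD _ _) _; rewrite [ep]splitr mulrDl.
by apply: lerD; [apply: h1 | apply: h2].
Qed.

Lemma has_cderiv_cst (c : C) r : has_cderiv (fun=> c) r 0.
Proof.
move=> ep ep0; exists 1 => // s _.
by rewrite subrr mulr0 subr0 Normc.normc0 mulr_ge0 // ltW.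
Qed.

Lemma has_cderivZ (c : C) f r d : has_cderiv f r d ->
  has_cderiv (fun s => c * f s) r (c * d).
Proof.
move=> hf; have := has_cderivM (has_cderiv_cst c r) hf.
by rewrite mul0r addr0.
Qed.

Lemma has_cderiv_shift f r d : has_cderiv (fun s => f (r + s)) 0 d -> has_cderiv f r d.
Proof.
move=> hf ep ep0; have [dl dl0 hd] := hf ep ep0; exists dl => // s sd.
by have := hd s sd; rewrite add0r addr0.
Qed.

Lemma cderiv0_const f : (forall r, has_cderiv f r 0) -> forall r s, f r = f s.
Proof.
move=> h r s; apply: complexP.
  apply: (@is_derive_0_is_cst R (fun x => complex.Re (f x))) => x.
  by have /has_cderivP [] := h x.
apply: (@is_derive_0_is_cst R (fun x => complex.Im (f x))) => x.
by have /has_cderivP [] := h x.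
Qed.

End ComplexCurves.
(** * First-order expansions at the identity of SL(2) *)

Section FirstOrder.
Variable C : numFieldType.
Implicit Types (f h : 'M[C]_2 -> C) (X A : 'M[C]_2).

Lemma differential_SL2D f1 f2 A a1 a2 :
  differential_SL2 f1 A a1 -> differential_SL2 f2 A a2 ->
  differential_SL2 (fun M => f1 M + f2 M) A (a1 + a2).
Proof.
move=> [h1 l1 e1] [h2 l2 e2]; exists (h1 + h2).
  near=> M; have [d1 h1M] : differentiable h1 M /\ (\det M = 1 -> h1 M = f1 M).
    by near: M.
  have [d2 h2M] : differentiable h2 M /\ (\det M = 1 -> h2 M = f2 M) by near: M.
  split; first exact: differentiableD.
  by move=> dM; rewrite fctE h1M // h2M.
have [d1 _] := nbhs_singleton l1; have [d2 _] := nbhs_singleton l2.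
by rewrite diffD // -e1 -e2.
Unshelve. all: by end_near. Qed.

Lemma differential_SL2Z c f A a :
  differential_SL2 f A a -> differential_SL2 (fun M => c * f M) A (c * a).
Proof.
move=> [h l e]; exists (c \*: h).
  near=> M; have [d hM] : differentiable h M /\ (\det M = 1 -> h M = f M).
    by near: M.
  split; first exact: differentiableZ.
  by move=> dM; rewrite -hM.
have [d _] := nbhs_singleton l.
by rewrite diffZ // -e.
Unshelve. all: by end_near. Qed.

Lemma differential_SL2_sum (I : Type) (s : seq I) (F : I -> 'M[C]_2 -> C) A (a : I -> C) :
  (forall i, differential_SL2 (F i) A (a i)) ->
  differential_SL2 (fun M => \sum_(i <- s) F i M) A (\sum_(i <- s) a i).
Proof.
move=> h; elim: s => [|i s IH].
  exists (cst 0); last by rewrite big_nil diff_cst.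
  near=> M; split; first exact: differentiable_cst.
  by rewrite big_nil.
rewrite big_cons.
have -> : (fun M => \sum_(j <- i :: s) F j M) =
   (fun M => F i M + \sum_(j <- s) F j M).
  by apply/funext => M; rewrite big_cons.
exact: differential_SL2D.
Unshelve. all: by end_near. Qed.

Lemma holomorphic_differential f A : holomorphic_SL2 f ->
  exists d, differential_SL2 f A d.
Proof.
move=> /(_ 1%:M (det1 _ _)) [h hh].
by exists ('d h (1%:M : 'M[C]_2) A); exists h.
Qed.

Lemma mx_norm_le_sum X : `|X| <= \sum_i \sum_j `|X i j|.
Proof.
rewrite -[leLHS]/(mx_norm X); have [->|/mx_norm_neq0 [[i j] /= ->]] := eqVneq (mx_norm X) 0.
  by apply: sumr_ge0 => i _; apply: sumr_ge0 => j _.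
rewrite (bigD1 i) //= (bigD1 j) //= -addrA lerDl addr_ge0 //.
  by apply: sumr_ge0 => j' _.
by apply: sumr_ge0 => i' _; apply: sumr_ge0 => j' _.
Qed.

Lemma near_entries (Q : 'M[C]_2 -> Prop) A : (\forall M \near A, Q M) ->
  exists2 dl : C, 0 < dl & forall X, (forall i j, `|X i j| < dl) -> Q (A + X).
Proof.
move=> /nbhs_normP [e /= e0 he].
exists (e / 4) => [|X hX]; first by rewrite divr_gt0.
apply: he; rewrite /ball_ /= opprD addrA subrr add0r normrN.
apply: le_lt_trans (mx_norm_le_sum X) _; rewrite !sum2E.
have -> : e = (e / 4 + e / 4) + (e / 4 + e / 4) by field.
by apply: ltrD; apply: ltrD.
Qed.

(** The function and its extension may differ off SL(2), so the expansion is
    restricted to increments that stay in the group. *)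
Lemma differential_SL2_expand f A d : differential_SL2 f A d ->
  exists L : {linear 'M[C]_2 -> C}, L A = d /\ forall e : C, 0 < e ->
    exists2 dl : C, 0 < dl & forall X, (forall i j, `|X i j| < dl) ->
      \det (1%:M + X) = 1 ->
      `|f (1%:M + X) - f 1%:M - L X| <= e * \sum_i \sum_j `|X i j|.
Proof.
move=> [h lh ed]; have [dh h1] := nbhs_singleton lh.
exists ('d h (1%:M : 'M[C]_2)); split=> // e e0.
have [_ /eqaddoP hdiff] := (diff_locallyP _ _).1 dh.
have [d1 d10 hd1] := near_entries lh.
have [d2 d20 hd2] := near_entries (hdiff e e0).
have [d3 d30 [d31 d32]] : exists2 d3, 0 < d3 & d3 <= d1 /\ d3 <= d2.
  have [c1|c1] := boolP (d1 <= d2); first by exists d1.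
  exists d2 => //; split=> //; have := real_leVge (gtr0_real d10) (gtr0_real d20).
  by rewrite (negPf c1).
exists d3 => // X hX dX.
have [_ hf] : differentiable h (1%:M + X) /\
    (\det (1%:M + X) = 1 -> h (1%:M + X) = f (1%:M + X)).
  by apply: hd1 => i j; apply: lt_le_trans (hX i j) d31.
have := hd2 X (fun i j => lt_le_trans (hX i j) d32).
rewrite add0r !fctE /= -h1 ?det1 // -hf // [X + _]addrC opprD addrA => he.
apply: le_trans he _; apply: ler_wpM2l; first exact: ltW.
exact: mx_norm_le_sum.
Qed.

End FirstOrder.
(** * Weights of a holomorphic representation *)

Section Coordinates.
Variables (F : fieldType) (V : vectType F).
Implicit Types (phi : 'Hom(V, F^o)) (x y : V) (f : 'End(V)).
Local Notation e := (vbasis {:V}).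
Local Notation n := (\dim {:V}).

Definition coordh (i : 'I_n) : 'Hom(V, F^o) := linfun (coord e i : V -> F^o).

Lemma coordhE i x : coordh i x = coord e i x.
Proof. by rewrite lfunE. Qed.

Lemma coord_expand x : x = \sum_(i < n) coordh i x *: e`_i.
Proof.
rewrite [LHS](coord_vbasis (memvf x)).
by apply: eq_bigr => i _; rewrite coordhE.
Qed.

Lemma coordh_inj x y : (forall phi, phi x = phi y) -> x = y.
Proof.
move=> h; rewrite (coord_expand x) (coord_expand y).
by apply: eq_bigr => i _; rewrite h.
Qed.

Lemma functional_expand phi x : phi x = \sum_(i < n) phi e`_i * coordh i x.
Proof.
rewrite {1}(coord_expand x) linear_sum; apply: eq_bigr => i _.
by rewrite linearZ /= mulrC.
Qed.

Lemma functional_endo phi f x :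
  phi (f x) = \sum_(i < n) phi e`_i * \sum_(j < n) coordh j x * coordh i (f e`_j).
Proof.
rewrite functional_expand; apply: eq_bigr => i _; congr (_ * _).
rewrite {1}(coord_expand x) !linear_sum; apply: eq_bigr => j _.
by rewrite !linearZ.
Qed.

Lemma functional_endo_exists (d : 'I_n * 'I_n -> F) : exists f : 'End(V),
  forall phi x, phi (f x) = \sum_(i < n) phi e`_i * \sum_(j < n) coordh j x * d (i, j).
Proof.
exists (passmx.hommx e e (\matrix_(j, i) d (i, j))) => phi x.
have be := vbasisP (@fullv _ V).
rewrite (passmx.hommxE be be) /passmx.vecof linear_sum; apply: eq_bigr => i _.
rewrite linearZ [RHS]mulrC; congr (_ * _); rewrite mxE.
by apply: eq_bigr => j _; rewrite !mxE coordhE.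
Qed.

End Coordinates.

Section TorusAction.
Variable R : realType.
Local Notation C := R[i].
Local Notation nc := (@Normc.normc R).
Variables (g : vectType C) (br : g -> g -> g) (rho : 'M[C]_2 -> 'End(g)).
Hypothesis hrho : lie_group_rep br rho.
Implicit Types (phi : 'Hom(g, C^o)) (x y : g) (A M : 'M[C]_2) (t z l : C).

(** Each matrix coefficient has a differential because it is holomorphic; these are
    the coefficients of the endomorphism that the definition asks for. *)
Lemma drho_spec A phi x :
  differential_SL2 (fun M => phi (rho M x)) A (phi (drho rho A x)).
Proof.
suff [D hD] : exists D : 'End(g), forall phi x,
    differential_SL2 (fun M => phi (rho M x)) A (phi (D x)).
  have := @xgetPex _ 0 [set D : 'End(g) | forall (phi : 'Hom(g, C^o)) (x : g),
            differential_SL2 (fun M => phi (rho M x)) A (phi (D x))].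
  by move=> /(_ (ex_intro _ D hD)); apply.
have /choice [d hd] (ij : 'I_(\dim {:g}) * 'I_(\dim {:g})) : exists d : C,
    differential_SL2 (fun M => coordh ij.1 (rho M (vbasis {:g})`_ij.2)) A d.
  exact: holomorphic_differential (rep_holomorphic hrho (coordh ij.1) _).
have [D hD] := functional_endo_exists d; exists D => {}phi {}x; rewrite hD.
under [X in differential_SL2 X]eq_fun do rewrite functional_endo.
apply: differential_SL2_sum => i; apply: differential_SL2Z.
apply: differential_SL2_sum => j; apply: differential_SL2Z.
exact: (hd (i, j)).
Qed.

Definition torus t : 'M[C]_2 := mx2 t 0 0 t^-1.

Local Notation T t := (rho (torus t)).
Local Notation H := (drho rho (mx2 1 0 0 (-1))).

Lemma det_torus t : t != 0 -> \det (torus t) = 1.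
Proof. by move=> t0; rewrite det2E !mx2E mulr0 subr0 divff. Qed.

Lemma torusM s t : torus s *m torus t = torus (s * t).
Proof.
apply: mx2P; rewrite mulmx2 !mx2E ?mulr0 ?mul0r ?addr0 ?add0r //.
by rewrite invfM.
Qed.

Lemma torus1 : torus 1 = 1%:M.
Proof. by apply: mx2P; rewrite !mxE //= invr1. Qed.

Lemma rho_torusM s t x : s != 0 -> t != 0 -> T (s * t) x = T s (T t x).
Proof.
move=> s0 t0; rewrite -torusM (rep_mul hrho) ?det_torus //.
by rewrite comp_lfunE.
Qed.

Lemma rho_torus1 x : T 1 x = x.
Proof. by rewrite torus1 (rep_one hrho) id_lfunE. Qed.

Lemma norm_nc z : `|z| = (nc z)%:C. Proof. by []. Qed.

(** The curve [torus (cexp (z * r))] leaves the identity in the direction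
    [z * diag(1, -1)], up to an error of second order that the first-order
    expansion controls. *)
Lemma torus_deriv0 z phi x :
  has_cderiv (fun r => phi (T (cexp (z * r%:C)) x)) 0 (z * phi (H x)).
Proof.
have [L [LA hL]] := differential_SL2_expand (drho_spec (mx2 1 0 0 (-1)) phi x).
pose X (r : R) : 'M[C]_2 :=
  mx2 (cexp (z * r%:C) - 1) 0 0 (cexp (- z * r%:C) - 1).
pose a := L (mx2 1 0 0 0); pose b := L (mx2 0 0 0 1).
have LX r : L (X r) = (cexp (z * r%:C) - 1) * a + (cexp (- z * r%:C) - 1) * b.
  rewrite -[_ * a]linearZ -[_ * b]linearZ -linearD; congr (L _).
  by apply: mx2P; rewrite !mxE /= ?mulr0 ?mulr1 ?addr0 ?add0r.
have Lab : phi (H x) = a - b.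
  rewrite -LA /a /b -linearB; congr (L _).
  by apply: mx2P; rewrite !mxE /= ?subr0 ?sub0r.
have eX r : 1%:M + X r = torus (cexp (z * r%:C)).
  apply: mx2P; rewrite !mxE /= ?addr0 //; first by rewrite addrC subrK.
  by rewrite addrC subrK mulNr cexpNV.
have c1 := has_cderiv_cexp z 0; have c2 := has_cderiv_cexp (- z) 0.
rewrite !mulr0 cexp0 !mulr1 in c1 c2.
pose h (r : R) : C := (phi (T 1 x) - a - b)
   + (a * cexp (z * r%:C) + b * cexp (- z * r%:C)).
have dh : has_cderiv h 0 (z * phi (H x)).
  have := has_cderivD (has_cderiv_cst (phi (T 1 x) - a - b) 0)
    (has_cderivD (has_cderivZ a c1) (has_cderivZ b c2)).
  by rewrite Lab (_ : 0 + _ = z * (a - b)) //; ring.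
apply: has_cderiv_close dh _ _.
  by rewrite /h !mulr0 cexp0 !mulr1; ring.
move=> ep ep0; have [K1 K10 [d1 d10 h1]] := has_cderiv_lip c1.
have [K2 K20 [d2 d20 h2]] := has_cderiv_lip c2.
pose ep' := ep / (K1 + K2).
have ep'0 : 0 < ep' by rewrite divr_gt0 // addr_gt0.
have [dC dC0 hdC] := hL ep'%:C (etrans (ltcR 0 ep') ep'0).
have [dl dle] : exists dl : R, dC = dl%:C.
  by exists (complex.Re dC); apply/esym/RRe_real/gtr0_real.
have dl0 : 0 < dl by rewrite -ltcR -dle.
exists (Num.min (Num.min d1 d2) (Num.min (dl / K1) (dl / K2))).
  by rewrite !lt_min d10 d20 !divr_gt0.
move=> s; rewrite !lt_min -!andbA => /and4P[s1 s2 s3 s4]; rewrite add0r.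
have := h1 s s1; have := h2 s s2; rewrite !add0r !mulr0 cexp0 => b2 b1.
have k1 : nc (cexp (z * s%:C) - 1) < dl.
  by apply: le_lt_trans b1 _; rewrite mulrC -ltr_pdivlMr.
have k2 : nc (cexp (- z * s%:C) - 1) < dl.
  by apply: le_lt_trans b2 _; rewrite mulrC -ltr_pdivlMr.
have hX i j : `|X s i j| < dC.
  rewrite dle norm_nc ltcR.
  by case: (I2P i) => ->; case: (I2P j) => ->; rewrite mx2E ?Normc.normc0.
have := hdC (X s) hX; rewrite eX det_torus ?cexp_neq0 // => /(_ erefl).
rewrite LX !sum2E !mx2E !normr0 addr0 add0r.
rewrite -torus1.
rewrite (_ : _ - _ = phi (T (cexp (z * s%:C)) x) - h s); last first.
  by rewrite /h; ring.
rewrite !norm_nc -rmorphD -rmorphM lecR => le1.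
apply: le_trans le1 _.
have -> : ep * `|s| = ep' * ((K1 + K2) * `|s|).
  by rewrite mulrA /ep' divfK // gt_eqF // addr_gt0.
by apply: ler_wpM2l; [exact: ltW | rewrite mulrDl lerD].
Qed.

Lemma has_cderiv_eq (f : R -> C) r d d' :
  has_cderiv f r d -> d = d' -> has_cderiv f r d'.
Proof. by move=> + <-. Qed.

Lemma torus_deriv z phi x r : has_cderiv (fun r => phi (T (cexp (z * r%:C)) x)) r
  (z * phi (T (cexp (z * r%:C)) (H x))).
Proof.
apply: has_cderiv_shift.
have := torus_deriv0 z (phi \o T (cexp (z * r%:C)))%VF x; rewrite !comp_lfunE.
congr has_cderiv; apply/funext => s.
rewrite !comp_lfunE -rho_torusM ?cexp_neq0 // -cexpD; congr (phi (T (cexp _) x)).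
by rewrite rmorphD mulrDr.
Qed.

(** [cexp (- l z r) T (cexp (z r)) x] has zero derivative in [r]. *)
Lemma torus_eigen l x z : H x = l *: x -> T (cexp z) x = cexp (l * z) *: x.
Proof.
move=> hx; apply: coordh_inj => phi; rewrite linearZ /=.
pose f (r : R) := cexp (- (l * z) * r%:C) * phi (T (cexp (z * r%:C)) x).
have df r : has_cderiv f r 0.
  apply: has_cderiv_eq
    (has_cderivM (has_cderiv_cexp (- (l * z)) r) (torus_deriv z phi x r)) _.
  rewrite hx !linearZ /= /GRing.scale /=.
  by move: (cexp _) (phi _) => c u; ring.
have := cderiv0_const df 1 0; rewrite /f !mulr0 !mulr1 cexp0 mul1r rho_torus1 => e1.
by rewrite -e1 /GRing.scale /= mulrA -cexpD addrN cexp0 mul1r.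
Qed.

(** The analogue for a Jordan block of size two, whose exponential has an extra
    linear term. *)
Lemma torus_jordan l x y z : H x = l *: x + y -> H y = l *: y ->
  T (cexp z) x = cexp (l * z) *: (x + z *: y).
Proof.
move=> hx hy; apply: coordh_inj => phi; rewrite linearZ /= linearD linearZ /=.
pose f (r : R) := cexp (- (l * z) * r%:C) * phi (T (cexp (z * r%:C)) x)
   + (- (z * phi y)) * r%:C.
have dr r : has_cderiv (fun r : R => r%:C) r 1.
  move=> ep ep0; exists 1 => // s _; rewrite rmorphD mulr1 [r%:C + _]addrC addrK.
  by rewrite subrr Normc.normc0 mulr_ge0 // ltW.
have df r : has_cderiv f r 0.
  apply: has_cderiv_eq (has_cderivD
    (has_cderivM (has_cderiv_cexp (- (l * z)) r) (torus_deriv z phi x r))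
    (has_cderivZ (- (z * phi y)) (dr r))) _.
  have -> : phi (T (cexp (z * r%:C)) (H x)) =
      l * phi (T (cexp (z * r%:C)) x) + cexp (l * (z * r%:C)) * phi y.
    by rewrite hx !linearD !linearZ /= (torus_eigen _ hy) linearZ.
  have : cexp (- (l * z) * r%:C) * cexp (l * (z * r%:C)) = 1.
    by rewrite -cexpD mulNr mulrA addNr cexp0.
  move: (cexp (- _ * _)) (cexp (l * _)) (phi (T _ x)) (phi y) => c c' u v ecc.
  transitivity (z * v * (c * c' - 1)); first by ring.
  by rewrite ecc subrr mulr0.
have := cderiv0_const df 1 0; rewrite /f !mulr0 !mulr1 cexp0 mul1r rho_torus1 addr0.
move=> e1; rewrite -e1 /GRing.scale /= addrNK mulrA -cexpD addrN cexp0 mul1r //.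
Qed.

Lemma cexp2pi : cexp (0 +i* (pi *+ 2)) = 1 :> C.
Proof. by rewrite /cexp /= expR0 !mul1r cos2pi sin2pi. Qed.

(** [torus (cexp z)] returns to the identity at [z = 2 pi i]. *)
Lemma weight_int l x : H x = l *: x -> x != 0 -> cexp (l * (0 +i* (pi *+ 2))) = 1.
Proof.
move=> hx nx; have := torus_eigen (0 +i* (pi *+ 2)) hx.
rewrite cexp2pi rho_torus1 -{1}[x]scale1r => /eqP.
rewrite -subr_eq0 -scalerBl scaler_eq0 (negPf nx) orbF subr_eq0 => /eqP.
by move=> <-.
Qed.

(** At [z = 2 pi i] the torus acts trivially, whereas a Jordan block would add the
    vector [2 pi i y]. *)
Lemma weight_semisimple l x y : H x = l *: x + y -> H y = l *: y -> y = 0.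
Proof.
move=> hx hy; apply/eqP/negPn/negP => ny.
have e1 := weight_int hy ny.
have := torus_jordan (0 +i* (pi *+ 2)) hx hy.
rewrite cexp2pi rho_torus1 e1 scale1r => /eqP.
rewrite -subr_eq0 opprD addrA subrr sub0r oppr_eq0 scaler_eq0 (negPf ny) orbF.
by move=> /eqP [] /eqP; rewrite mulrn_eq0 /= gt_eqF // pi_gt0.
Qed.

End TorusAction.
(** * Diagonalisation *)

Section Diagonalisation.
Import passmx.
Variable F : closedFieldType.

(** If [X - z] divided the minimal polynomial twice, dropping one factor would still
    annihilate [A], against minimality. *)
Lemma semisimple_diagonalizable n (A : 'M[F]_n) :
  (forall (l : F) (u : 'rV_n), u *m (A - l%:M) *m (A - l%:M) = 0 ->
     u *m (A - l%:M) = 0) -> diagonalizable A.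
Proof.
case: n A => [|n] A hA; first by rewrite (flatmx0 A); exact: diagonalizable0.
have [s es] := closed_field_poly_normal (mxminpoly A).
rewrite (monicP (mxminpoly_monic A)) scale1r in es.
apply/diagonalizableP; exists s; last by rewrite es.
apply/negPn/negP => ns.
have [z [s' ps]] : exists z s', perm_eq s [:: z, z & s'].
  elim: s ns {es} => // a s IH /=; rewrite negb_and negbK => /orP[as_|/IH [z [s' ps]]].
    exists a, (rem a s); rewrite perm_cons.
    exact: perm_to_rem.
  exists z, (a :: s'); apply/permP => r; rewrite /= (permP ps r) /=; lia.
pose q := \prod_(x <- s') ('X - x%:P).
have em : mxminpoly A = ('X - z%:P) * (('X - z%:P) * q).
  by rewrite es (perm_big _ ps) !big_cons.
have hz : horner_mx A ('X - z%:P) = A - z%:M.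
  by rewrite rmorphB /= horner_mx_X horner_mx_C.
have : horner_mx A (('X - z%:P) * q) = 0.
  apply/row_matrixP => i; rewrite row0 rowE mulrC rmorphM /= hz.
  rewrite -[_ * _]/(_ *m _) mulmxA; apply: hA.
  rewrite -!mulmxA -hz.
  have -> : horner_mx A q *m (horner_mx A ('X - z%:P) *m horner_mx A ('X - z%:P)) =
      horner_mx A (mxminpoly A) by rewrite em mulrA mulrC !rmorphM.
  by rewrite mx_root_minpoly mulmx0.
move/mxminpoly_min/dvdp_leq.
have q0 : q != 0 by apply: monic_neq0; apply: monic_prod_XsubC.
have zq0 : ('X - z%:P) * q != 0 by rewrite mulf_neq0 // polyXsubC_eq0.
by rewrite zq0 em size_mul ?polyXsubC_eq0 // size_XsubC /= ltnn => /(_ isT).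
Qed.

Variable (V : vectType F).

Lemma semisimple_basis (H : 'End(V)) :
  (forall l x y, H x = l *: x + y -> H y = l *: y -> y = 0) ->
  exists (v : 'I_(\dim {:V}) -> V) (kappa : 'I_(\dim {:V}) -> F)
         (phi : 'I_(\dim {:V}) -> 'Hom(V, F^o)),
  [/\ forall i, H (v i) = kappa i *: v i, forall x, x = \sum_i phi i x *: v i &
      forall i j, phi i (v j) = (i == j)%:R].
Proof.
set n := \dim {:V}; pose e := vbasis {:V} => hH.
have be : basis_of {:V} e := vbasisP _.
pose A : 'M[F]_n := mxof e e H.
have uA u l : u *m (A - l%:M) = rVof e (H (vecof e u) - l *: vecof e u).
  rewrite mulmxBr mul_mx_scalar [RHS]linearB mul_mxof.
  by rewrite [X in _ = _ - X]linearZ /= vecofK.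
have [P uP dP] : diagonalizable A.
  apply: semisimple_diagonalizable => l u; rewrite !uA rVofK //.
  set x := vecof e u; set y := H x - l *: x => h0.
  suff -> : y = 0 by rewrite linear0.
  apply: (hH l x); first by rewrite /y addrC subrK.
  apply/eqP; rewrite -subr_eq0; apply/eqP.
  by apply: (can_inj (rVofK be)); rewrite h0 linear0.
have [D /(simmxP uP) sD] := diagonalizable_forPex dP.
pose phi i : 'Hom(V, F^o) := \sum_(k < n) invmx P k i *: coordh k.
have phiE i x : phi i x = (rVof e x *m invmx P) 0 i.
  rewrite sum_lfunE mxE; apply: eq_bigr => k _.
  by rewrite scale_lfunE coordhE mxE /GRing.scale /= mulrC.
exists (fun i => vecof e (row i P)), (fun i => D 0 i), phi; split.
- move=> i; rewrite -linearZ; apply: (can_inj (rVofK be)).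
  rewrite -mul_mxof vecofK // -row_mul sD row_mul row_diag_mx.
  by rewrite -scalemxAl -rowE.
- move=> x; rewrite -{1}(rVofK be x) -{1}(mulmxKV uP (rVof e x)).
  rewrite mulmx_sum_row linear_sum; apply: eq_bigr => i _.
  by rewrite linearZ phiE.
- move=> i j; rewrite phiE vecofK // -row_mul mulmxV // row1 mxE eqxx.
  by rewrite eq_sym.
Qed.
End Diagonalisation.
(** * Matrix coefficients are polynomial *)

Section MatrixCoefficients.
Variable R : realType.
Local Notation C := R[i].
Local Notation nc := (@Normc.normc R).
Variables (g : vectType C) (br : g -> g -> g) (rho : 'M[C]_2 -> 'End(g)).
Hypothesis hrho : lie_group_rep br rho.
Implicit Types (x y : g) (M : 'M[C]_2) (t z : C).
Local Notation T t := (rho (torus t)).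
Local Notation H := (drho rho (mx2 1 0 0 (-1))).
Local Notation d := (\dim {:g}).

Lemma torus_weight (k : int) x t : H x = k%:~R *: x -> t != 0 -> T t x = t ^ k *: x.
Proof.
move=> hx /cexp_surj [z <-]; rewrite (torus_eigen hrho z hx); congr (_ *: _).
exact: cexpXz.
Qed.

Lemma weight_basis : exists (v : 'I_d -> g) (kappa : 'I_d -> int)
    (phi : 'I_d -> 'Hom(g, C^o)),
  [/\ forall i, H (v i) = (kappa i)%:~R *: v i,
      forall x, x = \sum_i phi i x *: v i
    & forall i j, phi i (v j) = (i == j)%:R].
Proof.
have [v [l [phi [hv ex dual]]]] := semisimple_basis
  (fun l x y => @weight_semisimple R g br rho hrho l x y).
have nv i : v i != 0.
  apply: contra_eq_neq (dual i i) => ->.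
  by rewrite linear0 eqxx eq_sym oner_neq0.
have /choice [kappa hk] i : exists k : int, l i = k%:~R.
  exact: cexp_2pi_int (weight_int hrho (hv i) (nv i)).
by exists v, kappa, phi; split=> // i; rewrite -hk.
Qed.

Definition shear z : 'M[C]_2 := mx2 1 z 0 1.

Lemma det_shear z : \det (shear z) = 1.
Proof. by rewrite det2E !mx2E mulr0 subr0 mulr1. Qed.

Lemma torus_shear t z : t != 0 ->
  torus t *m shear z *m torus t^-1 = shear (t ^+ 2 * z).
Proof.
move=> t0; apply: mx2P; rewrite !mulmx2 !mx2E ?mulr0 ?mul0r ?addr0 ?add0r ?mulr1 //.
all: rewrite ?invrK ?divff ?mulVf //.
  by rewrite expr2 mulrAC.
by rewrite mul0r.
Qed.

(** Only a bound near [z = 0] is needed, and the first-order expansion at the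
    identity gives it. *)
Lemma shear_lipschitz (phi : 'Hom(g, C^o)) x : exists2 K : R, 0 < K &
  exists2 dl : R, 0 < dl & forall z, nc z < dl ->
    nc (phi (rho (shear z) x) - phi (rho (shear 0) x)) <= K * nc z.
Proof.
have [a ha] := holomorphic_differential 0 (rep_holomorphic hrho phi x).
have [L [_ hL]] := differential_SL2_expand ha.
have [dC dC0 hdC] := hL 1 ltr01.
have [dl dle] : exists dl : R, dC = dl%:C.
  by exists (complex.Re dC); apply/esym/RRe_real/gtr0_real.
have dl0 : 0 < dl by rewrite -ltcR -dle.
pose c := L (mx2 0 1 0 0).
have c0 : 0 <= nc c := le_trans (normr_ge0 _) (nc_Re c).
exists (1 + nc c); first by rewrite ltr_pwDl.
exists dl => // z zd.
pose X : 'M[C]_2 := mx2 0 z 0 0.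
have eX : 1%:M + X = shear z.
  by apply: mx2P; rewrite !mxE /= ?addr0 ?add0r.
have e0 : 1%:M = shear 0 by apply: mx2P; rewrite !mxE.
have LX : L X = z * c.
  rewrite -[z * c]linearZ; congr (L _).
  by apply: mx2P; rewrite !mxE /= ?mulr0 ?mulr1.
have hX i j : `|X i j| < dC.
  rewrite dle norm_nc ltcR.
  by case: (I2P i) => ->; case: (I2P j) => ->; rewrite mx2E ?Normc.normc0.
have := hdC X hX; rewrite eX det_shear => /(_ erefl).
rewrite LX e0 !sum2E !mx2E !normr0 !addr0 add0r mul1r !norm_nc lecR => le1.
have -> : phi (rho (shear z) x) - phi (rho (shear 0) x) =
  (phi (rho (shear z) x) - phi (rho (shear 0) x) - z * c) + z * c.
  by rewrite subrK.
apply: le_trans (le_normcD _ _) _; rewrite mulrDl mul1r; apply: lerD => //.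
by rewrite Normc.normcM mulrC.
Qed.

Lemma small_bound (a K dl : R) : 0 < K -> 0 < dl ->
  (forall r : R, 0 < r -> r < dl -> a <= K * r) -> a <= 0.
Proof.
move=> K0 dl0 h; rewrite leNgt; apply/negP => a0.
pose r := Num.min (dl / 2) (a / (2 * K)).
have r0 : 0 < r by rewrite lt_min !divr_gt0 // mulr_gt0.
have rd : r < dl by rewrite gt_min; apply/orP; left; lra.
have := h r r0 rd; rewrite leNgt => /negP; apply.
have : r <= a / (2 * K) by rewrite ge_min lexx orbT.
rewrite ler_pdivlMr ?mulr_gt0 // => h2.
by have := mulr_gt0 K0 r0; nra.
Qed.

Lemma nc_real (r : R) : 0 <= r -> nc r%:C = r.
Proof. by move=> r0; rewrite /= expr0n addr0 sqrtr_sqr ger0_norm. Qed.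

(** A function with this weight under squares is a power of [z] off the origin;
    being bounded near the origin, it is a monomial. *)
Lemma weighted_monomial (f : C -> C) (m : int) :
  (forall t z, t != 0 -> f (t ^+ 2 * z) = t ^ m * f z) ->
  (exists2 K : R, 0 < K & exists2 dl : R, 0 < dl &
     forall z, nc z < dl -> nc (f z - f 0) <= K * nc z) ->
  exists (c : C) (k : nat), forall z, f z = c * z ^+ k.
Proof.
move=> hf [K K0 [dl dl0 hK]].
have sq z : z != 0 -> exists2 t, t != 0 & t ^+ 2 = z.
  by move=> z0; exists (sqrtC z); rewrite ?sqrtC_eq0 // sqrtCK.
have f1 t : t != 0 -> f (t ^+ 2) = t ^ m * f 1.
  by move=> t0; rewrite -hf // mulr1.
have hKr (r : R) : 0 < r -> r < dl -> nc (f r%:C - f 0) <= K * r.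
  by move=> r0 rd; have := hK r%:C; rewrite (nc_real (ltW r0)) => h; exact: h.
have nc0 z : nc z <= 0 -> z = 0.
  move=> h; apply: Normc.eq0_normc; apply/le_anti; rewrite h.
  exact: le_trans (normr_ge0 _) (nc_Re z).
have rC (r : R) : 0 < r -> r%:C != 0 :> C.
  by move=> r0; rewrite -(rmorph0 (real_complex R)) (inj_eq (@complexI R)) gt_eqF.
have [c0|c0] := eqVneq (f 1) 0.
  have fz z : z != 0 -> f z = 0.
    by move=> /sq [t t0 <-]; rewrite f1 // c0 mulr0.
  exists 0, 0%N => z; rewrite mul0r; have [->|/fz//] := eqVneq z 0.
  apply/eqP; rewrite -oppr_eq0; apply/eqP/nc0; apply: (small_bound K0 dl0) => r r0 rd.
  by have := hKr r r0 rd; rewrite fz ?rC // sub0r.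
(* Taking [t = -1] leaves [t ^+ 2 * z] unchanged. *)
have m2 : (2 %| m)%Z.
  have := f1 (-1); rewrite oppr_eq0 oner_neq0 sqrrN expr1n => /(_ isT) e.
  have {e} : (-1) ^ m = 1 :> C by apply: (mulIf c0); rewrite mul1r.
  have /orP[/eqP em|/eqP em] : (m == (m %/ 2)%Z * 2) || (m == (m %/ 2)%Z * 2 + 1).
  - by apply/orP; lia.
  - by rewrite em dvdz_mull.
  - have n1 : (-1 : C) != 0 by rewrite oppr_eq0 oner_neq0.
    rewrite em expfzDr // mulrC -exprz_exp mulrC expr1z.
    have -> : ((-1) ^ (m %/ 2)%Z) ^ 2 = 1 :> C.
      by rewrite exprz_exp mulrC -exprz_exp -exprnP sqrrN expr1n exp1rz.
    rewrite mul1r => /eqP.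
    by rewrite eq_sym -subr_eq0 opprK -mulr2n pnatr_eq0.
have /dvdzP [n em] := m2.
have fz z : z != 0 -> f z = f 1 * z ^ n.
  move=> /sq [t t0 <-]; rewrite f1 // em [RHS]mulrC; congr (_ * _).
  by rewrite exprnP exprz_exp [in RHS]mulrC.
have f0 : f 0 = 2 ^ m * f 0.
  by rewrite -hf ?pnatr_eq0 // mulr0.
have n0 : n != 0 -> f 0 = 0.
  move=> nn0; apply/eqP; have /eqP := f0; rewrite eq_sym -subr_eq0 -{2}[f 0]mul1r.
  rewrite -mulrBl mulf_eq0 => /orP[|//]; rewrite subr_eq0 => /eqP e1.
  exfalso; move: nn0; apply/negP; rewrite negbK.
  have n21 k : (2 : C) ^+ k = 1 -> k = 0%N.
    by case: k => // k /eqP; rewrite pexprn_eq1 ?ler0n // (eqr_nat C 2 1).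
  suff : m = 0 by rewrite em => /eqP; rewrite mulf_eq0 orbF.
  move: e1; case: m {hf f1 m2 em f0} => k.
    by move=> /n21 ->.
  by rewrite NegzE -exprnN => /(congr1 GRing.inv); rewrite invrK invr1 => /n21.
(* The value at [0] is a limit, which rules out negative exponents. *)
case: n em fz n0 => [[|n]|n] em fz n0.
- exists (f 1), 0%N => z; rewrite expr0 mulr1.
  have [->|/fz ->] := eqVneq z 0; last by rewrite expr0z mulr1.
  apply/esym/eqP; rewrite -subr_eq0; apply/eqP/nc0; apply: (small_bound K0 dl0) => r r0 rd.
  by have := hKr r r0 rd; rewrite fz ?rC // expr0z mulr1.
- exists (f 1), n.+1 => z.
  by have [->|/fz ->] := eqVneq z 0; rewrite ?n0 // expr0n mulr0.
- exfalso; move/negP: c0; apply; apply/eqP/nc0.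
  apply: (@small_bound _ K (Num.min dl 1)) => //; first by rewrite lt_min dl0 ltr01.
  move=> r r0; rewrite lt_min => /andP[rd r1].
  have := hKr r r0 rd; rewrite n0 // subr0 fz ?rC // Normc.normcM => h.
  apply: le_trans h; rewrite ler_peMr //; first exact: le_trans (normr_ge0 _) (nc_Re _).
  rewrite NegzE -exprnN -rmorphXn -fmorphV nc_real ?invr_ge0 ?exprn_ge0 ?(ltW r0) //.
  by rewrite invf_ge1 ?exprn_gt0 // exprn_ile1 // ?ltW.
Qed.

Inductive polynomial_entries : ('M[C]_2 -> C) -> Prop :=
| PolyConst c : polynomial_entries (fun=> c)
| PolyEntry i j : polynomial_entries (fun M => M i j)
| PolyAdd f1 f2 : polynomial_entries f1 -> polynomial_entries f2 ->
    polynomial_entries (fun M => f1 M + f2 M)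
| PolyMul f1 f2 : polynomial_entries f1 -> polynomial_entries f2 ->
    polynomial_entries (fun M => f1 M * f2 M).

Lemma PolyExp f k : polynomial_entries f -> polynomial_entries (fun M => f M ^+ k).
Proof.
move=> pf; elim: k => [|k IH].
  rewrite (_ : (fun M => _) = fun=> 1); first exact: PolyConst.
  by apply/funext => M; rewrite expr0.
rewrite (_ : (fun M => _) = fun M => f M * f M ^+ k); first exact: PolyMul.
by apply/funext => M; rewrite exprS.
Qed.

Lemma PolySubst f (s : 'M[C]_2 -> 'M[C]_2) : polynomial_entries f ->
  (forall i j, polynomial_entries (fun M => s M i j)) ->
  polynomial_entries (fun M => f (s M)).
Proof.
move=> pf hs; elim: pf => [c|i j|f1 f2 _ p1 _ p2|f1 f2 _ p1 _ p2].
- exact: PolyConst.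
- exact: hs.
- exact: PolyAdd.
- exact: PolyMul.
Qed.

Definition sl2_regular (f : 'M[C]_2 -> C) : Prop :=
  exists2 p, polynomial_entries p & forall M, \det M = 1 -> f M = p M.

Lemma sl2_regular_subst f (s : 'M[C]_2 -> 'M[C]_2) : sl2_regular f ->
  (forall i j, polynomial_entries (fun M => s M i j)) ->
  (forall M, \det M = 1 -> \det (s M) = 1) -> sl2_regular (fun M => f (s M)).
Proof.
move=> [p pp ep] hs ds; exists (fun M => p (s M)); first exact: PolySubst.
by move=> M dM; rewrite ep // ds.
Qed.

(** The determinant is a linear relation between [M 0 0] and [M 1 0] with value 1, so
    no point of SL(2) is a common zero; powers follow by substitution. *)
Lemma comaximal_powers (i j : nat) : exists s t : 'M[C]_2 -> C,
  [/\ polynomial_entries s, polynomial_entries t & forall M, \det M = 1 ->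
     s M * M 0 0 ^+ i + t M * M 1 0 ^+ j = 1].
Proof.
have base k : exists s t : 'M[C]_2 -> C, [/\ polynomial_entries s, polynomial_entries t &
    forall M, \det M = 1 -> s M * M 0 0 ^+ k + t M * M 1 0 = 1].
  elim: k => [|k [s [t [ps pt e]]]].
    exists (fun=> 1), (fun=> 0); split; [exact: PolyConst | exact: PolyConst |].
    by move=> M _; rewrite mul0r addr0 mul1r.
  exists (fun M => s M * M 1 1), (fun M => t M + s M * M 0 0 ^+ k * (-1) * M 0 1); split.
  - by apply: PolyMul => //; exact: PolyEntry.
  - apply: PolyAdd => //; apply: PolyMul; last exact: PolyEntry.
    apply: PolyMul; last exact: PolyConst.
    by apply: PolyMul => //; apply: PolyExp; exact: PolyEntry.
  - move=> M dM; have := e M dM; have := dM; rewrite det2E exprS.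
    move: (s M) (t M) (M 0 0) (M 0 1) (M 1 0) (M 1 1).
    move=> x y a b c d' ed; move: (a ^+ k) => p exy; transitivity (x * (a * d' - b * c) * p + y * c); first by ring.
    by rewrite ed mulr1.
elim: j => [|j [s [t [ps pt e]]]].
  exists (fun=> 0), (fun=> 1); split; [exact: PolyConst | exact: PolyConst |].
  by move=> M _; rewrite mul0r add0r mul1r.
have [s1 [t1 [ps1 pt1 e1]]] := base i.
exists (fun M => s M + t M * M 1 0 ^+ j * s1 M), (fun M => t M * t1 M); split.
- apply: PolyAdd => //; apply: PolyMul => //; apply: PolyMul => //.
  by apply: PolyExp; exact: PolyEntry.
- exact: PolyMul.
- move=> M dM; have := e M dM; have := e1 M dM; rewrite exprS.
  move: (s M) (t M) (s1 M) (t1 M) (M 0 0) (M 1 0).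
  move=> x y x1 y1 a c; move: (a ^+ i) (c ^+ j) => p q e1' e'; transitivity (x * p + y * (x1 * p + y1 * c) * q); first by ring.
  by rewrite e1' mulr1.
Qed.

(** Regular on the big Bruhat cell, where the lower left entry is invertible. *)
Definition cell_regular (f : 'M[C]_2 -> C) : Prop := exists m p,
  polynomial_entries p /\ forall M, \det M = 1 -> M 1 0 != 0 ->
    M 1 0 ^+ m * f M = p M.

Lemma cell_regular_term c n1 n2 (k : int) :
  cell_regular (fun M => c * M 0 0 ^+ n1 * M 1 1 ^+ n2 * M 1 0 ^ k).
Proof.
exists `|k|%N, (fun M => c * M 0 0 ^+ n1 * M 1 1 ^+ n2 * M 1 0 ^+ `|(`|k|%:Z + k)%R|%N).
split.
  apply: PolyMul; last by apply: PolyExp; exact: PolyEntry.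
  apply: PolyMul; last by apply: PolyExp; exact: PolyEntry.
  by apply: PolyMul; [exact: PolyConst | apply: PolyExp; exact: PolyEntry].
move=> M dM nM; rewrite mulrCA; congr (_ * _).
have k0 : 0 <= `|k|%N%:Z + k by lia.
by rewrite !exprnP -expfzDr // (gez0_abs k0).
Qed.

Lemma cell_regular_sum (I : Type) (s : seq I) (F : I -> 'M[C]_2 -> C) :
  (forall i, cell_regular (F i)) -> cell_regular (fun M => \sum_(i <- s) F i M).
Proof.
move=> h; elim: s => [|i s [m [p [pp ep]]]].
  exists 0%N, (fun=> 0); split; first exact: PolyConst.
  by move=> M _ _; rewrite big_nil mulr0.
have [m' [p' [pp' ep']]] := h i.
exists (m' + m)%N, (fun M => M 1 0 ^+ m * p' M + M 1 0 ^+ m' * p M); split.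
  by apply: PolyAdd; apply: PolyMul => //; apply: PolyExp; exact: PolyEntry.
move=> M dM nM; rewrite big_cons -ep // -ep' // exprD.
move: (M 1 0 ^+ m') (M 1 0 ^+ m) (F i M) (\sum_(j <- s) F j M) => a b c e; ring.
Qed.

End MatrixCoefficients.

Section RegularCoefficients.
Variable R : realType.
Local Notation C := R[i].
Variables (g : vectType C) (br : g -> g -> g) (rho : 'M[C]_2 -> 'End(g)).
Hypothesis hrho : lie_group_rep br rho.
Implicit Types (x y : g) (M : 'M[C]_2) (t z : C).
Local Notation T t := (rho (torus t)).
Local Notation H := (drho rho (mx2 1 0 0 (-1))).
Local Notation d := (\dim {:g}).

Lemma eq_cell_regular (f f' : 'M[C]_2 -> C) :
  (forall M, \det M = 1 -> M 1 0 != 0 -> f M = f' M) ->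
  cell_regular f -> cell_regular f'.
Proof.
move=> e [m [p [pp ep]]]; exists m, p; split=> // M dM nM.
by rewrite -e // ep.
Qed.

Lemma cell_regularZ c (f : 'M[C]_2 -> C) :
  cell_regular f -> cell_regular (fun M => c * f M).
Proof.
move=> [m [p [pp ep]]]; exists m, (fun M => c * p M); split.
  by apply: PolyMul => //; exact: PolyConst.
by move=> M dM nM; rewrite mulrCA ep.
Qed.

Definition weyl : 'M[C]_2 := mx2 0 (-1) 1 0.

Lemma det_weyl : \det weyl = 1.
Proof. by rewrite det2E !mx2E mulr0 sub0r mulr1 opprK. Qed.

Lemma bruhat M : \det M = 1 -> M 1 0 != 0 ->
  M = shear (M 0 0 / M 1 0) *m
      (weyl *m (torus (M 1 0) *m shear (M 1 1 / M 1 0))).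
Proof.
rewrite det2E => dM nM; apply: mx2P; rewrite ![in RHS]mulmx2 !mx2E.
all: move: (M 0 0) (M 0 1) (M 1 0) (M 1 1) dM nM => a b c e dM nM.
- by rewrite !(mul0r, mulr0, mul1r, mulr1, add0r, addr0, oppr0, sub0r) mulfVK.
- rewrite !(mul0r, mulr0, mul1r, mulr1, add0r, addr0, oppr0, sub0r, mulN1r).
  rewrite [c * (e / c)]mulrC mulfVK //; apply: (mulfI nM).
  rewrite mulrDr mulrN divff // mulrA [c * (a / c)]mulrC mulfVK //.
  by rewrite -dM; ring.
- by rewrite !(mul0r, mulr0, mul1r, mulr1, add0r, addr0, oppr0, sub0r).
- rewrite !(mul0r, mulr0, mul1r, mulr1, add0r, addr0, oppr0, sub0r).
  by rewrite [c * _]mulrC mulfVK.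
Qed.

Section Basis.
Variables (v : 'I_d -> g) (kappa : 'I_d -> int) (phi : 'I_d -> 'Hom(g, C^o)).
Hypothesis hv : forall i, H (v i) = (kappa i)%:~R *: v i.
Hypothesis hx : forall x, x = \sum_i phi i x *: v i.
Hypothesis dual : forall i j, phi i (v j) = (i == j)%:R.

Lemma torus_coord t i x : t != 0 -> phi i (T t x) = t ^ kappa i * phi i x.
Proof.
move=> t0; rewrite {1}(hx x) !linear_sum /= (bigD1 i) //= big1 ?addr0 => [|j ji].
  by rewrite !linearZ /= (torus_weight hrho (hv i) t0) linearZ /= dual eqxx
             -[_ *: _]/(_ * _) -[t ^ _ *: _]/(_ * _) mulr1 mulrC.
rewrite !linearZ /= (torus_weight hrho (hv j) t0) linearZ /= dual eq_sym (negPf ji).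
by rewrite !scaler0.
Qed.

(** Conjugating by the torus rescales the shear, so the coefficient is homogeneous
    under squares. *)
Lemma shear_monomial i j : exists (c : C) (k : nat), forall z,
  phi i (rho (shear z) (v j)) = c * z ^+ k.
Proof.
apply: (@weighted_monomial R _ (kappa i - kappa j)); last first.
  exact: (shear_lipschitz hrho (phi i) (v j)).
move=> t z t0; have ti0 : t^-1 != 0 by rewrite invr_neq0.
rewrite -torus_shear // (rep_mul hrho); first last.
- exact: det_torus.
- by rewrite det_mulmx det_torus // det_shear mulr1.
rewrite (rep_mul hrho) ?det_torus ?det_shear // !lfunE /= !lfunE /= torus_coord //.
rewrite (torus_weight hrho (hv j)) ?invr_neq0 // !linearZ /=.
rewrite expfzDr // -[_ *: _]/(_ * _) mulrA; congr (_ * _ * _).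
by rewrite exprz_inv.
Qed.

(** In the Bruhat decomposition the torus acts by weights and the two shears have
    monomial coefficients, in [M 0 0 / M 1 0] and in [M 1 1 / M 1 0]. *)
Lemma cell_coord i j : cell_regular (fun M => phi i (rho M (v j))).
Proof.
have /choice [c1 /choice [k1 h1]] l := shear_monomial i l.
have /choice [c2 /choice [k2 h2]] l := shear_monomial l j.
pose F (l m : 'I_d) M := (c2 l * phi m (rho weyl (v l)) * c1 m) *
  M 0 0 ^+ k1 m * M 1 1 ^+ k2 l * M 1 0 ^ (kappa l - (k1 m)%:Z - (k2 l)%:Z).
apply: (@eq_cell_regular (fun M => \sum_l \sum_m F l m M)); last first.
  by apply: cell_regular_sum => l; apply: cell_regular_sum => m; exact: cell_regular_term.
move=> M dM nM; rewrite [in RHS](bruhat dM nM).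
rewrite !(rep_mul hrho) ?det_mulmx ?det_shear ?det_weyl ?det_torus ?mul1r //.
rewrite !lfunE /= !lfunE /= !lfunE /=.
rewrite [T _ _]hx !linear_sum; apply: eq_bigr => l _.
rewrite torus_coord // h2 !linearZ /= [rho weyl _]hx !linear_sum /=.
apply: eq_bigr => m _; rewrite !linearZ /= h1 /F.
rewrite -[_ *: _]/(_ * (_ * _)).
have nk k : M 1 0 ^+ k != 0 by rewrite expf_neq0.
rewrite !expfzDr // -!exprnN !expr_div_n.
move: (M 1 0 ^ _) (phi m _) (c1 m) (c2 l) (M 0 0 ^+ _) (M 1 1 ^+ _).
move: (_ ^- k1 m) (_ ^- k2 l) => *; ring.
Qed.

End Basis.

Lemma cell_coefficient (phi : 'Hom(g, C^o)) x : cell_regular (fun M => phi (rho M x)).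
Proof.
have [v [kappa [psi [hv hx dual]]]] := weight_basis hrho.
apply: (@eq_cell_regular (fun M => \sum_j \sum_i
   psi j x * (phi (v i) * psi i (rho M (v j))))); last first.
  apply: cell_regular_sum => j; apply: cell_regular_sum => i.
  by apply: cell_regularZ; apply: cell_regularZ; exact: cell_coord hv hx dual i j.
move=> M _ _; rewrite [in RHS](hx x) !linear_sum; apply: eq_bigr => j _.
rewrite !linearZ /= [in RHS](hx (rho M (v j))) linear_sum -big_distrr /=.
congr (_ * _); apply: eq_bigr => i _; rewrite linearZ /=.
by rewrite mulrC.
Qed.

(** The coefficient is polynomial on the two open cells [M 1 0 != 0] and
    [M 0 0 != 0], which cover the group: the two expressions are glued by a
    partition of unity with powers of these entries. *)
Lemma coefficient_regular (phi : 'Hom(g, C^o)) x : sl2_regular (fun M => phi (rho M x)).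
Proof.
have [m [p [pp ep]]] := cell_coefficient phi x.
pose winv : 'M[C]_2 := mx2 0 1 (-1) 0.
have ew : winv *m weyl = 1%:M.
  apply: mx2P; rewrite ![in LHS]mulmx2 !mx2E [RHS]mxE /=; ring.
have dw : \det winv = 1 by rewrite det2E !mx2E mulr0 mul1r opprK add0r.
have [m' [p' [pp' ep']]] := cell_coefficient (phi \o rho winv)%VF x.
have ps : forall i j, polynomial_entries (fun M => (weyl *m M) i j).
  move=> i j; rewrite (_ : (fun M => _) = fun M => weyl i 0 * M 0 j + weyl i 1 * M 1 j).
    by apply: PolyAdd; apply: PolyMul; (exact: PolyConst || exact: PolyEntry).
  by apply/funext => M; rewrite mxE sum2E.
have [s [t [pos pot e]]] := comaximal_powers R m'.+1 m.+1.
exists (fun M => s M * (M 0 0 * p' (weyl *m M)) + t M * (M 1 0 * p M)).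
  apply: PolyAdd; apply: PolyMul => //; apply: PolyMul; try exact: PolyEntry.
    exact: PolySubst.
  done.
move=> M dM; rewrite -[LHS]mul1r -(e M dM) mulrDl -!mulrA; congr (_ * _ + _ * _).
  rewrite exprS -mulrA; have [->|n0] := eqVneq (M 0 0) 0; first by rewrite !mul0r.
  congr (_ * _); have ec : (weyl *m M) 1 0 = M 0 0.
    by rewrite mxE sum2E !mx2E mul0r addr0 mul1r.
  rewrite -ep' ?ec ?det_mulmx ?det_weyl ?mul1r // lfunE /=; congr (_ * phi _).
  rewrite -[in LHS](mul1mx M) -ew -mulmxA (rep_mul hrho) ?lfunE //.
  by rewrite det_mulmx det_weyl mul1r.
rewrite exprS -mulrA; have [->|n0] := eqVneq (M 1 0) 0; first by rewrite !mul0r.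
by rewrite ep.
Qed.

End RegularCoefficients.

(** * Homogeneous fractions *)

Section Fractions.
Variables (R : realType) (P : mpoly 2 R[i]) (N : nat).
Hypotheses (N_gt0 : (0 < N)%N) (hP : homogeneous N P).
Local Notation C := R[i].
Local Notation vec := 'cV[C]_2.
Implicit Types (v : vec) (f F : vec -> C) (k : int).

(** Degree [k] elements of the localisation at [P]. Values are only compared where
    [P] does not vanish, since division by zero has a default value. *)
Definition hfrac k F : Prop := exists n m f, [/\ m%:Z = k + (n * N)%:Z, is_form m f
  & forall v, ev P v != 0 -> F v = f v / ev P v ^+ n].

Let fP : is_form N (ev P) := is_form_ev hP.

Lemma eq_hfrac k F F' : (forall v, ev P v != 0 -> F v = F' v) -> hfrac k F -> hfrac k F'.
Proof.
by move=> e [n [m [f [em hf ef]]]]; exists n, m, f; split=> // v Pv; rewrite -e // ef.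
Qed.

Lemma hfrac_form m f : is_form m f -> hfrac m f.
Proof.
move=> hf; exists 0%N, m, f; split=> //; first by rewrite mul0n addr0.
by move=> v _; rewrite expr0 divr1.
Qed.

Lemma hfracM k1 k2 F1 F2 : hfrac k1 F1 -> hfrac k2 F2 ->
  hfrac (k1 + k2) (fun v => F1 v * F2 v).
Proof.
move=> [n1 [m1 [f1 [e1 h1 E1]]]] [n2 [m2 [f2 [e2 h2 E2]]]].
exists (n1 + n2)%N, (m1 + m2)%N, (fun v => f1 v * f2 v); split.
- by rewrite !PoszD e1 e2 mulnDl PoszD; ring.
- exact: is_formM.
- by move=> v Pv; rewrite E1 // E2 // exprD invfM mulrACA.
Qed.

Lemma hfracZ k c F : hfrac k F -> hfrac k (fun v => c * F v).
Proof.
move=> h; rewrite -[k]add0r; apply: hfracM (h); apply: (@hfrac_form 0).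
exact: is_form_const.
Qed.

Lemma hfracD k F1 F2 : hfrac k F1 -> hfrac k F2 -> hfrac k (fun v => F1 v + F2 v).
Proof.
move=> [n1 [m1 [f1 [e1 h1 E1]]]] [n2 [m2 [f2 [e2 h2 E2]]]].
exists (n1 + n2)%N, (m1 + N * n2)%N,
  (fun v => f1 v * ev P v ^+ n2 + f2 v * ev P v ^+ n1); split.
- by rewrite !PoszD e1 mulnDl PoszD mulnC; ring.
- apply: is_formD; first by apply: is_formM => //; apply: is_formX.
  have -> : (m1 + N * n2 = m2 + N * n1)%N by apply/eqP; rewrite -eqz_nat; lia.
  by apply: is_formM => //; apply: is_formX.
- move=> v Pv; rewrite E1 // E2 // exprD mulrDl.
  have nk n : ev P v ^+ n != 0 by exact: expf_neq0.
  rewrite !invfM; congr (_ + _).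
    by rewrite mulrACA divff // mulr1.
  by rewrite -mulrA [ev P v ^+ n1 * _]mulrA divff // mul1r.
Qed.

Lemma hfrac0 k : hfrac k (fun=> 0).
Proof.
exists `|k|%N, `|(k + (`|k| * N)%N%:Z)%R|%N, (fun=> 0); split; [|exact: is_form0|].
  by rewrite gez0_abs //; nia.
by move=> v _; rewrite mul0r.
Qed.

Lemma hfrac_sum (I : Type) (s : seq I) k (F : I -> vec -> C) :
  (forall i, hfrac k (F i)) -> hfrac k (fun v => \sum_(i <- s) F i v).
Proof.
move=> h; elim: s => [|i s IH].
  by apply: eq_hfrac (hfrac0 k) => v _; rewrite big_nil.
by apply: eq_hfrac (hfracD (h i) IH) => v _; rewrite big_cons.
Qed.

Lemma evP_scale t v : t != 0 -> (ev P (t *: v) != 0) = (ev P v != 0).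
Proof.
move=> t0; rewrite (is_form_scale _ _ fP) mulf_eq0 negb_or expf_neq0 //.
Qed.

Lemma hfrac_scale k F t v : hfrac k F -> t != 0 -> ev P v != 0 ->
  F (t *: v) = t ^ k * F v.
Proof.
move=> [n [m [f [em hf ef]]]] t0 Pv; rewrite !ef ?evP_scale //.
rewrite (is_form_scale _ _ hf) (is_form_scale _ _ fP) exprMn invfM mulrACA.
congr (_ * _); rewrite exprnP em expfzDr // -exprM -exprnP mulnC -mulrA divff ?mulr1 //.
exact: expf_neq0.
Qed.

(** The degrees are recorded with the summands: they are the exponents of [t] when
    [F (t *: v)] is expanded. *)
Definition fraction F : Prop := exists (I : finType) (k : I -> int) (h : I -> vec -> C),
  (forall i, hfrac (k i) (h i)) /\ forall v, ev P v != 0 -> F v = \sum_i h i v.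

Lemma fraction_hfrac k F : hfrac k F -> fraction F.
Proof.
move=> h; exists 'I_1, (fun=> k), (fun=> F); split=> // v _.
by rewrite big_ord1.
Qed.

Lemma fractionD F1 F2 : fraction F1 -> fraction F2 -> fraction (fun v => F1 v + F2 v).
Proof.
move=> [I1 [k1 [h1 [H1 E1]]]] [I2 [k2 [h2 [H2 E2]]]].
exists (I1 + I2)%type, (fun i => match i with inl j => k1 j | inr j => k2 j end),
  (fun i => match i with inl j => h1 j | inr j => h2 j end); split=> [[] //|v Pv].
by rewrite big_sumType /= E1 // E2.
Qed.

Lemma fractionM F1 F2 : fraction F1 -> fraction F2 -> fraction (fun v => F1 v * F2 v).
Proof.
move=> [I1 [k1 [h1 [H1 E1]]]] [I2 [k2 [h2 [H2 E2]]]].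
exists (I1 * I2)%type, (fun i => k1 i.1 + k2 i.2), (fun i v => h1 i.1 v * h2 i.2 v).
split=> [i|v Pv]; first exact: hfracM.
by rewrite E1 // E2 // big_distrlr /= pair_big.
Qed.

Lemma fraction_sum (I : Type) (s : seq I) (F : I -> vec -> C) :
  (forall i, fraction (F i)) -> fraction (fun v => \sum_(i <- s) F i v).
Proof.
move=> h; elim: s => [|i s IH].
  rewrite (_ : (fun v => _) = fun=> 0); first exact: fraction_hfrac (hfrac0 0).
  by apply/funext => v; rewrite big_nil.
rewrite (_ : (fun v => _) = fun v => F i v + \sum_(j <- s) F j v); first exact: fractionD.
by apply/funext => v; rewrite big_cons.
Qed.

Lemma fraction_polynomial (f : 'M[C]_2 -> C) (A : vec -> 'M[C]_2) :
  polynomial_entries f -> (forall i j, fraction (fun v => A v i j)) ->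
  fraction (fun v => f (A v)).
Proof.
move=> pf hA; elim: pf => [c|i j|f1 f2 _ p1 _ p2|f1 f2 _ p1 _ p2].
- exact: fraction_hfrac (hfrac_form (is_form_const c)).
- exact: hA.
- exact: fractionD.
- exact: fractionM.
Qed.

(** A fraction that scales by the character [t ^ k] equals its component of
    degree [k]: compare the coefficients of the Laurent polynomial in [t]. *)
Lemma hfrac_of_fraction k F : fraction F ->
  (forall t v, t != 0 -> ev P v != 0 -> F (t *: v) = t ^ k * F v) -> hfrac k F.
Proof.
move=> [I [kk [h [H E]]]] hF.
apply: (@eq_hfrac _ (fun v => \sum_(i | kk i == k) h i v)); last first.
  apply: (@eq_hfrac _ (fun v => \sum_i (kk i == k)%:R * h i v)).
    by move=> v _; rewrite [RHS]big_mkcond; apply: eq_bigr => i _; rewrite mulr_natl mulrb.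
  apply: hfrac_sum => i; have [<-|_] := eqVneq (kk i) k; first exact: hfracZ.
  by apply: eq_hfrac (hfrac0 k) => v _; rewrite mul0r.
move=> v Pv.
pose M := (`|k| + \sum_i `|kk i|)%N.
have Mk i : 0 <= kk i + M%:Z by rewrite /M (bigD1 i) //=; lia.
have Mk0 : 0 <= k + M%:Z by rewrite /M; lia.
pose e i := `|(kk i + M%:Z)%R|%N; pose e0 := `|(k + M%:Z)%R|%N.
pose q : {poly C} := \sum_i h i v *: 'X^(e i) - F v *: 'X^e0.
have q0 : q = 0.
  apply: poly_eq0 => t t0; rewrite !hornerE horner_sum.
  have := hF t v t0 Pv; rewrite E ?evP_scale // => e1.
  have te n (n0 : 0 <= n + M%:Z) : t ^+ `|(n + M%:Z)%R|%N = t ^ n * t ^+ M.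
    by rewrite exprnP gez0_abs // expfzDr.
  apply/eqP; rewrite subr_eq0 ?hornerE /e0 te // mulrA [F v * _]mulrC -e1 big_distrl /=.
  apply/eqP/eq_bigr => i _; rewrite ?hornerE /e te // (hfrac_scale (H i) t0 Pv).
  by rewrite mulrA [h i v * _]mulrC.
have : q`_e0 = 0 by rewrite q0 coef0.
rewrite coefB coef_sum coefZ coefXn eqxx mulr1 => /eqP; rewrite subr_eq0 => /eqP <-.
rewrite [LHS]big_mkcond; apply: eq_bigr => i _; rewrite coefZ coefXn.
have -> : (e0 == e i) = (kk i == k).
  by rewrite /e0 /e -eqz_nat !gez0_abs // (inj_eq (addIr _)) eq_sym.
by case: eqP => _; rewrite ?mulr1 ?mulr0.
Qed.

End Fractions.

(** * The fundamental matrix *)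

(** Cramer's rule for the transpose of a matrix of determinant 1. *)
Lemma cotangent_solve (K : comNzRingType) (u0 u1 u2 u3 c x y a b : K) :
  u0 * u3 - u1 * u2 = 1 -> c * a = u0 * x + u2 * y -> c * b = u1 * x + u3 * y ->
  y = c * (u0 * b - u1 * a) /\ - x = c * (u2 * b - u3 * a).
Proof.
move=> dU g0 g1; rewrite !mulrBr !(mulrCA c) g0 g1.
split; [transitivity ((u0 * u3 - u1 * u2) * y) | transitivity (- ((u0 * u3 - u1 * u2) * x))].
- by rewrite dU mul1r.
- by ring.
- by rewrite dU mul1r.
- by ring.
Qed.

Section FundamentalMatrix.
Variables (R : realType) (P : mpoly 2 R[i]) (N : nat).
Hypotheses (N_gt0 : (0 < N)%N) (hP : homogeneous N P).
Local Notation C := R[i].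
Local Notation vec := 'cV[C]_2.
Implicit Types (v : vec) (U : 'M[C]_2).

Lemma degree_homogeneous : P != 0 -> degree P = N.
Proof.
move=> nP; rewrite /degree; suff -> : msize P = N.+1 by [].
apply/eqP; rewrite eqn_leq mmeasureE; apply/andP; split.
  by apply/bigmax_leqP_seq => m mP _; rewrite (dhomog_mf hP mP).
have l := mlead_supp nP.
by rewrite (big_rem _ l) /= (dhomog_mf hP l) leq_maxl.
Qed.

Lemma is_form_deriv i : is_form N.-1 (ev (mderiv i P)).
Proof.
apply: is_form_ev; apply/dhomogP => m.
rewrite mcoeff_msupp mcoeff_mderiv mulrn_eq0 negb_or /= -mcoeff_msupp => mP.
have e : mdeg (mnm_add m (mnm1 i)) = N := dhomog_mf hP mP.
by rewrite -e mdegD mdeg1 addn1.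
Qed.

(** [Phi1] as a function on the whole plane, to be evaluated at [t *: v] and
    [U *m v]. *)
Definition Phi_mx v : 'M[C]_2 :=
  mx2 (ev (mderiv 1 P) v / (N%:R * ev P v)) (v 0 0)
      (- (ev (mderiv 0 P) v / (N%:R * ev P v))) (v 1 0).

Let N0 : (N%:R : C) != 0.
Proof. by rewrite pnatr_eq0 -lt0n. Qed.

Lemma Phi_mx_fraction i j : fraction P N (fun v => Phi_mx v i j).
Proof.
have hD l c : hfrac P N (-1) (fun v => c * (ev (mderiv l P) v / (N%:R * ev P v))).
  exists 1%N, N.-1, (fun v => c / N%:R * ev (mderiv l P) v); split.
  - by rewrite mul1n; lia.
  - by apply: is_formZ; exact: is_form_deriv.
  - move=> v _; rewrite expr1 invfM.
    by move: (ev (mderiv l P) v) (ev P v)^-1 (N%:R^-1 : C) => x y n; ring.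
have hX l : hfrac P N 1 (fun v => v l 0) := hfrac_form P N (is_form_coord _ l).
case: (I2P i) => ->; case: (I2P j) => ->; apply: fraction_hfrac.
- by apply: eq_hfrac (hD 1 1) => v _; rewrite mx2E mul1r.
- by apply: eq_hfrac (hX 0) => v _; rewrite mx2E.
- by apply: eq_hfrac (hD 0 (-1)) => v _; rewrite mx2E mulN1r.
- by apply: eq_hfrac (hX 1) => v _; rewrite mx2E.
Qed.

(** The determinant is Euler's relation divided by [N * P]. *)
Lemma det_Phi_mx v : ev P v != 0 -> \det (Phi_mx v) = 1.
Proof.
move=> Pv; rewrite det2E !mx2E.
have := euler v hP; rewrite -!/(ev _ _) => e.
have nD : N%:R * ev P v != 0 by rewrite mulf_neq0.
rewrite mulrN opprK [_ * v 1 0]mulrAC mulrA -mulrDl.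
rewrite [_ * v 1 0]mulrC addrC.
by apply: (mulIf nD); rewrite mulfVK // mul1r -e.
Qed.

(** The gradient is a covector, but a matrix of determinant 1 preserves the area
    form, which turns it into the vector that is the first column. *)
Lemma Phi_mx_equivariant U c : \det U = 1 ->
  (forall v, ev P (U *m v) = c * ev P v) -> forall v, ev P v != 0 ->
  ev P (U *m v) != 0 -> Phi_mx (U *m v) = U *m Phi_mx v.
Proof.
move=> dU cP v Pv PUv; have [g0 g1] := gradient_equivariant cP v.
have nc : c != 0 by apply: contraNneq PUv => c0; rewrite cP c0 mul0r.
rewrite det2E in dU; move: g0 g1; rewrite -!/(ev _ _) => g0 g1.
have [ey ex] : ev (mderiv 1 P) (U *m v) =
    c * (U 0 0 * ev (mderiv 1 P) v - U 0 1 * ev (mderiv 0 P) v) /\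
  - ev (mderiv 0 P) (U *m v) = c * (U 1 0 * ev (mderiv 1 P) v - U 1 1 * ev (mderiv 0 P) v).
  exact: cotangent_solve dU g0 g1.
apply: mx2P; rewrite [in RHS]mulmx2 !mx2E ?mulmx2E //; rewrite cP -?mulNr ?ey ?ex.
all: move: N0 nc Pv; move: (ev P v) (ev (mderiv 0 P) v) (ev (mderiv 1 P) v).
all: move: (U 0 0) (U 0 1) (U 1 0) (U 1 1) (N%:R : C) => u0 u1 u2 u3 n p a b n0 nc p0.
all: by field; rewrite p0 nc n0.
Qed.

(** The columns have degrees [-1] and [1]. *)
Lemma Phi_mx_scale t v : t != 0 -> ev P v != 0 -> Phi_mx (t *: v) = Phi_mx v *m torus t^-1.
Proof.
move=> t0 Pv; have fP := is_form_ev hP.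
have hs i : ev (mderiv i P) (t *: v) = t ^+ N.-1 * ev (mderiv i P) v.
  exact: is_form_scale (is_form_deriv i).
have eP : ev P (t *: v) = t * t ^+ N.-1 * ev P v.
  by rewrite -exprS prednK //; exact: is_form_scale fP.
apply: mx2P; rewrite [in RHS]mulmx2 !mx2E ?invrK ?mulr0 ?addr0 ?add0r ?mxE ?hs ?eP.
2,4: by rewrite mulrC.
all: have := expf_neq0 N.-1 t0; move: N0 t0 Pv; move: (t ^+ N.-1) (ev P v) (N%:R : C).
all: move: (ev (mderiv 0 P) v) (ev (mderiv 1 P) v) => a b s p n n0 t0 p0 s0.
all: by field; rewrite t0 p0 s0 n0.
Qed.

End FundamentalMatrix.

(** * Vector-valued functions in the localisation *)

Section InverseMatrix.
Variable R : realType.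
Local Notation C := R[i].
Implicit Types M : 'M[C]_2.

Definition adj2 M : 'M[C]_2 := mx2 (M 1 1) (- M 0 1) (- M 1 0) (M 0 0).

Lemma invmx_adj2 M : \det M = 1 -> invmx M = adj2 M.
Proof.
move=> dM; have uM : M \in unitmx by rewrite unitmxE dM unitr1.
rewrite -[LHS]mulmx1 (_ : 1%:M = M *m adj2 M) ?mulKmx //.
move: dM; rewrite det2E => dM.
apply: mx2P; rewrite ![in RHS]mulmx2 !mx2E [LHS]mxE /= -1?dM.
all: by move: (M 0 0) (M 0 1) (M 1 0) (M 1 1) => *; ring.
Qed.

Lemma polynomial_adj2 i j : polynomial_entries (fun M => adj2 M i j).
Proof.
have hN k l : polynomial_entries (fun M : 'M[C]_2 => - M k l).
  rewrite (_ : (fun M => _) = fun M => -1 * M k l).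
    by apply: PolyMul; [exact: PolyConst | exact: PolyEntry].
  by apply/funext => M; rewrite mulN1r.
have e (f : 'M[C]_2 -> C) : polynomial_entries f -> (forall M, adj2 M i j = f M) ->
    polynomial_entries (fun M => adj2 M i j).
  by move=> pf /funext ->.
case: (I2P i) e => ->; case: (I2P j) => -> e.
- by apply: (e (fun M => M 1 1)) => [|M]; [exact: PolyEntry | rewrite mx2E].
- by apply: (e (fun M => - M 0 1)) => // M; rewrite mx2E.
- by apply: (e (fun M => - M 1 0)) => // M; rewrite mx2E.
- by apply: (e (fun M => M 0 0)) => [|M]; [exact: PolyEntry | rewrite mx2E].
Qed.

Variables (g : vectType C) (br : g -> g -> g) (rho : 'M[C]_2 -> 'End(g)).
Hypothesis hrho : lie_group_rep br rho.

Lemma inverse_coefficient_regular (phi : 'Hom(g, C^o)) x :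
  sl2_regular (fun M => phi (rho (invmx M) x)).
Proof.
have [|p pp ep] := @sl2_regular_subst R (fun M => phi (rho M x)) adj2
  (coefficient_regular hrho phi x) polynomial_adj2.
  by move=> M dM; rewrite -invmx_adj2 // det_inv dM invr1.
by exists p => // M dM; rewrite -ep // invmx_adj2.
Qed.

Lemma rep_invK M x : \det M = 1 -> rho (invmx M) (rho M x) = x.
Proof.
move=> dM; have uM : M \in unitmx by rewrite unitmxE dM unitr1.
have := rep_mul hrho (A := invmx M) (B := M).
rewrite det_inv dM invr1 mulVmx // (rep_one hrho) => /(_ erefl erefl) /lfunP /(_ x).
by rewrite !lfunE.
Qed.

Lemma rep_Kinv M x : \det M = 1 -> rho M (rho (invmx M) x) = x.
Proof.
move=> dM; rewrite -[M in rho M]invmxK; apply: rep_invK.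
by rewrite det_inv dM invr1.
Qed.

Lemma rep_mulE A B x : \det A = 1 -> \det B = 1 -> rho (A *m B) x = rho A (rho B x).
Proof. by move=> dA dB; rewrite (rep_mul hrho) // lfunE. Qed.

End InverseMatrix.

Section LocalizedFunctions.
Variables (R : realType) (P : mpoly 2 R[i]) (N : nat).
Hypotheses (N_gt0 : (0 < N)%N) (hP : homogeneous N P) (degP : degree P = N).
Local Notation C := R[i].
Local Notation vec := 'cV[C]_2.
Implicit Types (k : int) (F : vec -> C).

Let fP : is_form N (ev P) := is_form_ev hP.

(** The denominators are raised to a common power of [P]. *)
Lemma hfrac_common (I : finType) k (F : I -> vec -> C) : (forall i, hfrac P N k (F i)) ->
  exists n m (q : I -> mpoly 2 C), [/\ m%:Z = k + (n * N)%:Z, forall i, homogeneous m (q i) &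
    forall i v, ev P v != 0 -> F i v = ev (q i) v / ev P v ^+ n].
Proof.
move=> /choice [n /choice [m /choice [f h]]].
pose n0 := (`|k| + \sum_i n i)%N; pose m0 := `|(k + (n0 * N)%N%:Z)%R|%N.
have ln i : (n i <= n0)%N by rewrite /n0 (bigD1 i) //=; lia.
have em : m0%:Z = k + (n0 * N)%:Z by rewrite gez0_abs // /n0; nia.
have /choice [q hq] i : exists q : mpoly 2 C, homogeneous m0 q /\
    forall v, f i v * ev P v ^+ (n0 - n i) = ev q v.
  have [emi hf _] := h i.
  have e0 : (m0 = m i + N * (n0 - n i))%N.
    by apply/eqP; rewrite -eqz_nat em; have := ln i; nia.
  have [q hq eq_] := is_formM hf (is_formX (n0 - n i) fP).
  by exists q; split; rewrite ?e0.
exists n0, m0, q; split=> [//|i|i v Pv]; first by have [] := hq i.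
have [_ _ ef] := h i; have [_ eq_] := hq i.
rewrite ef // -eq_ -{2}(subnK (ln i)) exprD invfM mulrA mulfK ?expf_neq0 //.
Qed.

Lemma localized_hom (V : vectType C) k (f : domain P -> V) (phi : 'Hom(V, C^o)) :
  localized k f -> exists2 F, hfrac P N k F & forall v, phi (f v) = F (val v).
Proof.
move=> [n [m [r [q [x [em hq ->]]]]]]; rewrite degP in em.
exists (fun v => (\sum_(j < r) phi (x j) * ev (q j) v) / ev P v ^+ n).
  exists n, m, (fun v => \sum_(j < r) phi (x j) * ev (q j) v); split=> //.
  by apply: is_form_sum => j; apply: is_formZ; exact: form_of_homogeneous (hq j).
move=> v; rewrite linear_sum big_distrl /=; apply: eq_bigr => j _.
rewrite linearZ /= -[_ *: _]/(_ * _).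
by rewrite mulrC mulrA.
Qed.

Lemma localized_scalar k (a : domain P -> C^o) :
  localized k a <-> exists2 F, hfrac P N k F & forall v, a v = F (val v).
Proof.
split=> [[n [m [r [q [x [em hq ->]]]]]]|[F [n [m [f [em [q hq eq_] ef]]]] ea]].
  rewrite degP in em.
  exists (fun v => (\sum_(j < r) x j * ev (q j) v) / ev P v ^+ n).
    exists n, m, (fun v => \sum_(j < r) x j * ev (q j) v); split=> //.
    by apply: is_form_sum => j; apply: is_formZ; exact: form_of_homogeneous (hq j).
  move=> v; rewrite big_distrl /=; apply: eq_bigr => j _.
  rewrite -[_ *: _]/(_ * _).
  by rewrite mulrC mulrA.
exists n, m, 1%N, (fun=> q), (fun=> 1); rewrite degP; split=> //.
apply/funext => v; rewrite big_ord1 ea (ef _ (valP v)) eq_.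
exact: esym (mulr1 _).
Qed.

Lemma localized_coord (V : vectType C) (I : finType) (e : I -> V) k (f : domain P -> V)
    (F : I -> vec -> C) : (forall i, hfrac P N k (F i)) ->
  (forall v, f v = \sum_i F i (val v) *: e i) -> localized k f.
Proof.
move=> /hfrac_common [n [m [q [em hq eq_]]]] ef.
exists n, m, #|I|, (fun j => q (enum_val j)), (fun j => e (enum_val j)).
rewrite degP; split=> //; apply/funext => v.
rewrite ef (reindex_onto (@enum_val I I) enum_rank) /=; last first.
  by move=> i _; rewrite enum_rankK.
rewrite big_mkcond /= [RHS]big_mkcond /=; apply: eq_bigr => j _.
by rewrite enum_valK eqxx eq_ ?(valP v).
Qed.

End LocalizedFunctions.

(** * The automorphic Lie algebra *)

Section AutomorphicLieAlgebra.
Variables (R : realType) (G : {fset 'M[R]_3}).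
Hypothesis hG : finite_subgroup_SO3 G.
Local Notation C := R[i].
Local Notation vec := 'cV[C]_2.
Local Notation line := {vspace 'cV[C]_2}.
Local Notation B := (binary_group G).
Local Notation N := #|` G|.
Variables (Omega : finType) (Sx : Omega -> set line).
Hypotheses (hSx_inj : injective Sx) (hSx : range Sx = exceptional_orbits G).
Variables (d nu : Omega -> nat).
Hypotheses (hd : forall i, d i = #|` fset_set (Sx i)|)
  (hnu : forall i L, Sx i L -> stab_order G L = nu i).
Variable p : Omega -> mpoly 2 C.
Hypotheses (hp_neq0 : forall i, p i != 0)
  (hp_hom : forall i, homogeneous (d i) (p i))
  (hp_van : forall i L, Sx i L -> vanishes_on (p i) L).
Variables (S : set line) (hS : is_orbit G S) (P : mpoly 2 C).
Hypotheses (hP_hom : homogeneous N P)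
  (hP_zero : forall L, \dim L = 1%N -> (vanishes_on P L <-> S L))
  (hP_inv : relatively_invariant B P).
Variables (g : vectType C) (br : g -> g -> g) (rho : 'M[C]_2 -> 'End(g)).
Hypothesis hrho : lie_group_rep br rho.
Variables (e : 'I_(\dim {:g}) -> g) (kappa : 'I_(\dim {:g}) -> int)
  (phi : 'I_(\dim {:g}) -> 'Hom(g, C^o)).
Hypothesis he : forall i, drho rho (mx2 1 0 0 (-1)) (e i) = (kappa i)%:~R *: e i.
Hypothesis hx : forall x, x = \sum_i phi i x *: e i.
Hypothesis dual : forall i j, phi i (e j) = (i == j)%:R.
Implicit Types (U : 'M[C]_2) (v : vec) (z : domain P) (k : int) (x y : g).

Local Notation Pf := (Pk_fun G P d nu p).
Local Notation Pz := (Pk N d nu p).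
Local Notation Ph := (Phi_mx P N).

Let N0 : (0 < N)%N := group_card_gt0 hG.
Let degP : degree P = N := degree_homogeneous hP_hom (P_neq0 hG hS hP_zero).

Lemma Phi1E z : Phi1 z = Ph (val z).
Proof. by rewrite /Phi1 degP. Qed.

Lemma PhiE z : Phi rho z = rho (Ph (val z)).
Proof. by rewrite /Phi Phi1E. Qed.

Lemma det_Ph z : \det (Ph (val z)) = 1.
Proof. exact: (det_Phi_mx N0 hP_hom (valP z)). Qed.

Lemma PkE k z : (2 %| k)%Z -> Pz k z = Pf k (val z).
Proof. by move=> k2; rewrite /Pk k2. Qed.

Lemma Pk_odd k z : ~~ (2 %| k)%Z -> Pz k z = 0.
Proof. by move=> /negPf k2; rewrite /Pk k2. Qed.

(** [P] is semi-invariant for the inverse of [U]. *)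
Lemma domain_stable U v : B U -> ev P v != 0 -> ev P (U *m v) != 0.
Proof.
move=> bU Pv; have [c hc] := semi_invariant_ev hG hP_inv (binaryV hG bU).
apply: contraNneq Pv => h; have uU : U \in unitmx.
  by rewrite unitmxE (binary_det bU) unitr1.
by have := hc (U *m v); rewrite mulmxA mulVmx // mul1mx h mulr0 => ->.
Qed.

Definition move_domain U z : domain P := insubd z (U *m val z).

Lemma val_move U z : B U -> val (move_domain U z) = U *m val z.
Proof. by move=> bU; apply: insubdK; exact: domain_stable bU (valP z). Qed.

Lemma Ph_equivariant U v : B U -> ev P v != 0 -> Ph (U *m v) = U *m Ph v.
Proof.
move=> bU Pv; have [c hc] := semi_invariant_ev hG hP_inv bU.
exact: (Phi_mx_equivariant N0 (binary_det bU) hc Pv (domain_stable bU Pv)).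
Qed.

Lemma weight_spaceP k x : x \in weight_space rho k ->
  drho rho (mx2 1 0 0 (-1)) x = k%:~R *: x.
Proof.
rewrite memv_ker add_lfunE opp_lfunE scale_lfunE id_lfunE subr_eq0.
by move=> /eqP.
Qed.

Lemma weight_space_basis i : e i \in weight_space rho (kappa i).
Proof. by rewrite memv_ker add_lfunE opp_lfunE scale_lfunE id_lfunE he subrr. Qed.

Lemma weight_coord k x i : x \in weight_space rho k -> kappa i != k -> phi i x = 0.
Proof.
move=> /weight_spaceP hk ne; have : (kappa i)%:~R * phi i x = k%:~R * phi i x.
  have eL : phi i (k%:~R *: x) = k%:~R * phi i x by exact: linearZ.
  rewrite -eL -hk {2}(hx x) !linear_sum /= (bigD1 i) //=.
  rewrite big1 ?addr0 => [|j ji]; rewrite !linearZ /= he linearZ /= dual.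
    by rewrite eqxx -[_ *: _]/(_ * (_ * _)) mulr1 mulrC.
  by rewrite eq_sym (negPf ji) !scaler0.
move=> /eqP; rewrite -subr_eq0 -mulrBl mulf_eq0 -rmorphB /= intr_eq0 subr_eq0.
by rewrite (negPf ne) => /eqP.
Qed.

Definition W k : set (domain P -> g) :=
  [set (fun z => Pz k z *: Phi rho z x) | x in [set x | x \in weight_space rho k]].

(** [Phi] is invertible at each point and distinct weight spaces are independent. *)
Lemma weight_sum_direct : sum_direct W.
Proof.
move=> s w Ww sum0 k ks.
have /choice [x hw] l : exists x, x \in weight_space rho l /\
    w l = fun z => Pz l z *: Phi rho z x.
  by have [x hl <-] := Ww l; exists x.
apply/funext => z; have [hk ->] := hw k.
suff e0 : Pz k z *: x k = 0 by rewrite -linearZ /= e0 linear0.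
have s0 : \sum_(l <- s) Pz l z *: x l = 0.
  rewrite -(rep_invK hrho (\sum_(l <- s) Pz l z *: x l) (det_Ph z)) -PhiE.
  have -> : Phi rho z (\sum_(l <- s) Pz l z *: x l) = 0; last by rewrite linear0.
  rewrite linear_sum -[RHS](sum0 z); apply: eq_bigr => l _.
  by have [_ ->] := hw l; rewrite linearZ.
rewrite [LHS]hx big1 // => i _.
have [ei|ni] := eqVneq (kappa i) k; last first.
  by rewrite linearZ /= (weight_coord hk ni) scaler0 scale0r.
have := congr1 (phi i) s0; rewrite linear0 linear_sum (big_fsetD1 k ks) /=.
rewrite big1_fset ?addr0 => [->|l]; first by rewrite scale0r.
rewrite !inE => /andP[lk _] _; rewrite linearZ /=.
have [hl _] := hw l; rewrite (weight_coord hl) ?scaler0 //.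
by rewrite ei eq_sym.
Qed.

Lemma hfrac_power (l : int) : hfrac P N (l * N%:Z) (fun v => ev P v ^ l).
Proof.
have fP := is_form_ev hP_hom.
case: l => l.
  by rewrite -PoszM (mulnC l); exact: hfrac_form (is_formX l fP).
exists l.+1, 0%N, (fun=> 1); split; [by rewrite NegzE; lia | exact: is_form_const |].
by move=> v _; rewrite NegzE -exprnN mul1r.
Qed.

Lemma Pk_hfrac k : (2 %| k)%Z -> hfrac P N k (Pf k).
Proof.
move=> k2; rewrite -[k in hfrac _ _ k](Pk_degree hG hSx_inj hSx hd hnu k2).
apply: hfracM; first exact: hfrac_power.
apply: hfrac_form; rewrite (eq_bigr (fun i => d i * residue (nu i) k)%N); last first.
  by move=> i _; rewrite mulnC.
apply: is_form_prod => i; apply: is_formX; exact: form_of_homogeneous (hp_hom i).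
Qed.

Lemma Phi_fraction (h : 'M[C]_2 -> C) : sl2_regular h ->
  exists2 F, fraction P N F & forall v, ev P v != 0 -> F v = h (Ph v).
Proof.
move=> [q pq eq_]; exists (fun v => q (Ph v)).
  exact: (fraction_polynomial pq (Phi_mx_fraction N0 hP_hom)).
by move=> v Pv; rewrite eq_ // (det_Phi_mx N0 hP_hom Pv).
Qed.

Lemma eq_fraction F F' : (forall v, ev P v != 0 -> F v = F' v) ->
  fraction P N F -> fraction P N F'.
Proof. by move=> eF [I [k [h [H E]]]]; exists I, k, h; split=> // v Pv; rewrite -eF // E. Qed.

(** [Phi (t v) = Phi v torus(t^-1)], and [torus t^-1] acts on the weight space [k] by
    [t^-k]. *)
Lemma Phi_weight_hfrac k x i : x \in weight_space rho k ->
  hfrac P N (- k) (fun v => phi i (rho (Ph v) x)).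
Proof.
move=> xk; apply: (hfrac_of_fraction N0 hP_hom).
  have [F fF eF] := Phi_fraction (coefficient_regular hrho (phi i) x).
  by apply: eq_fraction fF.
move=> t v t0 Pv; rewrite (Phi_mx_scale N0 hP_hom t0 Pv).
have ti0 : t^-1 != 0 by rewrite invr_neq0.
rewrite (rep_mulE hrho) ?(det_Phi_mx N0 hP_hom Pv) ?det_torus //.
by rewrite (torus_weight hrho (weight_spaceP xk) ti0) !linearZ /= exprz_inv.
Qed.

(** For the inverse, [torus t] acts on the left, where it multiplies the component of
    weight [k] by [t^k]. *)
Lemma Phi_inverse_hfrac i (F : 'I_(\dim {:g}) -> vec -> C) :
  (forall j, hfrac P N 0 (F j)) ->
  hfrac P N (kappa i) (fun v => \sum_j F j v * phi i (rho (invmx (Ph v)) (e j))).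
Proof.
move=> hF; apply: (hfrac_of_fraction N0 hP_hom).
  apply: fraction_sum => [|j]; [exact: N0|]; apply: fractionM; first exact: fraction_hfrac (hF j).
  have [F' fF eF] := Phi_fraction (inverse_coefficient_regular hrho (phi i) (e j)).
  exact: eq_fraction eF fF.
move=> t v t0 Pv; have ti0 : t^-1 != 0 by rewrite invr_neq0.
have dP := det_Phi_mx N0 hP_hom Pv.
have uP : Ph v \in unitmx by rewrite unitmxE dP unitr1.
rewrite big_distrr /=; apply: eq_bigr => j _.
rewrite (hfrac_scale hP_hom (hF j) t0 Pv) expr0z mul1r mulrCA; congr (_ * _).
have -> : invmx (Ph (t *: v)) = torus t *m invmx (Ph v).
  rewrite (Phi_mx_scale N0 hP_hom t0 Pv); set A := Ph v *m torus _.
  have uA : A \in unitmx by rewrite unitmxE /A det_mulmx dP det_torus // mulr1 unitr1.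
  rewrite -[RHS](mulKmx uA) /A -mulmxA (mulmxA (torus t^-1)) torusM mulVf //.
  by rewrite torus1 mul1mx mulmxV // mulmx1.
rewrite (rep_mulE hrho) ?det_torus ?det_inv ?dP ?invr1 //.
exact: (torus_coord hrho he hx dual).
Qed.

(** [P_k] is invariant, and the factor [U] that [Phi] produces at the moved point
    cancels the action on values. *)
Lemma W_invariant k w U z : W k w -> B U ->
  rho U (w (move_domain (invmx U) z)) = w z.
Proof.
move=> [x _ <-] bU; have bV := binaryV hG bU.
have -> : Pz k (move_domain (invmx U) z) = Pz k z.
  have [k2|k2] := boolP (2 %| k)%Z; last by rewrite !(Pk_odd _ k2).
  rewrite !(PkE _ k2) (val_move z bV).
  exact: (Pk_invariant hG hS hP_hom hP_zero hP_inv hSx_inj hSx hd hnu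
            hp_neq0 hp_hom hp_van (val z) k2 bV).
rewrite linearZ /= !PhiE (val_move z bV) (Ph_equivariant bV (valP z)).
rewrite (rep_mulE hrho) ?(binary_det bV) ?det_Ph //.
by rewrite (rep_Kinv hrho _ (binary_det bU)).
Qed.

(** The degree [k] of [P_k] compensates the degree [- k] of [Phi] on the weight space. *)
Lemma W_coord k w i : W k w ->
  exists F, hfrac P N 0 F /\ forall z, phi i (w z) = F (val z).
Proof.
move=> [x xk <-]; have [k2|k2] := boolP (2 %| k)%Z; last first.
  exists (fun=> 0); split=> [|z]; first exact: (hfrac0 P N0).
  by rewrite Pk_odd // scale0r linear0.
exists (fun v => Pf k v * phi i (rho (Ph v) x)); split=> [|z].
  by rewrite -(subrr k); apply: hfracM; [exact: Pk_hfrac | exact: Phi_weight_hfrac].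
by rewrite linearZ /= PkE // PhiE.
Qed.

Lemma sum_of_invariant (y : domain P -> g) U z : sum_of W y -> B U ->
  rho U (y (move_domain (invmx U) z)) = y z.
Proof.
move=> [s [w [hw ->]]] bU; rewrite linear_sum; apply: eq_bigr => k _.
exact: (W_invariant z (hw k) bU).
Qed.

Lemma sum_of_coord (y : domain P -> g) i : sum_of W y ->
  exists F, hfrac P N 0 F /\ forall z, phi i (y z) = F (val z).
Proof.
move=> [s [w [hw ->]]].
have /choice [F hF] k := W_coord i (hw k).
exists (fun v => \sum_(k <- s) F k v); split=> [|z].
  by apply: hfrac_sum => // k; have [] := hF k.
rewrite linear_sum; apply: eq_bigr => k _; exact: (hF k).2.
Qed.

Lemma generated_automorphic :
  generated_module (invariant_functions P B) (sum_of W) `<=`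
  automorphic_lie_algebra P rho B.
Proof.
move=> f [n [a [y [ha hy ->]]]]; split.
  have /choice [A hA] j : exists A, hfrac P N 0 A /\ forall z, a j z = A (val z).
    by have [/(localized_scalar degP) [A h1 h2] _] := ha j; exists A.
  have hF i : exists F, forall j, hfrac P N 0 (F j) /\ forall z, phi i (y j z) = F j (val z).
    have /choice [F hF] j := sum_of_coord i (hy j).
    by exists F.
  have /choice [F {}hF] := hF.
  apply: (@localized_coord _ _ _ N0 hP_hom degP _ _ e 0 _
    (fun i v => \sum_j A j v * F i j v)) => [i|z].
    apply: hfrac_sum => // j; rewrite -[0]addr0.
    by apply: hfracM; [have [] := hA j | have [] := hF i j].
  rewrite [LHS]hx; apply: eq_bigr => i _; congr (_ *: _); rewrite linear_sum.
  apply: eq_bigr => j _; rewrite linearZ /=.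
  by have [_ ->] := hA j; have [_ ->] := hF i j.
move=> U bU; apply/funext => z; rewrite /act -/(move_domain _ _) linear_sum.
apply: eq_bigr => j _; rewrite linearZ /= (sum_of_invariant z (hy j) bU).
have [_ /(_ U bU)] := ha j.
by move=> /(congr1 (fun b => b z)) <-.
Qed.

(** The components of [Phi^-1 f] in the weight basis are invariant of degree equal to the
    weight, hence products of [P_k] with invariants of degree [0]. *)
Lemma component_factor (f : domain P -> g) i : automorphic_lie_algebra P rho B f ->
  exists a, invariant_functions P B a /\
    forall z, phi i (rho (invmx (Ph (val z))) (f z)) = Pz (kappa i) z * a z.
Proof.
move=> [lf invf].
have /choice [F hF] j : exists F, hfrac P N 0 F /\ forall z, phi j (f z) = F (val z).
  by have [F h1 h2] := localized_hom degP (phi j) lf; exists F.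
pose H v := \sum_j F j v * phi i (rho (invmx (Ph v)) (e j)).
have hH : hfrac P N (kappa i) H.
  by apply: Phi_inverse_hfrac => j; have [] := hF j.
have eH z : phi i (rho (invmx (Ph (val z))) (f z)) = H (val z).
  rewrite (hx (f z)) !linear_sum; apply: eq_bigr => j _.
  by rewrite !linearZ /=; have [_ ->] := hF j.
have invH U v : B U -> ev P v != 0 -> H (U *m v) = H v.
  move=> bU Pv; pose z : domain P := exist _ v Pv.
  have dU := binary_det bU; have uU : U \in unitmx by rewrite unitmxE dU unitr1.
  have ez : val (move_domain U z) = U *m v by rewrite (val_move z bU).
  have := congr1 (fun h => h (move_domain U z)) (invf U bU); rewrite /act.
  have -> : insubd (move_domain U z) (invmx U *m val (move_domain U z)) = z.
    apply: val_inj; rewrite ez mulKmx //.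
    by apply: insubdK; exact: Pv.
  move=> ef; have dP : \det (Ph v) = 1 := det_Ph z.
  rewrite -ez -eH -ef ez (Ph_equivariant bU Pv) -[v in RHS]/(val z) -eH.
  have uP : Ph v \in unitmx by rewrite unitmxE dP unitr1.
  congr (phi i _).
  have -> : invmx (U *m Ph v) = invmx (Ph v) *m invmx U.
    have uA : U *m Ph v \in unitmx by rewrite unitmxE det_mulmx dU dP mulr1 unitr1.
    rewrite -[RHS](mulKmx uA) -mulmxA (mulmxA (Ph v)) mulmxV // mul1mx mulmxV //.
    by rewrite mulmx1.
  rewrite (rep_mulE hrho) ?det_inv ?dP ?dU ?invr1 //.
  by rewrite (rep_invK hrho _ dU).
have [k2|k2] := boolP (2 %| kappa i)%Z; last first.
  (* In odd degree there are no invariants: [- 1] acts by a sign. *)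
  exists (fun=> 0); split.
    split; last by move=> U bU; apply/funext.
    apply/(localized_scalar degP).
    by exists (fun=> 0) => //; exact: (hfrac0 P N0).
  move=> z; rewrite mulr0 eH.
  have n1 : (-1 : C) != 0 by rewrite oppr_eq0 oner_neq0.
  have := hfrac_scale hP_hom hH n1 (valP z).
  rewrite scaleN1r -[- val z]mul1mx mulmxN -mulNmx.
  rewrite (invH _ _ (binaryN (binary1 hG)) (valP z)).
  have [m em] : exists m, kappa i = m * 2 + 1 by exists (kappa i %/ 2)%Z; lia.
  rewrite em expfzDr // mulrC -exprz_exp mulrC expr1z.
  have -> : ((-1) ^ m) ^ 2 = 1 :> C.
    by rewrite exprz_exp mulrC -exprz_exp -exprnP sqrrN expr1n exp1rz.
  rewrite mul1r mulN1r => /eqP; rewrite -subr_eq0 opprK -mulr2n mulrn_eq0 /=.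
  by move=> /eqP.
have [n [m [q [em hq eq_]]]] := hH.
have [n' [q' [hq' e' inv']]] := invariant_factor hG hS hP_hom hP_zero hP_inv hSx_inj hSx
  hd hnu hp_neq0 hp_hom hp_van k2 em hq
  (fun U v bU Pv => etrans (esym (eq_ _ (domain_stable bU Pv)))
     (etrans (invH U v bU Pv) (eq_ v Pv))).
exists (fun z => q' (val z) / ev P (val z) ^+ n'); split; last first.
  by move=> z; rewrite eH (eq_ _ (valP z)) (e' _ (valP z)) PkE.
split.
  apply/(localized_scalar degP); exists (fun v => q' v / ev P v ^+ n') => //.
  by exists n', (n' * N)%N, q'; split=> //; rewrite add0r.
move=> U bU; apply/funext => z; rewrite /act -/(move_domain _ _).
have bV := binaryV hG bU; rewrite (val_move z bV).
exact: (inv' _ _ bV (valP z)).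
Qed.

(** Expand [Phi^-1 f] in the weight basis and apply [Phi] again. *)
Lemma automorphic_generated :
  automorphic_lie_algebra P rho B `<=`
  generated_module (invariant_functions P B) (sum_of W).
Proof.
move=> f hf; have /choice [a ha] i := component_factor i hf.
exists (\dim {:g}), a, (fun i z => Pz (kappa i) z *: Phi rho z (e i)); split.
- by move=> i; have [] := ha i.
- move=> i; exists [fset kappa i]%fset, (fun k =>
    if k == kappa i then (fun z => Pz k z *: Phi rho z (e i)) else fun=> 0); split.
    move=> k; case: eqVneq => [->|_].
      by exists (e i) => //=; exact: weight_space_basis.
    exists 0; first by rewrite /= mem0v.
    by apply/funext => z; rewrite linear0 scaler0.
  by apply/funext => z; rewrite big_seq_fset1 eqxx.
- apply/funext => z; rewrite -[LHS](rep_Kinv hrho (f z) (det_Ph z)) -PhiE.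
  rewrite (hx (rho (invmx _) (f z))) linear_sum; apply: eq_bigr => i _.
  have [_ ->] := ha i; rewrite linearZ /= scalerA.
  by congr (_ *: _); rewrite mulrC.
Qed.

End AutomorphicLieAlgebra.

Theorem theorem3p4 (R : realType)
    (G : {fset 'M[R]_3}) (hG : finite_subgroup_SO3 G)
    (Omega : finType) (Sx : Omega -> set {vspace 'cV[R[i]]_2})
    (hSx_inj : injective Sx) (hSx : range Sx = exceptional_orbits G)
    (d nu : Omega -> nat)
    (hd : forall i, d i = #|` fset_set (Sx i)|)
    (hnu : forall i L, Sx i L -> stab_order G L = nu i)
    (p : Omega -> mpoly 2 R[i])
    (hp_neq0 : forall i, p i != 0)
    (hp_hom : forall i, homogeneous (d i) (p i))
    (hp_van : forall i L, Sx i L -> vanishes_on (p i) L)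
    (S : set {vspace 'cV[R[i]]_2}) (hS : is_orbit G S)
    (P : mpoly 2 R[i])
    (hP_hom : homogeneous #|` G| P)
    (hP_zero : forall L : {vspace 'cV[R[i]]_2}, \dim L = 1%N ->
       (vanishes_on P L <-> S L))
    (hP_inv : relatively_invariant (binary_group G) P)
    (g : vectType R[i]) (br : {bilinear g -> g -> g | *:%R & *:%R})
    (hbr : is_lie_bracket br)
    (rho : 'M[R[i]]_2 -> 'End(g)) (hrho : lie_group_rep br rho) :
  let W (k : int) : set (domain P -> g) :=
    [set (fun v => Pk #|` G| d nu p k v *: Phi rho v x)
      | x in [set x | x \in weight_space rho k]] in
  sum_direct W /\
  automorphic_lie_algebra P rho (binary_group G)
  = generated_module (invariant_functions P (binary_group G)) (sum_of W).
Proof.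
have [e [kappa [phi [he hx dual]]]] := weight_basis hrho.
split.
  exact: (weight_sum_direct hG hS hP_hom hP_zero hrho he hx dual).
apply/seteqP; split.
  exact: (automorphic_generated hG hSx_inj hSx hd hnu hp_neq0 hp_hom hp_van
            hS hP_hom hP_zero hP_inv hrho he hx dual).
exact: (generated_automorphic hG hSx_inj hSx hd hnu hp_neq0 hp_hom hp_van
          hS hP_hom hP_zero hP_inv hrho hx).
Qed.
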